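(* Let $d\geq 1$ be an integer. There exists a constant $c\in\mathbb{R}$ (not depending on $f$) such that for every radial function $f\in\mathcal{S}(\mathbb{R}^d)$ with $\|f\|_{2}=1$, $$2\int_{\mathbb{R}^d}|f(x)|^2\log|f(x)|\,dx+(d-1)\int_{\mathbb{R}^d}|f(x)|^2\log|x|\,dx\;\leq\;\int_{\mathbb{R}^d}|\widehat{f}(\xi)|^2\log|\xi|\,d\xi+c.$$
   Context: $\mathcal{S}(\mathbb{R}^d)$ is the Schwartz class, and $\|\cdot\|_2$ is the norm of $L^2(\mathbb{R}^d)$ with respect to Lebesgue measure. The Fourier transform is normalized as $\widehat{f}(\xi)=(2\pi)^{-d/2}\int_{\mathbb{R}^d}f(x)e^{-i\xi\cdot x}\,dx$. A function is radial if $f(x)$ depends only on $|x|$. The integrand $|f|^2\log|f|$ is understood to be $0$ where $f=0$. *)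

(* Defs.v *)
(* Built on MathComp-Analysis; R[i] is the field of complex numbers over R. *)
From HB Require Import structures.
From mathcomp Require Import all_boot all_order all_algebra.
From mathcomp Require Import complex.
From mathcomp Require Import all_classical all_reals all_analysis.

Set Implicit Arguments.
Unset Strict Implicit.
Unset Printing Implicit Defensive.

Import Order.TTheory GRing.Theory Num.Theory.
Import numFieldNormedType.Exports.

Local Open Scope classical_set_scope.
Local Open Scope ring_scope.
Local Open Scope complex_scope.

Definition rV_display : measure_display.
Proof. exact: default_measure_display. Qed.

(* R^n carries the product sigma-algebra, i.e. the one generated by the
   coordinate functions. *)
Section measurable_rV.
Context {R : realType} (n : nat).

Let coors : 'I_n -> 'rV[R]_n -> R := fun i x => x ord0 i.

Let rV_set0 : g_sigma_preimage coors set0.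
Proof. exact: sigma_algebra0. Qed.

Let rV_setC A : g_sigma_preimage coors A -> g_sigma_preimage coors (~` A).
Proof. exact: sigma_algebraC. Qed.

Let rV_bigcup (F : (set 'rV[R]_n)^nat) :
  (forall i, g_sigma_preimage coors (F i)) ->
  g_sigma_preimage coors (\bigcup_i (F i)).
Proof. exact: sigma_algebra_bigcup. Qed.

HB.instance Definition _ := @isMeasurable.Build rV_display
  'rV[R]_n (g_sigma_preimage coors) rV_set0 rV_setC rV_bigcup.

End measurable_rV.

Lemma measurable_coord (R : realType) n (i : 'I_n) :
  measurable_fun [set: 'rV[R]_n] (fun x => x ord0 i).
Proof.
move=> _ Y mY; rewrite setTI; apply: sub_sigma_algebra => /=.
rewrite -bigcup_seq/=; exists i => /=; first by rewrite mem_index_enum.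
by exists Y => //; rewrite setTI.
Qed.

Lemma measurable_fun_rV d (T : measurableType d) (R : realType) n
    (f : T -> 'rV[R]_n) :
  (forall i, measurable_fun [set: T] (fun t => f t ord0 i)) ->
  measurable_fun [set: T] f.
Proof.
move=> mf.
apply: measurability; first reflexivity.
move=> A [B]; rewrite -bigcup_seq => -[i _ [C mC <-]] <-.
by rewrite setTI; exact: mf.
Qed.

Section lebesgue_rV.
Context {R : realType}.

Definition consrV n (p : measurableTypeR R * 'rV[R]_n) : 'rV[R]_n.+1 :=
  row_mx (p.1 : R)%:M p.2.

Definition unconsrV n (x : 'rV[R]_n.+1) : measurableTypeR R * 'rV[R]_n :=
  (x ord0 ord0, \row_i x ord0 (lift ord0 i)).

Lemma consrV0 n p : @consrV n p ord0 ord0 = p.1.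
Proof.
have := row_mxEl (p.1 : R)%:M p.2 ord0 ord0.
rewrite [in RHS]mxE eqxx mulr1n => <-.
by congr (row_mx _ _ _ _); exact/val_inj.
Qed.

Lemma consrV_lift n p i : @consrV n p ord0 (lift ord0 i) = p.2 ord0 i.
Proof.
have <- := row_mxEr (p.1 : R)%:M p.2 ord0 i.
by congr (row_mx _ _ _ _); exact/val_inj.
Qed.

Lemma consrVK n : cancel (@consrV n) (@unconsrV n).
Proof.
move=> [t y]; rewrite /unconsrV consrV0; congr pair.
by apply/rowP => i; rewrite mxE consrV_lift.
Qed.

Lemma measurable_consrV n : measurable_fun setT (@consrV n).
Proof.
apply: measurable_fun_rV => i.
case: (unliftP ord0 i) => [j|] ->.
  under eq_fun do rewrite consrV_lift.
  exact: measurableT_comp (measurable_coord j) measurable_snd.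
under eq_fun do rewrite consrV0.
exact: measurable_fst.
Qed.

Lemma measurable_unconsrV n : measurable_fun setT (@unconsrV n).
Proof.
apply: measurable_fun_pair; first exact: (measurable_coord ord0).
apply: measurable_fun_rV => i.
under eq_fun do rewrite mxE.
exact: measurable_coord.
Qed.

Section lebesgue_cons.
Variables (n : nat) (mu : {sigma_finite_measure set 'rV[R]_n -> \bar R}).

Definition lebesgue_cons : set 'rV[R]_n.+1 -> \bar R :=
  pushforward (lebesgue_measure \x mu)%E (@consrV n).

Let push0 : lebesgue_cons set0 = 0%E.
Proof. by rewrite /lebesgue_cons /pushforward preimage_set0 measure0. Qed.

Let push_ge0 A : (0 <= lebesgue_cons A)%E.
Proof. exact: (measure_ge0 (lebesgue_measure \x mu)%E). Qed.

Let push_sigma_additive : semi_sigma_additive lebesgue_cons.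
Proof.
exact: (@measure_semi_sigma_additive _ _ _
  (measure_function_pushforward__canonical__measure_function_Measure
     (lebesgue_measure \x mu)%E (@measurable_consrV n))).
Qed.

HB.instance Definition _ := isMeasure.Build _ _ _ lebesgue_cons
  push0 push_ge0 push_sigma_additive.

Let push_sigma_finite : sigma_finite setT lebesgue_cons.
Proof.
have /sigma_finiteP[F [TF ndF Foo]] := sigma_finiteT (@lebesgue_measure R).
have /sigma_finiteP[G [TG ndG Goo]] := sigma_finiteT mu.
exists (fun k => @unconsrV n @^-1` (F k `*` G k)).
  rewrite -preimage_bigcup (_ : \bigcup_k _ = setT) ?preimage_setT//.
  rewrite -subTset => -[t y] _.
  have [k _ Ft] : (\bigcup_k F k) t by rewrite -TF.
  have [l _ Gy] : (\bigcup_l G l) y by rewrite -TG.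
  exists (maxn k l) => //; split => /=.
    by move: t Ft; exact/subsetPset/ndF/leq_maxl.
  by move: y Gy; exact/subsetPset/ndG/leq_maxr.
move=> k; have [mF Fk] := Foo k; have [mG Gk] := Goo k; split.
  rewrite -[X in measurable X]setTI.
  by apply: measurable_unconsrV => //; exact: measurableX.
rewrite /lebesgue_cons /pushforward -comp_preimage.
rewrite (_ : _ \o _ = id); last by apply/funext => p /=; rewrite consrVK.
by rewrite preimage_id product_measure1E// lte_mul_pinfty// ge0_fin_numE.
Qed.

HB.instance Definition _ := Measure_isSigmaFinite.Build _ _ _ lebesgue_cons
  push_sigma_finite.

End lebesgue_cons.

End lebesgue_rV.

(* Lebesgue measure on R^n, as the n-fold product of the one-dimensional one;
   R^0 is a point. *)
Fixpoint lebesgueRn (R : realType) n :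
    {sigma_finite_measure set 'rV[R]_n -> \bar R} :=
  match n with
  | 0 => (\d_(0 : 'rV[R]_0) : set 'rV[R]_0 -> \bar R)
  | m.+1 => lebesgue_cons (lebesgueRn R m)
  end.
Arguments lebesgueRn {R} n.

Lemma lebesgueRn_box (R : realType) n (A : 'I_n -> set R) :
  (forall i, measurable (A i)) ->
  lebesgueRn n [set x | forall i, A i (x ord0 i)] =
  (\prod_(i < n) lebesgue_measure (A i))%E.
Proof.
elim: n A => [|n IH] A mA.
  rewrite big_ord0 /= diracE mem_set //=.
  by case.
have mB : measurable [set x : 'rV[R]_n | forall i, A (lift ord0 i) (x ord0 i)].
  rewrite (_ : [set x | _] = \bigcap_(i in [set: 'I_n])
    [set x : 'rV[R]_n | A (lift ord0 i) (x ord0 i)]); last first.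
    by apply/seteqP; split => x /= Ax i; [move=> _|]; exact: Ax.
  apply: fin_bigcap_measurable => // i _.
  by rewrite -[X in measurable X]setTI; exact: measurable_coord.
rewrite big_ord_recl -(IH (fun i => A (lift ord0 i)))//.
rewrite /= /lebesgue_cons /pushforward -product_measure1E//; last exact: mA.
congr ((_ \x _)%E _); apply/seteqP; split => -[t y] /=.
  by move=> H; split => [|i]; [have := H ord0|have := H (lift ord0 i)];
    rewrite (consrV0, consrV_lift).
move=> [H0 H1] i.
by case: (unliftP ord0 i) => [j|] ->; rewrite (consrV0, consrV_lift).
Qed.

(* The library norm on 'rV[R]_n is the sup norm. *)
Definition enorm (R : realType) n (x : 'rV[R]_n) : R :=
  Num.sqrt (\sum_(i < n) x ord0 i ^+ 2).

Definition dotrV (R : realType) n (x y : 'rV[R]_n) : R :=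
  \sum_(i < n) x ord0 i * y ord0 i.

Definition radial (R : realType) n (T : Type) (f : 'rV[R]_n -> T) : Prop :=
  forall x y, enorm x = enorm y -> f x = f y.

Section complex_valued.
Context {R : realType} {n : nat}.
Implicit Types (f : 'rV[R]_n -> R[i]) (i : 'I_n) (s : seq 'I_n).

Local Notation Re := (@complex.Re R).
Local Notation Im := (@complex.Im R).

(* R[i] is a normed module over itself but not over R, so differentiation and
   integration of R[i]-valued functions go through real and imaginary parts. *)
Definition cpartial i f : 'rV[R]_n -> R[i] := fun x =>
  'D_(delta_mx ord0 i) (Re \o f) x +i* 'D_(delta_mx ord0 i) (Im \o f) x.

Definition iter_cpartial s f : 'rV[R]_n -> R[i] := foldr cpartial f s.

Definition has_cpartials f : Prop := forall i x,
  derivable (Re \o f) x (delta_mx ord0 i) /\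
  derivable (Im \o f) x (delta_mx ord0 i).

Definition csmooth f : Prop := forall s,
  [/\ has_cpartials (iter_cpartial s f),
      continuous (Re \o iter_cpartial s f) &
      continuous (Im \o iter_cpartial s f)].

(* The derivatives range over all sequences of coordinates rather than over
   multi-indices; on C^oo functions the two families are the same. *)
Definition schwartz f : Prop :=
  csmooth f /\
  forall (k : nat) s, exists C : R,
    forall x, enorm x ^+ k * Normc.normc (iter_cpartial s f x) <= C.

Definition cintegral f : R[i] :=
  (\int[lebesgueRn n]_x Re (f x)) +i* (\int[lebesgueRn n]_x Im (f x)).

Definition expi (t : R) : R[i] := cos t +i* sin t.

Definition fourier f : 'rV[R]_n -> R[i] := fun xi =>
  ((2 * pi) `^ (- (n%:R / 2)))%:C *
  cintegral (fun x => f x * expi (- dotrV xi x)).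

End complex_valued.

(* Main.v *)
(* Write [u = |f|] and [F] for the square modulus of the Fourier transform.
   Gaussian Plancherel bounds [\int expR (- (r |xi|)^2) F] by the heat form
   [\int \int u(x) u(y) h_r(x - y)], where [h_r] is the heat kernel of width [r];
   letting [r -> 0] gives [\int F = \int u^2 = 1].

   For [r = 4^k] split [u = a + b] at height [M_k = 2^-k |x|^(-(d-1)/2)], with [a]
   the part where [u <= M_k].  The form of [a] is at most [\int a^2] since [h_r]
   has mass one.  As [u] is radial, [h_r] may be averaged over spheres, which turns
   the bound [r^-d] on it into [C r^-1 |y|^-(d-1) = C M_k^2]; together with
   [u <= (u^2 / M_k + M_k) / 2] this gives [h_r * u <= C' M_k], so the terms
   containing [b] contribute at most [2 C' \int M_k b].

   Sum over [-N <= k < N].  Up to bounded errors the left-hand sides add up to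
   [N - \int F log2 |xi| / 2] and the [\int a^2] to
   [N - \int u^2 log2 (u |x|^((d-1)/2))], while the sum over [k] of [M_k b] is
   geometric and at most [2 u^2].  The [N]'s cancel. *)
Require Import Defs.
From mathcomp Require Import all_boot all_order all_algebra.
From mathcomp Require Import complex.
From mathcomp Require Import all_classical all_reals all_analysis.
From mathcomp Require Import measurable_realfun ring lra.

Set Implicit Arguments.
Unset Strict Implicit.
Unset Printing Implicit Defensive.

Import Order.TTheory GRing.Theory Num.Theory.
Import numFieldNormedType.Exports.

Local Open Scope classical_set_scope.
Local Open Scope ring_scope.
Local Open Scope complex_scope.

(** * Lebesgue measure on R^n *)

(** The constant may not depend on [f], yet finitely many scales see only a window of heights and
    frequencies. What falls outside costs [2^-N] times integrals that do depend on [f]. Since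
    [\int F = \int u^2 = 1] exactly, [N] enters both sides with the same coefficient and cancels, so
    it can be chosen after [f], large enough to make these errors at most 1. The scales are matched
    by the averaged kernel bound: [C / (r |y|^(d-1))] is [C M^2] for [M = m / |y|^((d-1)/2)] exactly
    when [r = m^-2]. This quadratic law produces the factor 2 before [log |f|], and the power of
    [|y|] gained by averaging produces the weight [d - 1]. Only [u] enters the upper bounds: the
    real part of [f(x)] times the conjugate of [f(y)] is at most [u(x) u(y)]. The integral of
    [F ln |xi|] is bounded below by integrable minorants, as an extended real number. *)

Section lebesgue1.
Context {R : realType}.
Notation mu := (@lebesgue_measure R).
Implicit Types (a b : R) (g : R -> \bar R).

Lemma measurable_funV_ge0 d (T : measurableType d) (f : T -> R) :
  measurable_fun setT f -> (forall x, 0 <= f x) -> measurable_fun setT (fun x => (f x)^-1).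
Proof.
move=> mf f0; rewrite (_ : (fun x => _) = (fun x => f x `^ (-1))); last first.
  by apply/funext => x; rewrite powR_inv1.
exact: (measurableT_comp (measurable_powR _)).
Qed.

Lemma measurable_sqrt d (T : measurableType d) (f : T -> R) :
  measurable_fun setT f -> measurable_fun setT (fun x => Num.sqrt (f x)).
Proof. exact: (measurableT_comp (continuous_measurable_fun (@sqrt_continuous R))). Qed.

Lemma measurable_affine a b :
  measurable_fun setT ((fun x => a * x + b) : measurableTypeR R -> measurableTypeR R).
Proof.
by apply: measurable_funD => //; exact: measurable_funM.
Qed.

(** The right-hand side is itself a measure in [A], so by uniqueness of Lebesgue measure half-open
    intervals suffice. A negative [a] exchanges the open and the closed end, hence the case
    split. *)
Lemma lebesgue_measure_affine a b (A : set R) : a != 0 -> measurable A ->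
  mu A = (`|a|%:E * mu ((fun x => (a * x + b)%R) @^-1` A))%E.
Proof.
move=> a0 mA.
have ag : 0 <= `|a| by [].
rewrite (@lebesgue_measure_unique R (mscale (NngNum ag)
  (measure_function_pushforward__canonical__measure_function_Measure
    mu (measurable_affine a b))))// => _ [[u v]] _ <-.
rewrite /mscale /= /pushforward.
have [an|ap|/eqP] := ltgtP a 0; last by rewrite (negbTE a0).
- rewrite [X in (_ = _ * lebesgue_measure X)%E](_ : _ = `[(v - b) / a, (u - b) / a[%classic); last first.
    apply/seteqP; split => x /=; rewrite !in_itv/= => /andP[h1 h2]; apply/andP; split.
    + by rewrite ler_ndivrMr// mulrC lerBrDr.
    + by rewrite ltr_ndivlMr// mulrC ltrBlDr.
    + by rewrite -ltrBlDr mulrC -ltr_ndivlMr.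
    + by rewrite -lerBrDr mulrC -ler_ndivrMr.
  rewrite !lebesgue_measure_itv/= !lte_fin ltr_nM2r ?invr_lt0// ltrD2r.
  case: ifPn => _; last by rewrite mule0.
  by rewrite -!EFinB -EFinM ltr0_norm//; congr EFin; field.
- rewrite [X in (_ = _ * lebesgue_measure X)%E](_ : _ = `](u - b) / a, (v - b) / a]%classic); last first.
    apply/seteqP; split => x /=; rewrite !in_itv/= => /andP[h1 h2]; apply/andP; split.
    + by rewrite ltr_pdivrMr// mulrC ltrBlDr.
    + by rewrite ler_pdivlMr// mulrC lerBrDr.
    + by rewrite -ltrBlDr mulrC -ltr_pdivrMr.
    + by rewrite -lerBrDr mulrC -ler_pdivlMr.
  rewrite !lebesgue_measure_itv/= !lte_fin ltr_pM2r ?invr_gt0// ltrD2r.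
  case: ifPn => _; last by rewrite mule0.
  by rewrite -!EFinB -EFinM gtr0_norm//; congr EFin; field.
Qed.

Lemma integral_affine a b g : a != 0 -> measurable_fun setT g ->
  (forall x, 0 <= g x)%E ->
  (`|a|%:E * \int[mu]_x g (a * x + b)%R = \int[mu]_x g x)%E.
Proof.
move=> a0 mg g0; have ag : 0 <= `|a| by [].
pose P := measure_function_pushforward__canonical__measure_function_Measure
    mu (measurable_affine a b).
transitivity (\int[mscale (NngNum ag) P]_x g x)%E; last first.
  by apply: eq_measure_integral => A mA _; rewrite [RHS](@lebesgue_measure_affine a b).
rewrite ge0_integral_mscale//.
by rewrite (@ge0_integral_pushforward _ _ _ _ _ _ (measurable_affine a b) mu).
Qed.

End lebesgue1.

Section lebesgueRn.
Context {R : realType}.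
Notation mu := (@lebesgueRn R _).

Lemma ge0_integral_lebesgueRnS n (g : 'rV[R]_n.+1 -> \bar R) :
  measurable_fun setT g -> (forall x, 0 <= g x)%E ->
  (\int[lebesgueRn n.+1]_x g x =
   \int[lebesgue_measure]_t \int[lebesgueRn n]_y g (consrV (t, y)))%E.
Proof.
move=> mg g0.
rewrite (@ge0_integral_pushforward _ _ _ _ _ _ (@measurable_consrV R n)
   (lebesgue_measure \x lebesgueRn n)%E)//.
rewrite preimage_setT fubini_tonelli1//.
  by apply: measurableT_comp => //; exact: measurable_consrV.
by move=> x; exact: g0.
Qed.

Lemma measurable_affineRn n (a : R) (b : 'rV[R]_n) :
  measurable_fun setT (fun x : 'rV[R]_n => a *: x + b).
Proof.
apply: measurable_fun_rV => i; under eq_fun do rewrite !mxE.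
apply: measurable_funD => //; apply: measurable_funM => //.
exact: measurable_coord.
Qed.

(** Induction on the dimension: the first coordinate contributes one factor [|a|] through
    [integral_affine], the others come from the induction hypothesis. R^0 is a single point. *)
Lemma integral_affineRn n (a : R) (b : 'rV[R]_n) (g : 'rV[R]_n -> \bar R) :
  a != 0 -> measurable_fun setT g -> (forall x, 0 <= g x)%E ->
  ((`|a| ^+ n)%:E * \int[lebesgueRn n]_x g (a *: x + b)%R =
   \int[lebesgueRn n]_x g x)%E.
Proof.
move=> a0; elim: n b g => [|n IH] b g mg g0.
  rewrite mul1e; apply: eq_integral => x _; by congr g; apply/rowP => -[].
rewrite !ge0_integral_lebesgueRnS//; last first.
  exact: (measurableT_comp mg (measurable_affineRn _ _)).
have mG : measurable_fun setT (fun t => \int[lebesgueRn n]_y g (consrV (t, y)))%E.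
  exact: (measurable_fun_fubini_tonelli_F (fun p => g (consrV p))
    (measurableT_comp mg (@measurable_consrV R n))).
have mgt t : measurable_fun setT (fun y => g (consrV (t, y))).
  apply: (measurableT_comp (measurableT_comp mg (@measurable_consrV R n))).
  exact: measurable_pair1.
rewrite -[RHS](@integral_affine _ a (b ord0 ord0))//; last first.
  by move=> t; exact: integral_ge0.
rewrite exprS EFinM -muleA; congr (_ * _)%E.
rewrite -ge0_integralZl//; last 2 first.
  apply: (measurable_fun_fubini_tonelli_F (fun p => g (a *: consrV p + b))) => //.
  apply: (measurableT_comp (measurableT_comp mg (measurable_affineRn _ _))).
  exact: measurable_consrV.
by move=> t _; exact: integral_ge0.
apply: eq_integral => t _.
rewrite -[RHS](IH (\row_i b ord0 (lift ord0 i)))//; congr (_ * _)%E.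
apply: eq_integral => y _; congr g; apply/rowP => i.
have -> (z : 'rV[R]_n.+1) : (a *: z + b) ord0 i = a * z ord0 i + b ord0 i.
  by rewrite !mxE.
by case: (unliftP ord0 i) => [j|] ->; rewrite ?consrV_lift ?consrV0 ?mxE.
Qed.
End lebesgueRn.

(** Positive and negative parts carry a change of variables from nonnegative to integrable
    functions. It serves affine maps, the reflection and [consrV], with [k] the Jacobian factor. *)
Lemma integral_change_of_variables d1 d2 (T1 : measurableType d1)
    (T2 : measurableType d2) (R : realType)
    (m1 : {measure set T1 -> \bar R}) (m2 : {measure set T2 -> \bar R})
    (phi : T1 -> T2) (k : R) (g : T2 -> \bar R) :
  0 < k -> measurable_fun setT phi ->
  (forall h : T2 -> \bar R, measurable_fun setT h -> (forall x, 0 <= h x)%E ->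
    k%:E * \int[m1]_x h (phi x) = \int[m2]_x h x)%E ->
  m2.-integrable setT g ->
  m1.-integrable setT (g \o phi) /\
  (k%:E * \int[m1]_x g (phi x) = \int[m2]_x g x)%E.
Proof.
move=> k0 mphi H ig; have mg := measurable_int _ ig.
have ig1 : m1.-integrable setT (g \o phi).
  apply/integrableP; split; first exact: measurableT_comp.
  move/integrableP : ig => [_]; rewrite -H//; last exact: measurableT_comp.
  move=> h; rewrite ltNge; apply/negP; rewrite leye_eq => /eqP e.
  by move: h; rewrite [X in (_ * X)%E]e mulry gtr0_sg// mul1e ltxx.
split=> //.
have ip := integrable_pos_fin_num measurableT ig1.
have iN := integrable_neg_fin_num measurableT ig1.
rewrite (integralE _ _ (fun x => g (phi x))) (integralE _ _ g).
rewrite muleBr ?fin_num_adde_defl ?fin_numN//.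
congr (_ - _)%E.
  rewrite -(H _ (measurable_funepos mg) (@funepos_ge0 _ _ g)).
  by congr (_ * _)%E; apply: eq_integral => x _; rewrite !funeposE.
rewrite -(H _ (measurable_funeneg mg) (@funeneg_ge0 _ _ g)).
by congr (_ * _)%E; apply: eq_integral => x _; rewrite !funenegE.
Qed.

Section integrable_real.
Context d (T : measurableType d) (R : realType) (mu : {measure set T -> \bar R}).
Implicit Types f g : T -> R.

Lemma integrableZ_EFin k f : mu.-integrable setT (EFin \o f) ->
  mu.-integrable setT (EFin \o (fun x => k * f x)).
Proof. exact: (@integrableZl _ _ _ _ _ measurableT k (EFin \o f)). Qed.

Lemma integrableD_EFin f g : mu.-integrable setT (EFin \o f) ->
  mu.-integrable setT (EFin \o g) ->
  mu.-integrable setT (EFin \o (fun x => f x + g x)).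
Proof. exact: (@integrableD _ _ _ _ _ measurableT (EFin \o f) (EFin \o g)). Qed.

Lemma integrableB_EFin f g : mu.-integrable setT (EFin \o f) ->
  mu.-integrable setT (EFin \o g) ->
  mu.-integrable setT (EFin \o (fun x => f x - g x)).
Proof. exact: (@integrableB _ _ _ _ _ measurableT (EFin \o f) (EFin \o g)). Qed.

End integrable_real.

(** Domination is asked only for parameters within 1 of [a]: a Gaussian translated by at most 1 lies
    below one wider Gaussian, while no integrable bound is uniform over all translations. *)
Lemma is_derive_under_integral (R : realType) d (Y : measurableType d)
    (mu : {measure set Y -> \bar R}) (f f' : R -> Y -> R) (G : Y -> R) (a : R) :
  (forall x, mu.-integrable setT (EFin \o f x)) ->
  (forall (x : R) (y : Y), is_derive x 1 (f ^~ y) (f' x y)) ->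
  (forall y, 0 <= G y) -> mu.-integrable setT (EFin \o G) ->
  (forall x y, a - 1 < x < a + 1 -> `|f' x y| <= G y) ->
  is_derive a 1 (fun x => \int[mu]_y f x y) (\int[mu]_y f' a y).
Proof.
move=> intf df G0 intG fG.
have aI : `](a - 1), (a + 1)[%classic a by rewrite /= in_itv/=; apply/andP; split; lra.
have d1 x y : partial1of2 f x y = f' x y.
  by rewrite partial1of2E; exact: derive_val.
have I1 x : `](a - 1), (a + 1)[%classic x -> mu.-integrable setT (EFin \o f x) by [].
have I2 x y : `](a - 1), (a + 1)[%classic x -> setT y -> derivable (f^~ y) x 1.
  by move=> _ _; exact: ex_derive.
have I3 x y : `](a - 1), (a + 1)[%classic x -> setT y -> `|partial1of2 f x y| <= G y.
  by rewrite /= in_itv/= d1 => h _; exact: fG.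
apply: DeriveDef.
  exact: (derivable_under_integral measurableT aI I1 I2 G0 intG I3).
rewrite -derive1E (differentiation_under_integral measurableT aI I1 I2 G0 intG I3).
by apply: eq_Rintegral => y _; rewrite d1.
Qed.

(** * Affine substitutions and Gaussians on the line *)

Section gauss1.
Context {R : realType}.
Notation mu := (@lebesgue_measure R).
Implicit Types (a b c z x : R).

Lemma integrable_affine a b (g : R -> \bar R) : a != 0 -> mu.-integrable setT g ->
  mu.-integrable setT (fun x => g (a * x + b)) /\
  (`|a|%:E * \int[mu]_x g (a * x + b)%R = \int[mu]_x g x)%E.
Proof.
move=> a0; apply: (@integral_change_of_variables _ _ _ _ _ mu mu
  (fun x => a * x + b)).
- by rewrite normr_gt0.
- exact: measurable_affine.
- by move=> h mh h0; exact: integral_affine.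
Qed.

Lemma integrable_gaussZ (r : R) : r != 0 ->
  mu.-integrable setT (EFin \o (fun x => expR (- (r * x) ^+ 2))).
Proof.
move=> r0; have [+ _] := integrable_affine 0 r0 (@integrableT_gauss R).
by apply: eq_integrable => // x _; rewrite /= /gauss_fun addr0.
Qed.

Lemma measurable_sincos z c :
  measurable_fun setT (fun x : R => cos (z * x + c)) /\
  measurable_fun setT (fun x : R => sin (z * x + c)).
Proof.
split; (apply: measurableT_comp; last exact: measurable_affine);
  apply: continuous_measurable_fun; [exact: continuous_cos|exact: continuous_sin].
Qed.

End gauss1.

(** * The Fourier transform of the Gaussian *)

Section gauss_fourier1.
Context {R : realType}.
Notation mu := (@lebesgue_measure R).
Implicit Types (a b c z x : R).

Let E x : R := expR (- x ^+ 2).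

Let mE : measurable_fun setT E.
Proof. by apply: measurableT_comp => //; apply: measurable_funN; exact: measurable_funX. Qed.

Let quarter x : expR (- (2^-1 * x) ^+ 2) = expR (- (x ^+ 2 / 4)).
Proof. by congr expR; field. Qed.

(** Since [|x| <= 1 + 3 x^2 / 4 <= expR (3 x^2 / 4)], the factor [|x|] is absorbed by a wider
    Gaussian. *)
Let xE_le x : `|x| * E x <= expR (- (2^-1 * x) ^+ 2).
Proof.
rewrite quarter /E (_ : - x ^+ 2 = - (x ^+ 2 / 4) - (3 * x ^+ 2 / 4)); last by field.
rewrite expRD mulrCA ger_pMr ?expR_gt0// expRN ler_pdivrMr ?expR_gt0// mul1r.
apply: le_trans (expR_ge1Dx _).
by rewrite ler_norml; apply/andP; split; nra.
Qed.

Let E_le x : E x <= expR (- (2^-1 * x) ^+ 2).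
Proof. by rewrite quarter ler_expR; nra. Qed.

Let iG (k : R) : mu.-integrable setT
  (EFin \o (fun x => k * expR (- (2^-1 * x) ^+ 2))).
Proof.
by apply/integrableZ_EFin/integrable_gaussZ; rewrite invr_eq0.
Qed.

Let iM (h p : R -> R) k : measurable_fun setT h -> measurable_fun setT p ->
  (forall x, `|h x| <= 1) ->
  (forall x, `|p x| * E x <= k * expR (- (2^-1 * x) ^+ 2)) ->
  mu.-integrable setT (EFin \o (fun x => p x * E x * h x)).
Proof.
move=> mh mp h1 pk; apply: (le_integrable _ _ _ (iG k)) => //.
  by apply/measurable_EFinP; do 2?apply: measurable_funM.
move=> x _; rewrite lee_fin /= !normrM [`|E x|]ger0_norm ?expR_ge0//.
apply: (@le_trans _ _ (`|p x| * E x)); first by rewrite ler_piMr// mulr_ge0 ?expR_ge0.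
by apply: (le_trans (pk x)); rewrite -normrM ler_norm.
Qed.

Lemma normr_sin_le1 x : `|sin x| <= 1.
Proof. by rewrite ler_norml sin_geN1 sin_le1. Qed.

Let iEcos z c : mu.-integrable setT (EFin \o (fun x => E x * cos (z * x + c))).
Proof.
have := @iM (fun x => cos (z * x + c)) (cst 1) 1 (measurable_sincos z c).1.
move=> /(_ (measurable_cst _) (fun x => cos_max _)).
have -> : (fun x => cst 1 x * E x * cos (z * x + c)) = (fun x => E x * cos (z * x + c)).
  by apply/funext => x; rewrite mul1r.
by apply => x; rewrite /= normr1 !mul1r.
Qed.

Let iEsin z c : mu.-integrable setT (EFin \o (fun x => E x * sin (z * x + c))).
Proof.
have := @iM (fun x => sin (z * x + c)) (cst 1) 1 (measurable_sincos z c).2.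
move=> /(_ (measurable_cst _) (fun x => normr_sin_le1 _)).
have -> : (fun x => cst 1 x * E x * sin (z * x + c)) = (fun x => E x * sin (z * x + c)).
  by apply/funext => x; rewrite mul1r.
by apply => x; rewrite /= normr1 !mul1r.
Qed.

Let ixEsin z c : mu.-integrable setT (EFin \o (fun x => x * E x * sin (z * x + c))).
Proof.
apply: (@iM (fun x => sin (z * x + c)) id 1 (measurable_sincos z c).2) => //.
  by move=> x; exact: normr_sin_le1.
by move=> x; rewrite mul1r.
Qed.

Let I c z := \int[mu]_x (E x * cos (z * x + c)).
Let J c z := \int[mu]_x (x * E x * sin (z * x + c)).

Let dH z c x : is_derive x 1 (fun x : R => E x * sin (z * x + c))
  (z * (E x * cos (z * x + c)) - 2 * (x * E x * sin (z * x + c))).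
Proof.
rewrite /E; apply: trigger_derive; rewrite /GRing.scale/=; ring.
Qed.

(* Translation invariance makes [s |-> \int H (s + x)] constant, so its
   derivative [\int H'] vanishes: integration by parts without boundary terms. *)
Let byparts c z : z * I c z = 2 * J c z.
Proof.
pose H x := E x * sin (z * x + c).
pose H' x := z * (E x * cos (z * x + c)) - 2 * (x * E x * sin (z * x + c)).
(* [|H' y| <= (|z| + 2) expR (- y^2 / 2)], and for [|s| <= 1] the inequality [(x / 2 + s)^2 >= 0]
   gives [(s + x)^2 / 2 >= x^2 / 4 - 1 / 2]. *)
pose G x := ((`|z| + 2) * expR 2^-1) * expR (- (2^-1 * x) ^+ 2).
have d : is_derive (0:R) 1 (fun s => \int[mu]_x H (s + x)) (\int[mu]_x H' (0 + x)).
  apply: (@is_derive_under_integral _ _ _ mu (fun s x => H (s + x))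
    (fun s x => H' (s + x)) G).
  - move=> s; have [+ _] := integrable_affine s (oner_neq0 _) (iEsin z c).
    by apply: eq_integrable => // x _; rewrite /= /H mul1r addrC.
  - move=> s y.
    have d1 : is_derive s 1 (fun s : R => s + y) 1.
      by apply: trigger_derive; rewrite addr0.
    have := @is_derive1_comp R H (fun s => s + y) s _ _ (dH z c (s + y)) d1.
    by rewrite mulr1.
  - by move=> y; rewrite !mulr_ge0 ?expR_ge0// addr_ge0.
  - exact: iG.
  - move=> s x /andP[s1 s2]; set y := s + x.
    apply: (@le_trans _ _ ((`|z| + 2) * expR (- (y ^+ 2 / 2)))).
      apply: (le_trans (ler_normB _ _)); rewrite [leRHS]mulrDl; apply: lerD.
        rewrite !normrM ler_wpM2l// ger0_norm ?expR_ge0//.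
        apply: (@le_trans _ _ (E y)); first by rewrite ler_piMr ?expR_ge0 ?cos_max.
        by rewrite ler_expR; nra.
      rewrite !normrM (ger0_norm (_ : 0 <= 2))// ler_wpM2l// (ger0_norm (expR_ge0 _)).
      apply: (@le_trans _ _ (`|y| * E y)).
        by rewrite ler_piMr ?normr_sin_le1// mulr_ge0// expR_ge0.
      rewrite /E (_ : - y ^+ 2 = - (y ^+ 2 / 2) - (y ^+ 2 / 2)); last by field.
      rewrite expRD mulrCA ger_pMr ?expR_gt0// expRN ler_pdivrMr ?expR_gt0// mul1r.
      apply: le_trans (expR_ge1Dx _).
      by rewrite ler_norml; apply/andP; split; nra.
    rewrite /G -mulrA ler_wpM2l ?addr_ge0// quarter -expRD ler_expR /y.
    have s3 : s ^+ 2 <= 1 by nra.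
    by have := sqr_ge0 (x + 2 * s); nra.
have cst0 : (fun s => \int[mu]_x H (s + x)) = cst (\int[mu]_x H x).
  apply/funext => s; congr fine => /=.
  have [_] := integrable_affine s (oner_neq0 _) (iEsin z c).
  rewrite normr1 mul1e => <-; apply: eq_integral => x _.
  by rewrite /= /H mul1r addrC.
have e : \int[mu]_x H' (0 + x) = 0.
  have := @derive_val _ _ _ _ _ _ _ d.
  by rewrite cst0 derive_cst => <-.
move: e; under eq_Rintegral do rewrite add0r.
rewrite RintegralB//; last 2 first.
- exact: (integrableZ_EFin z (iEcos z c)).
- exact: (integrableZ_EFin 2 (ixEsin z c)).
rewrite (RintegralZl z measurableT (iEcos z c)) (RintegralZl 2 measurableT (ixEsin z c)).
by move/eqP; rewrite subr_eq0 => /eqP.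
Qed.

(** Differentiation under the integral gives [- J c z], which [byparts] turns into a linear
    differential equation for [I c]. *)
Let dI c z : is_derive z 1 (I c) (- (z / 2) * I c z).
Proof.
have -> : - (z / 2) * I c z = \int[mu]_x (-1 * (x * E x * sin (z * x + c))).
  rewrite (RintegralZl (-1) measurableT (ixEsin z c)).
  by have := byparts c z; rewrite /J; lra.
apply: (@is_derive_under_integral _ _ _ mu (fun z x => E x * cos (z * x + c))
    (fun z x => -1 * (x * E x * sin (z * x + c)))
    (fun x => 1 * expR (- (2^-1 * x) ^+ 2))).
- by move=> w; exact: iEcos.
- by move=> w y; apply: trigger_derive; rewrite /GRing.scale/=; ring.
- by move=> y; rewrite mul1r expR_ge0.
- exact: iG.
- move=> w y _; rewrite mulN1r normrN !normrM mul1r (ger0_norm (expR_ge0 _)).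
  apply: le_trans (xE_le y).
  by rewrite ler_piMr ?normr_sin_le1// mulr_ge0// expR_ge0.
Qed.

(** By [dI], [I c z * expR ((z / 2) ^+ 2)] has zero derivative, so it keeps its value at 0, where
    the Gaussian integral is known. *)
Lemma gauss_cos1 c z :
  \int[mu]_x (expR (- x ^+ 2) * cos (z * x + c)) =
  Num.sqrt pi * expR (- (z / 2) ^+ 2) * cos c.
Proof.
have I0 : I c 0 = Num.sqrt pi * cos c.
  rewrite /I; under eq_Rintegral do rewrite mul0r add0r.
  by rewrite RintegralZr//; [rewrite /Rintegral integralT_gauss|exact: integrableT_gauss].
have d (w : R) : is_derive w 1 (fun w : R => I c w * expR ((w / 2) ^+ 2)) 0.
  have := dI c w => dIw.
  by apply: trigger_derive; rewrite /GRing.scale/=; field.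
have := is_derive_0_is_cst z 0 d.
rewrite mul0r expr0n expR0 mulr1 I0 mulrAC => <-.
by rewrite -mulrA -expRD subrr expR0 mulr1.
Qed.

Lemma integral_gauss_cos1 (r : R) c z : 0 < r ->
  mu.-integrable setT (EFin \o (fun x => expR (- (r * x) ^+ 2) * cos (z * x + c))) /\
  (\int[mu]_x (expR (- (r * x) ^+ 2) * cos (z * x + c))%:E =
  (Num.sqrt pi / r * expR (- (z / (2 * r)) ^+ 2) * cos c)%:E)%E.
Proof.
move=> r0.
have [+ +] := integrable_affine 0 (lt0r_neq0 r0) (iEcos (z / r) c).
have e x : (EFin \o (fun x => E x * cos (z / r * x + c))) (r * x + 0) =
   (EFin \o (fun x => expR (- (r * x) ^+ 2) * cos (z * x + c))) x.
  by rewrite /= /E addr0 mulrA divfK// gt_eqF.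
under eq_integral do rewrite e.
move=> i1 i2; split; first by move: i1; apply: eq_integrable => // x _; rewrite e.
move: i2; rewrite gtr0_norm// => i2.
have f1 : (\int[mu]_x (E x * cos (z / r * x + c))%:E)%E =
   (Num.sqrt pi * expR (- (z / (2 * r)) ^+ 2) * cos c)%:E.
  have -> : z / (2 * r) = z / r / 2 by field; rewrite gt_eqF.
  by rewrite -gauss_cos1 fineK//; exact: integrable_fin_num (iEcos _ _).
move: i2; rewrite /comp f1 => i2.
have : (r%:E * (r^-1)%:E = 1)%E by rewrite -EFinM divff ?gt_eqF.
rewrite muleC => ri; rewrite -[LHS]mul1e -ri -muleA i2 -EFinM; congr EFin.
by ring.
Qed.

End gauss_fourier1.

(** * The Euclidean norm and Gaussian integrals on R^n *)

Section euclidean.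
Context {R : realType}.

Section dim.
Variable n : nat.
Implicit Types (x y z : 'rV[R]_n) (a : R).

Lemma enorm_ge0 x : 0 <= enorm x. Proof. exact: sqrtr_ge0. Qed.

Lemma enorm_sqr x : enorm x ^+ 2 = \sum_(i < n) x ord0 i ^+ 2.
Proof. by rewrite sqr_sqrtr// sumr_ge0// => i _; exact: sqr_ge0. Qed.

Lemma enormZ a x : enorm (a *: x) = `|a| * enorm x.
Proof.
rewrite /enorm -sqrtr_sqr -sqrtrM ?sqr_ge0// mulr_sumr.
by congr Num.sqrt; apply: eq_bigr => i _; rewrite mxE exprMn.
Qed.

Lemma enormN x : enorm (- x) = enorm x.
Proof. by rewrite -scaleN1r enormZ normrN1 mul1r. Qed.

Lemma enorm_eq0 x : (enorm x == 0) = (x == 0).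
Proof.
apply/eqP/eqP => [/(congr1 (fun u => u ^+ 2))|->]; last first.
  by rewrite /enorm big1 ?sqrtr0// => i _; rewrite mxE expr0n.
rewrite enorm_sqr expr0n => /eqP; rewrite psumr_eq0; last by move=> i _; exact: sqr_ge0.
move=> /allP h; apply/rowP => i; rewrite mxE; apply/eqP.
by have := h i (mem_index_enum i); rewrite /= sqrf_eq0.
Qed.

Lemma dotrVC x y : dotrV x y = dotrV y x.
Proof. by apply: eq_bigr => i _; rewrite mulrC. Qed.

Lemma dotrVZl a x y : dotrV (a *: x) y = a * dotrV x y.
Proof. by rewrite /dotrV mulr_sumr; apply: eq_bigr => i _; rewrite mxE mulrA. Qed.

Lemma dotrVDl x y z : dotrV (x + y) z = dotrV x z + dotrV y z.
Proof. by rewrite /dotrV -big_split; apply: eq_bigr => i _; rewrite mxE mulrDl. Qed.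

Lemma dotrVNl x y : dotrV (- x) y = - dotrV x y.
Proof. by rewrite -scaleN1r dotrVZl mulN1r. Qed.

Lemma dotrVxx x : dotrV x x = enorm x ^+ 2.
Proof. by rewrite enorm_sqr. Qed.

Lemma enormB_sqr x y :
  enorm (x - y) ^+ 2 = enorm x ^+ 2 - 2 * dotrV x y + enorm y ^+ 2.
Proof.
rewrite -!dotrVxx dotrVDl dotrVNl !(dotrVC _ (x - y)) !dotrVDl !dotrVNl.
by rewrite (dotrVC y x); ring.
Qed.

(** Cauchy-Schwarz: the squared norm of [|y| x - |x| y] is [2 |x| |y| (|x| |y| - x . y)]. *)
Lemma dotrV_le x y : dotrV x y <= enorm x * enorm y.
Proof.
have [->|x0] := eqVneq x 0.
  by rewrite -(scale0r 0) dotrVZl mul0r mulr_ge0// enorm_ge0.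
have [->|y0] := eqVneq y 0.
  by rewrite dotrVC -(scale0r 0) dotrVZl mul0r mulr_ge0// enorm_ge0.
have ex : 0 < enorm x by rewrite lt_neqAle eq_sym enorm_eq0 x0 enorm_ge0.
have ey : 0 < enorm y by rewrite lt_neqAle eq_sym enorm_eq0 y0 enorm_ge0.
have := sqr_ge0 (enorm (enorm y *: x - enorm x *: y)).
rewrite enormB_sqr !enormZ dotrVZl dotrVC dotrVZl dotrVC !ger0_norm ?enorm_ge0//.
have p : 0 < enorm x * enorm y by exact: mulr_gt0.
nra.
Qed.

Lemma measurable_enorm : measurable_fun setT (@enorm R n).
Proof.
by apply: measurable_sqrt; apply: measurable_sum => i; apply: measurable_funX; exact: measurable_coord.
Qed.

Lemma measurable_dotrV x : measurable_fun setT (dotrV x).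
Proof.
by apply: measurable_sum => i; apply: measurable_funM => //; exact: measurable_coord.
Qed.

End dim.

Lemma enorm_consrV n (p : measurableTypeR R * 'rV[R]_n) :
  enorm (consrV p) ^+ 2 = (p.1 : R) ^+ 2 + enorm p.2 ^+ 2.
Proof.
rewrite !enorm_sqr big_ord_recl consrV0; congr (_ + _).
by apply: eq_bigr => i _; rewrite consrV_lift.
Qed.

Lemma dotrV_consrV n (z : 'rV[R]_n.+1) (p : measurableTypeR R * 'rV[R]_n) :
  dotrV z (consrV p) =
  z ord0 ord0 * p.1 + dotrV (\row_i z ord0 (lift ord0 i)) p.2.
Proof.
rewrite /dotrV big_ord_recl consrV0; congr (_ + _).
by apply: eq_bigr => i _; rewrite consrV_lift mxE.
Qed.

Lemma integrable_lebesgueRnS n (g : 'rV[R]_n.+1 -> \bar R) :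
  (lebesgueRn n.+1).-integrable setT g ->
  (\int[lebesgueRn n.+1]_x g x =
   \int[lebesgue_measure]_t \int[lebesgueRn n]_y g (consrV (t, y)))%E.
Proof.
move=> ig.
have H (h : 'rV[R]_n.+1 -> \bar R) : measurable_fun setT h -> (forall x, 0 <= h x)%E ->
    (1%:E * \int[lebesgue_measure \x lebesgueRn n]_p h (consrV p) =
     \int[lebesgueRn n.+1]_x h x)%E.
  move=> mh h0; rewrite mul1e ge0_integral_lebesgueRnS//.
  have mhc : measurable_fun setT (h \o @consrV R n).
    by apply: measurableT_comp => //; exact: measurable_consrV.
  by rewrite (fubini_tonelli1 (h \o @consrV R n) mhc)// => x; exact: h0.
have [gi e] := integral_change_of_variables ltr01 (@measurable_consrV R n) H ig.
by rewrite -[LHS]e mul1e -(integral12_prod_meas1 gi).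
Qed.

Lemma measurable_gaussRn n r :
  measurable_fun setT (fun x : 'rV[R]_n => expR (- (r * enorm x) ^+ 2)).
Proof.
apply: measurableT_comp => //; apply: measurable_funN; apply: measurable_funX.
by apply: measurable_funM => //; exact: measurable_enorm.
Qed.

Lemma expR_consrV n r (p : measurableTypeR R * 'rV[R]_n) :
  expR (- (r * enorm (consrV p)) ^+ 2) =
  expR (- (r * p.1) ^+ 2) * expR (- (r * enorm p.2) ^+ 2).
Proof. by rewrite -expRD !exprMn enorm_consrV; congr expR; ring. Qed.

Lemma integral_gaussRn n (r : R) : 0 < r ->
  (\int[lebesgueRn n]_x (expR (- (r * enorm x) ^+ 2))%:E =
   ((Num.sqrt pi / r) ^+ n)%:E)%E.
Proof.
move=> r0; elim: n => [|n IH].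
  rewrite /= integral_dirac//; last by apply/measurable_EFinP; exact: measurable_gaussRn.
  by rewrite diracT mul1e (eqP (_ : enorm 0 == 0)) ?enorm_eq0// mulr0 expr0n oppr0 expR0.
rewrite ge0_integral_lebesgueRnS//; last first.
  by apply/measurable_EFinP; exact: measurable_gaussRn.
under eq_integral => t _.
  under eq_integral => y _ do rewrite expR_consrV EFinM/=.
  rewrite ge0_integralZl//; last first.
    by apply/measurable_EFinP; exact: measurable_gaussRn.
  rewrite IH; over.
rewrite ge0_integralZr//; last 2 first.
- apply/measurable_EFinP.
  apply: measurableT_comp => //; apply: measurable_funN; apply: measurable_funX.
  by apply: measurable_funM => //.
- by rewrite lee_fin exprn_ge0// divr_ge0 ?sqrtr_ge0// ltW.
have [_ h] := @integral_gauss_cos1 R r 0 0 r0.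
have h' : (\int[@lebesgue_measure R]_x (expR (- (r * x) ^+ 2))%:E =
    (Num.sqrt pi / r)%:E)%E.
  transitivity (\int[@lebesgue_measure R]_x (expR (- (r * x) ^+ 2) * cos (0 * x + 0))%:E)%E.
    by apply: eq_integral => x _; rewrite mul0r addr0 cos0 mulr1.
  by rewrite h mul0r expr0n oppr0 expR0 cos0 !mulr1.
by apply: (eq_trans (congr1 (fun u => (u * _)%E) h')); rewrite -EFinM exprS.
Qed.

Lemma integrable_gauss_bounded n (r : R) (h : 'rV[R]_n -> R) : 0 < r ->
  measurable_fun setT h -> (forall x, `|h x| <= 1) ->
  (lebesgueRn n).-integrable setT (EFin \o (fun x => expR (- (r * enorm x) ^+ 2) * h x)).
Proof.
move=> r0 mh h1.
have ig : (lebesgueRn n).-integrable setT (EFin \o (fun x => expR (- (r * enorm x) ^+ 2))).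
  apply/integrableP; split; first by apply/measurable_EFinP; exact: measurable_gaussRn.
  under eq_integral do rewrite gee0_abs ?lee_fin ?expR_ge0//.
  by rewrite integral_gaussRn// ltry.
apply: (le_integrable _ _ _ ig) => //.
  by apply/measurable_EFinP/measurable_funM => //; exact: measurable_gaussRn.
move=> x _; rewrite /= lee_fin normrM ger_pMr ?h1//.
by rewrite normr_gt0 gt_eqF// expR_gt0.
Qed.


(** The free phase [c] makes the induction close: once the first coordinate [t] is split off, its
    contribution to the dot product joins the phase of the remaining integral, and no product of
    sines appears. *)
Lemma integral_gauss_cosRn n (r : R) (z : 'rV[R]_n) c : 0 < r ->
  (\int[lebesgueRn n]_x (expR (- (r * enorm x) ^+ 2) * cos (dotrV z x + c))%:E =
   ((Num.sqrt pi / r) ^+ n * expR (- (enorm z / (2 * r)) ^+ 2) * cos c)%:E)%E.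
Proof.
move=> r0; elim: n z c => [|n IH] z c.
  rewrite /= integral_dirac//; last first.
    apply/measurable_EFinP; apply: measurable_funM; first exact: measurable_gaussRn.
    apply: measurableT_comp; last by apply: measurable_funD => //; exact: measurable_dotrV.
    by apply: continuous_measurable_fun; exact: continuous_cos.
  have e0 (u : 'rV[R]_0) : enorm u = 0 by rewrite /enorm big_ord0 sqrtr0.
  by rewrite diracT mul1e !e0 /dotrV big_ord0 add0r mulr0 mul0r expr0n oppr0 expR0 !mul1r.
have mcos m (w : 'rV[R]_m) e : measurable_fun setT (fun x => cos (dotrV w x + e)).
  apply: measurableT_comp; last by apply: measurable_funD => //; exact: measurable_dotrV.
  by apply: continuous_measurable_fun; exact: continuous_cos.
rewrite integrable_lebesgueRnS; last first.
  by apply: integrable_gauss_bounded => // x; exact: cos_max.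
set z' := \row_i z ord0 (lift ord0 i).
have zE : enorm z ^+ 2 = z ord0 ord0 ^+ 2 + enorm z' ^+ 2.
  rewrite !enorm_sqr big_ord_recl; congr (_ + _).
  by apply: eq_bigr => i _; rewrite mxE.
have [i1 e1] := @integral_gauss_cos1 R r c (z ord0 ord0) r0.
set k := (Num.sqrt pi / r) ^+ n * expR (- (enorm z' / (2 * r)) ^+ 2).
transitivity (\int[lebesgue_measure]_t
   (k%:E * (expR (- (r * t) ^+ 2) * cos (z ord0 ord0 * t + c))%:E))%E.
  apply: eq_integral => t _.
  have e (y : 'rV[R]_n) : (expR (- (r * enorm (consrV (t, y))) ^+ 2) *
      cos (dotrV z (consrV (t, y)) + c))%:E =
    ((expR (- (r * t) ^+ 2))%:E * (expR (- (r * enorm y) ^+ 2) *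
       cos (dotrV z' y + (z ord0 ord0 * t + c)))%:E)%E.
    rewrite expR_consrV dotrV_consrV -EFinM mulrA; congr (_ * cos _)%:E.
    by rewrite /=; ring.
  under eq_integral do rewrite e.
  rewrite integralZl//; last first.
    by apply: integrable_gauss_bounded => // x; exact: cos_max.
  by rewrite IH -!EFinM; congr EFin; rewrite /k; ring.
rewrite integralZl// e1 -EFinM /k; congr EFin.
rewrite (_ : - (enorm z / (2 * r)) ^+ 2 =
   - (enorm z' / (2 * r)) ^+ 2 - (z ord0 ord0 / (2 * r)) ^+ 2); last first.
  by rewrite !exprMn zE mulrDl opprD addrC.
rewrite expRD; set s := Num.sqrt pi / r; set A := expR _; set B := expR _. 
by rewrite (exprS s); ring.
Qed.
End euclidean.

(** * Polar coordinates *)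

Section polar.
Context {R : realType} (n : nat).
Notation V := 'rV[R]_n.+1.
Notation mu := (@lebesgueRn R n.+1).
Notation leb := (@lebesgue_measure R).
Implicit Types (x y : V) (r : R) (H : V -> R).

Lemma measurable_enormV : measurable_fun setT (fun x : V => (enorm x)^-1).
Proof.
by apply: measurable_funV_ge0 => [|x]; [exact: measurable_enorm|exact: enorm_ge0].
Qed.

Lemma measurable_scaleRn m d (T : measurableType d) (f : T -> R) (g : T -> 'rV[R]_m) :
  measurable_fun setT f -> measurable_fun setT g ->
  measurable_fun setT (fun t => f t *: g t).
Proof.
move=> mf mg; apply: measurable_fun_rV => i; under eq_fun do rewrite mxE.
by apply: measurable_funM => //; exact: measurableT_comp (measurable_coord i) mg.
Qed.

Lemma lebesgueRn_set0 : mu ([set 0] : set V) = 0%E.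
Proof.
have -> : [set 0] = [set x : V | forall i, [set (0 : R)] (x ord0 i)].
  apply/seteqP; split => x /=; first by move=> -> i; rewrite mxE.
  by move=> h; apply/rowP => i; rewrite mxE.
rewrite (lebesgueRn_box (A := fun=> [set (0 : R)])) => [|i]; last exact: measurable_set1.
by rewrite big_ord_recl lebesgue_measure_set1 mul0e.
Qed.

Lemma measurable_set0Rn : measurable ([set 0] : set V).
Proof.
rewrite (_ : [set 0] = (@enorm R n.+1) @^-1` [set 0]).
  by rewrite -[X in measurable X]setTI; apply: measurable_enorm.
apply/seteqP; split => x /=; first by move=> ->; apply/eqP; rewrite enorm_eq0.
by move=> /eqP; rewrite enorm_eq0 => /eqP.
Qed.

Lemma ae_neq0 : {ae mu, forall x : V, x != 0}.
Proof.
exists [set 0]; split; [exact: measurable_set0Rn|exact: lebesgueRn_set0|].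
by move=> x /= /negP; rewrite negbK => /eqP.
Qed.

(** Along each ray the weight integrates to [\int_1^2 2 s^-(n+2) s^n ds = 1], so the image of
    [polar_weight x dx] under [unitv] is surface measure on the unit sphere. *)
Definition polar_weight x : R :=
  if 1 <= enorm x <= 2 then 2 * (enorm x)^-1 ^+ n.+2 else 0.

Definition unitv x : V := (enorm x)^-1 *: x.

Lemma polar_weight_ge0 x : 0 <= polar_weight x.
Proof.
rewrite /polar_weight; case: ifP => // _.
by rewrite mulr_ge0// exprn_ge0// invr_ge0 enorm_ge0.
Qed.

Lemma measurable_annulus d (T : measurableType d) (f g h : T -> R) :
  measurable_fun setT f -> measurable_fun setT g -> measurable_fun setT h ->
  measurable_fun setT (fun t => f t <= g t <= h t).
Proof. by move=> mf mg mh; apply: measurable_and; exact: measurable_fun_ler. Qed.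

Lemma measurable_polar_weight : measurable_fun setT polar_weight.
Proof.
apply: measurable_fun_ifT => //.
  by apply: measurable_annulus => //; exact: measurable_enorm.
by apply: measurable_funM => //; apply: measurable_funX; exact: measurable_enormV.
Qed.

Lemma measurable_unitv : measurable_fun setT unitv.
Proof. by apply: measurable_scaleRn => //; exact: measurable_enormV. Qed.

(** The radial density, cut off so that the radius can run over the whole line. *)
Definition rpow r : R := if 0 < r then r ^+ n else 0.

(** The integral of [H] over directions at radius [r], not normalized: at the constant 1 it is the
    area of the unit sphere. *)
Definition polar_mean H r : \bar R :=
  (\int[mu]_x (polar_weight x * H (r *: unitv x))%:E)%E.

Lemma measurable_rpow : measurable_fun setT rpow.
Proof.
apply: measurable_fun_ifT => //.
exact: measurable_fun_ltr.
Qed.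

Lemma rpow_ge0 r : 0 <= rpow r.
Proof. by rewrite /rpow; case: ifPn => // r0; rewrite exprn_ge0 ?ltW. Qed.

Lemma polar_mean_ge0 H r : (forall x, 0 <= H x) -> (0 <= polar_mean H r)%E.
Proof.
by move=> H0; apply: integral_ge0 => x _; rewrite lee_fin mulr_ge0// polar_weight_ge0.
Qed.

Lemma measurable_polar_integrand H : measurable_fun setT H ->
  measurable_fun setT (fun p : V * measurableTypeR R =>
    polar_weight p.1 * H ((p.2 : R) *: unitv p.1)).
Proof.
move=> mH; apply: measurable_funM.
  by apply: (measurableT_comp measurable_polar_weight); exact: measurable_fst.
apply: measurableT_comp => //; apply: measurable_scaleRn; first exact: measurable_snd.
by apply: (measurableT_comp measurable_unitv); exact: measurable_fst.
Qed.

Lemma measurable_polar_mean H : measurable_fun setT H -> (forall x, 0 <= H x) ->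
  measurable_fun setT (polar_mean H : measurableTypeR R -> \bar R).
Proof.
move=> mH H0.
apply: (@measurable_fun_fubini_tonelli_G _ _ _ (measurableTypeR R) _ mu
  (fun p => (polar_weight p.1 * H ((p.2 : R) *: unitv p.1))%:E)).
  by apply/measurable_EFinP; exact: measurable_polar_integrand.
by move=> p; rewrite lee_fin mulr_ge0// polar_weight_ge0.
Qed.

(* Averaging [H] over dilations: for [x != 0] the [r] with [r <= |x| <= 2 r]
   form an interval of length [|x| / 2].  Exchanging the integrals and rescaling
   first [x], then [r], decouples the radius from the direction without any
   measure on the sphere. *)
Lemma polar_integral H : measurable_fun setT H -> (forall x, 0 <= H x) ->
  (\int[mu]_x (H x)%:E =
   \int[leb]_r ((rpow r)%:E * polar_mean H r))%E.
Proof.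
move=> mH H0.
pose c x : R := 2 * (enorm x)^-1.
have c0 x : 0 <= c x by rewrite mulr_ge0// invr_ge0 enorm_ge0.
have mc : measurable_fun setT c by apply: measurable_funM => //; exact: measurable_enormV.
have menf d (T : measurableType d) (f : T -> V) : measurable_fun setT f ->
    measurable_fun setT (fun t => enorm (f t)).
  by move=> mf; apply: measurableT_comp => //; exact: measurable_enorm.
pose K (p : V * measurableTypeR R) : R :=
  if (p.2 : R) <= enorm p.1 <= 2 * p.2 then c p.1 * H p.1 else 0.
have K0 p : 0 <= K p by rewrite /K; case: ifP => // _; rewrite mulr_ge0.
have mK : measurable_fun setT K.
  apply: measurable_fun_ifT => //.
    apply: measurable_annulus; [exact: measurable_snd|by apply: menf; exact: measurable_fst|].
    by apply: measurable_funM => //; exact: measurable_snd.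
  by apply: measurable_funM; (apply: measurableT_comp; last exact: measurable_fst).
transitivity (\int[mu]_x \int[leb]_r (K (x, r))%:E)%E.
  apply: ae_eq_integral => //.
  - by apply/measurable_EFinP.
  - by apply: (measurable_fun_fubini_tonelli_F (EFin \o K)) => //; exact/measurable_EFinP.
  - move: ae_neq0; apply: filterS => x x0 _.
    have ex : 0 < enorm x by rewrite lt_neqAle eq_sym enorm_eq0 x0 enorm_ge0.
    rewrite (_ : (fun r => (K (x, r))%:E) =
        (cst (c x * H x)%:E) \_ `[enorm x / 2, enorm x]); last first.
      apply/funext => r; rewrite /K /= patchE mem_setE in_itv /=.
      rewrite (_ : (enorm x / 2 <= r) = (enorm x <= 2 * r)); last first.
        by rewrite ler_pdivrMr// mulrC.
      by rewrite andbC; case: ifP.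
    rewrite -integral_mkcond integral_cst//= lebesgue_measure_itv/= lte_fin.
    rewrite ifT; last by lra.
    by rewrite -EFinB -EFinM /c; congr EFin; field; rewrite gt_eqF.
rewrite (fubini_tonelli (EFin \o K)) => //; last exact/measurable_EFinP.
(* The result of replacing [x] by [r x]: the Jacobian [r^(n+1)] meets [c (r x) = c x / r] and leaves
   [r^n]. *)
pose L (p : V * measurableTypeR R) : R :=
  rpow p.2 * (if 1 <= enorm p.1 <= 2 then c p.1 * H ((p.2 : R) *: p.1) else 0).
have L0 p : 0 <= L p by rewrite /L mulr_ge0 ?rpow_ge0//; case: ifP => // _; rewrite mulr_ge0.
have mL : measurable_fun setT L.
  apply: measurable_funM; first by apply: (measurableT_comp measurable_rpow); exact: measurable_snd.
  apply: measurable_fun_ifT => //.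
    by apply: measurable_annulus => //; apply: menf; exact: measurable_fst.
  apply: measurable_funM; first by apply: measurableT_comp => //; exact: measurable_fst.
  apply: measurableT_comp => //; apply: measurable_scaleRn.
    exact: measurable_snd.
  exact: measurable_fst.
transitivity (\int[leb]_r \int[mu]_x (L (x, r))%:E)%E.
  apply: eq_integral => r _.
  have [r0|r0] := ltP 0 r; last first.
    transitivity (\int[mu]_x (0 : \bar R))%E; [|symmetry]; apply: eq_integral => x _.
      congr EFin; rewrite /K /=; case: ifP => // /andP[_ h].
      have /eqP x0 : enorm x == 0 by rewrite eq_le enorm_ge0 andbT; lra.
      by rewrite /c x0 invr0 mulr0 mul0r.
    by rewrite /L /rpow /= ltNge r0 /= mul0r.
  have mKr : measurable_fun setT (fun x => (K (x, r))%:E).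
    by apply/measurable_EFinP; apply: measurableT_comp => //; exact: measurable_pair2.
  rewrite -(@integral_affineRn R n.+1 r 0 _ (lt0r_neq0 r0) mKr)//; last first.
    by move=> x; rewrite lee_fin.
  rewrite -ge0_integralZl_EFin ?exprn_ge0//; last 2 first.
    by move=> x _; rewrite lee_fin.
    by apply: (measurableT_comp mKr); exact: measurable_affineRn.
  apply: eq_integral => x _; rewrite -EFinM; congr EFin.
  rewrite /K /L /rpow /= addr0 r0 gtr0_norm// /c enormZ gtr0_norm//.
  rewrite (_ : (r <= r * enorm x) = (1 <= enorm x)); last by rewrite ler_pMr.
  rewrite (_ : (r * enorm x <= 2 * r) = (enorm x <= 2)); last by rewrite mulrC ler_pM2r.
  case: ifP => [/andP[e1 _]|_]; last by rewrite !mulr0.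
  by rewrite invfM exprS; field; rewrite !gt_eqF//; exact: lt_le_trans e1.
rewrite -(fubini_tonelli (EFin \o L)) => //; last exact/measurable_EFinP.
(* Obtained from [L] by replacing [r] by [r / |x|]: the [n] powers from [rpow], the Jacobian and
   [c x] combine into the [|x|^-(n+2)] of the weight. *)
pose P (p : V * measurableTypeR R) : R :=
  rpow p.2 * (polar_weight p.1 * H ((p.2 : R) *: unitv p.1)).
have P0 p : 0 <= P p by rewrite /P !mulr_ge0 ?rpow_ge0// polar_weight_ge0.
have mP : measurable_fun setT P.
  apply: measurable_funM; last exact: measurable_polar_integrand.
  by apply: (measurableT_comp measurable_rpow); exact: measurable_snd.
transitivity (\int[mu]_x \int[leb]_r (P (x, r))%:E)%E.
  apply: eq_integral => x _.
  have [ex|ex] := boolP (1 <= enorm x <= 2); last first.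
    by apply: eq_integral => r _; rewrite /L /P /polar_weight /= (negbTE ex) mul0r.
  have e0 : 0 < enorm x by case/andP: ex => + _; apply: lt_le_trans.
  have mPx : measurable_fun setT (fun r => (P (x, r))%:E).
    by apply/measurable_EFinP; apply: measurableT_comp => //; exact: measurable_pair1.
  rewrite -[RHS](@integral_affine R (enorm x) 0 _ (lt0r_neq0 e0) mPx)//; last first.
    by move=> r; rewrite lee_fin.
  rewrite -ge0_integralZl_EFin//; last 2 first.
    by move=> r _; rewrite lee_fin.
    by apply: (measurableT_comp mPx); exact: measurable_affine.
  apply: eq_integral => r _; rewrite -EFinM; congr EFin.
  rewrite /L /P /rpow /polar_weight ex /= addr0 gtr0_norm// pmulr_rgt0// /unitv.
  rewrite (_ : (enorm x * r) *: ((enorm x)^-1 *: x) = r *: x); last first.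
    by rewrite scalerA mulrAC divff ?gt_eqF// mul1r.
  case: ifP => _; last by rewrite !mul0r mulr0.
  rewrite exprMn exprVn /c !exprS; field.
  by rewrite expf_neq0 ?gt_eqF.
rewrite (fubini_tonelli (EFin \o P)) => //; last exact/measurable_EFinP.
apply: eq_integral => r _.
rewrite /polar_mean -ge0_integralZl_EFin//; last 3 first.
- by move=> x _; rewrite lee_fin mulr_ge0// polar_weight_ge0.
- apply/measurable_EFinP/measurable_funM; first exact: measurable_polar_weight.
  apply: measurableT_comp => //; apply: measurable_scaleRn => //.
  exact: measurable_unitv.
- exact: rpow_ge0.
Qed.

End polar.

(** * The heat kernel *)

Section heat.
Context {R : realType}.
Implicit Types r : R.

(** The standard heat kernel at time [r^2], whose Fourier multiplier is [expR (- (r |xi|)^2)].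
    Locking keeps simplification from unfolding it. *)
Definition heat n r (x : 'rV[R]_n) : R :=
  locked (((2 * Num.sqrt pi * r) ^+ n)^-1 * expR (- (enorm x / (2 * r)) ^+ 2)).

Lemma heatE n r (x : 'rV[R]_n) : heat r x =
  ((2 * Num.sqrt pi * r) ^+ n)^-1 * expR (- (enorm x / (2 * r)) ^+ 2).
Proof. by rewrite /heat -lock. Qed.

Lemma sqrtpi_gt0 : 0 < Num.sqrt pi :> R.
Proof. by rewrite sqrtr_gt0 pi_gt0. Qed.

Lemma heat_ge0 n r (x : 'rV[R]_n) : 0 < r -> 0 <= heat r x.
Proof.
move=> r0; rewrite heatE mulr_ge0 ?expR_ge0// invr_ge0 exprn_ge0//.
by rewrite !mulr_ge0// ?ltW// sqrtpi_gt0.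
Qed.

Lemma heatN n r (x : 'rV[R]_n) : heat r (- x) = heat r x.
Proof. by rewrite !heatE enormN. Qed.

Lemma measurable_heat n r : measurable_fun setT (@heat n r).
Proof.
rewrite (_ : @heat n r = fun x => ((2 * Num.sqrt pi * r) ^+ n)^-1 *
  expR (- (enorm x / (2 * r)) ^+ 2)); last by apply/funext => x; exact: heatE.
apply: measurable_funM => //; apply: measurableT_comp => //.
apply: measurable_funN; apply: measurable_funX; apply: measurable_funM => //.
exact: measurable_enorm.
Qed.

Lemma measurable_heat_sub n r (y : 'rV[R]_n) :
  measurable_fun setT (fun x : 'rV[R]_n => heat r (x - y)).
Proof.
apply: (measurableT_comp (@measurable_heat n r)).
have := @measurable_affineRn R n 1 (- y).
by under eq_fun do rewrite scale1r.
Qed.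

Lemma integral_heat n r (y : 'rV[R]_n) : 0 < r ->
  (\int[lebesgueRn n]_x (heat r (x - y))%:E = 1)%E.
Proof.
move=> r0.
have mh : measurable_fun setT (EFin \o @heat n r).
  by apply/measurable_EFinP; exact: measurable_heat.
have h0 (x : 'rV[R]_n) : (0 <= (EFin \o @heat n r) x)%E by rewrite lee_fin heat_ge0.
have := @integral_affineRn R n 1 (- y) _ (oner_neq0 _) mh h0.
rewrite normr1 expr1n mul1e; under eq_integral do rewrite scale1r.
move=> ->; rewrite /comp.
have p0 : 0 < (2 * r)^-1 by rewrite invr_gt0 mulr_gt0.
under eq_integral do rewrite heatE EFinM.
have c0 : 0 < (2 * Num.sqrt pi * r) ^+ n.
  by rewrite exprn_gt0// !mulr_gt0// sqrtpi_gt0.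
rewrite ge0_integralZl_EFin//; last 2 first.
- apply/measurable_EFinP; have := @measurable_gaussRn R n ((2 * r)^-1).
  by under eq_fun do rewrite mulrC.
- by rewrite invr_ge0 ltW.
have := @integral_gaussRn R n _ p0.
under eq_integral do rewrite mulrC.
move=> ->; rewrite -EFinM invrK (_ : Num.sqrt pi * (2 * r) = 2 * Num.sqrt pi * r).
  by rewrite mulVf// gt_eqF.
by ring.
Qed.

End heat.

(** * Integrals of radial functions *)

Section radial.
Context {R : realType} (n : nat).
Notation V := 'rV[R]_n.+1.
Notation mu := (@lebesgueRn R n.+1).
Notation leb := (@lebesgue_measure R).
Implicit Types (x y : V) (r s : R).

Lemma polar_weight_eq0 x : polar_weight x = 0 \/ enorm (unitv x) = 1.
Proof.
rewrite /polar_weight; case: ifP => [/andP[x1 _]|]; [right|by left].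
have x0 : 0 < enorm x by exact: lt_le_trans x1.
by rewrite /unitv enormZ gtr0_norm ?invr_gt0// mulVf// gt_eqF.
Qed.

(** [polar_weight] vanishes wherever [unitv] fails to have norm 1, so a radial factor is constant
    under the integral. *)
Lemma polar_mean_radial (v : R -> R) (H : V -> R) s : 0 < s -> 
  polar_mean (fun x => v (enorm x) * H x) s = polar_mean (fun x => v s * H x) s.
Proof.
move=> s0; apply: eq_integral => x _; congr EFin.
have [->|e] := polar_weight_eq0 x; first by rewrite !mul0r.
by rewrite enormZ e mulr1 gtr0_norm.
Qed.

Definition sphere_mass : \bar R := @polar_mean R n (fun=> 1) 1.

Lemma polar_mean_cst s : @polar_mean R n (fun=> 1) s = sphere_mass.
Proof. by []. Qed.

Lemma polar_meanZ (k : R) (H : V -> R) s : 0 <= k -> measurable_fun setT H ->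
  (forall x, 0 <= H x) ->
  polar_mean (fun x => k * H x) s = (k%:E * polar_mean H s)%E.
Proof.
move=> k0 mH H0; rewrite /polar_mean -ge0_integralZl_EFin//.
- by apply: eq_integral => x _; rewrite -EFinM mulrCA.
- by move=> x _; rewrite lee_fin mulr_ge0// polar_weight_ge0.
- apply/measurable_EFinP/measurable_funM; first exact: measurable_polar_weight.
  by apply: measurableT_comp => //; apply: measurable_scaleRn => //; exact: measurable_unitv.
Qed.

Lemma integral_radial (v : R -> R) : measurable_fun setT v -> (forall s, 0 <= v s) ->
  (\int[mu]_x (v (enorm x))%:E =
   \int[leb]_s (rpow n s * v s)%:E * sphere_mass)%E.
Proof.
move=> mv v0.
have -> : (\int[mu]_x (v (enorm x))%:E = \int[mu]_x (v (enorm x) * 1)%:E)%E.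
  by apply: eq_integral => x _; rewrite mulr1.
rewrite polar_integral; last 2 first.
- apply: measurable_funM => //; apply: measurableT_comp => //; exact: measurable_enorm.
- by move=> x; rewrite mulr1.
have S0 : (0 <= sphere_mass)%E by exact: polar_mean_ge0.
rewrite -ge0_integralZr//; last 2 first.
- apply/measurable_EFinP; apply: measurable_funM => //; exact: measurable_rpow.
- by move=> s _; rewrite lee_fin mulr_ge0// rpow_ge0.
apply: eq_integral => s _.
have [s0|s0] := ltP 0 s; last by rewrite /rpow ltNge s0 /= mul0r !mul0e.
by rewrite polar_mean_radial// polar_meanZ// polar_mean_cst EFinM muleA.
Qed.

(** [integral_radial] is tested on a Gaussian: the total integral is finite and positive and the
    radial integral [J] is positive, so the mass is neither 0 nor infinite. *)
Lemma sphere_mass_fin : exists2 s : R, 0 < s & sphere_mass = s%:E.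
Proof.
have S0 : (0 <= sphere_mass)%E by exact: polar_mean_ge0.
pose J : \bar R := (\int[leb]_s (rpow n s * expR (- (1 * s) ^+ 2))%:E)%E.
have mg : measurable_fun setT (fun s => expR (- (1 * s) ^+ 2) : R).
  by apply: measurableT_comp => //; apply: measurable_funN; apply: measurable_funX; apply: measurable_funM.
have E : (((Num.sqrt pi / 1) ^+ n.+1)%:E = J * sphere_mass)%E.
  by rewrite -integral_gaussRn// (@integral_radial (fun s => expR (- (1 * s) ^+ 2))).
have J0 : (0 < J)%E.
  have h : (0 < \int[leb]_(s in `[1%R, 2%R]) (cst (expR (- 4))%:E s))%E.
    rewrite integral_cst//= lebesgue_measure_itv/= lte_fin ltr1n -EFinB -EFinM lte_fin.
    by rewrite mulr_gt0 ?expR_gt0//; lra.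
  apply: (lt_le_trans h).
  apply: (@le_trans _ _ (\int[leb]_(s in `[1%R, 2%R]) (rpow n s * expR (- (1 * s) ^+ 2))%:E)%E).
    apply: ge0_le_integral => //.
    - by move=> s _; rewrite /= lee_fin expR_ge0.
    - apply/measurable_EFinP; apply: measurable_funTS; apply: measurable_funM => //; exact: measurable_rpow.
    - move=> s /=; rewrite in_itv/= => /andP[s1 s2]; rewrite lee_fin /rpow ifT; last by lra.
      apply: (@le_trans _ _ (1 * expR (- 4))); first by rewrite mul1r.
      rewrite ler_pM ?expR_ge0 ?exprn_ege1// ler_expR; nra.
  apply: ge0_subset_integral => //.
    apply/measurable_EFinP; apply: measurable_funM => //; exact: measurable_rpow.
  by move=> s _; rewrite lee_fin mulr_ge0 ?expR_ge0 ?rpow_ge0.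
have p0 : (0:R) < (Num.sqrt pi / 1) ^+ n.+1 by rewrite exprn_gt0// divr_gt0// sqrtpi_gt0.
case: sphere_mass E S0 => [s| |]//.
- move=> E s0; exists s => //; rewrite lt_neqAle eq_sym -lee_fin s0 andbT.
  apply/eqP => s00; move: E; rewrite s00 mule0 => -[] /eqP.
  by rewrite gt_eqF.
- by rewrite gt0_muley.
Qed.

End radial.

(** * Spherical averages of the heat kernel *)

Section heat_radial.
Context {R : realType} (n : nat).
Notation V := 'rV[R]_n.+1.
Notation mu := (@lebesgueRn R n.+1).
Notation leb := (@lebesgue_measure R).
Implicit Types (x y : V) (r s k : R).

Let K : R := locked ((2 * Num.sqrt pi) ^+ n.+1)^-1.

Let K0 : 0 < K.
Proof. by rewrite /K -lock invr_gt0 exprn_gt0// mulr_gt0// sqrtpi_gt0. Qed.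

(* [theta y x] is nonnegative by Cauchy-Schwarz, so that [expR (- k * theta y x)]
   decreases in [k]: this monotonicity along rays is what localizes the
   spherical mean of the heat kernel. *)
Definition theta y x : R := enorm y - dotrV y (unitv x).

Let I y k : \bar R := (\int[mu]_x (polar_weight x * expR (- (k * theta y x)))%:E)%E.

Let mtheta y : measurable_fun setT (theta y).
Proof.
apply: measurable_funB => //; apply: (measurableT_comp (measurable_dotrV y)).
exact: measurable_unitv.
Qed.

Let mI y k : measurable_fun setT
  (fun x => (polar_weight x * expR (- (k * theta y x)))%:E).
Proof.
apply/measurable_EFinP/measurable_funM; first exact: measurable_polar_weight.
by apply: measurableT_comp => //; apply: measurable_funN; exact: measurable_funM.
Qed.

Let theta_ge0 y x : polar_weight x != 0 -> 0 <= theta y x.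
Proof.
have [->|e] := polar_weight_eq0 x; first by rewrite eqxx.
by move=> _; rewrite subr_ge0; have := dotrV_le y (unitv x); rewrite e mulr1.
Qed.

(** For a unit vector [w], [|s w - y|^2 = (s - |y|)^2 + 2 s (|y| - y . w)]: radial and angular parts
    of the exponent separate. *)
Let heat_polar r s y x : polar_weight x != 0 -> 0 < s -> 0 < r ->
  heat r (s *: unitv x - y) = K * r^-1 ^+ n.+1 *
    expR (- (((s - enorm y) ^+ 2 + 2 * s * theta y x) / (4 * r ^+ 2))).
Proof.
have [->|e] := polar_weight_eq0 x; first by rewrite eqxx.
move=> _ s0 r0; rewrite heatE /K -lock exprMn invfM exprVn; congr (_ * expR (- _)).
rewrite expr_div_n enormB_sqr enormZ dotrVZl e mulr1 real_normK ?num_real//.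
by rewrite /theta dotrVC; field; rewrite gt_eqF.
Qed.

Let heat_weight_le r s y x c : 0 < s -> 0 < r ->
  (0 <= theta y x -> expR (- (((s - enorm y) ^+ 2 + 2 * s * theta y x) / (4 * r ^+ 2))) <= c) ->
  polar_weight x * heat r (s *: unitv x - y) <= K * r^-1 ^+ n.+1 * (polar_weight x * c).
Proof.
move=> s0 r0 h; have [->|w0] := eqVneq (polar_weight x) 0; first by rewrite !mul0r mulr0.
rewrite heat_polar// [leRHS]mulrCA ler_wpM2l ?polar_weight_ge0// ler_wpM2l//.
  by rewrite mulr_ge0 ?exprn_ge0 ?invr_ge0// ltW.
by apply: h; exact: theta_ge0.
Qed.

Let mheat r s y : measurable_fun setT
  (fun x => (polar_weight x * heat r (s *: unitv x - y))%:E).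
Proof.
apply/measurable_EFinP/measurable_funM; first exact: measurable_polar_weight.
apply: (measurableT_comp (measurable_heat_sub r y)).
by apply: measurable_scaleRn => //; exact: measurable_unitv.
Qed.

(* Obtained by restricting [\int heat (2 r) (x - y) dx = 1], written in polar
   coordinates, to the shell of width [r] inside the sphere through [y]. *)
Let C1 : R := locked (K * 2^-1 ^+ n.+1 * expR (- 16^-1) * 2^-1 ^+ n)^-1.

Let C1_gt0 : 0 < C1.
Proof. by rewrite /C1 -lock invr_gt0 !mulr_gt0 ?expR_gt0 ?exprn_gt0. Qed.

(** On the shell, the kernel of width [2 r] decays in [theta] at rate at most [|y| / (8 r^2)]. The
    kernel of width [r] decays at least that fast on spheres of radius at least [|y| / 2], which is
    where [polar_mean_heat_le] applies this bound; hence the doubled width. *)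
Lemma spherical_mean_le r y : 0 < r -> 2 * r <= enorm y ->
  (I y (enorm y / (8 * r ^+ 2)) <= (C1 * (r / enorm y) ^+ n)%:E)%E.
Proof.
move=> r0 rq; set q := enorm y; set Iy := I y _.
have q0 : 0 < q by apply: lt_le_trans rq; rewrite mulr_gt0.
have Iy0 : (0 <= Iy)%E.
  by apply: integral_ge0 => x _; rewrite lee_fin mulr_ge0 ?expR_ge0 ?polar_weight_ge0.
(* On the shell the polar integrand is at least [a * Iy]: there [s >= q / 2] because [2 r <= q], and
   [(s - q)^2 / (16 r^2) <= 1 / 16]. *)
pose a : R := (q / 2) ^+ n * (K * (2 * r)^-1 ^+ n.+1 * expR (- 16^-1)).
have a0 : 0 < a.
  by rewrite !mulr_gt0 ?expR_gt0 ?exprn_gt0 ?divr_gt0 ?invr_gt0 ?mulr_gt0.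
have r2 : 0 < 2 * r by rewrite mulr_gt0.
have mh := measurable_heat_sub (2 * r) y.
have h0 x : 0 <= heat (2 * r) (x - y) := heat_ge0 _ r2.
suff : ((a * r)%:E * Iy <= 1)%E.
  have ar : 0 < a * r by rewrite mulr_gt0.
  move: Iy0; case: Iy => [i| |]//.
  - rewrite -EFinM !lee_fin => i0 h.
    rewrite (_ : C1 * _ = (a * r)^-1).
      by rewrite -[leRHS]mul1r ler_pdivlMr// mulrC.
    rewrite /C1 -lock /a !exprMn !exprVn exprMn !exprS; field.
    rewrite !expf_neq0 ?gt_eqF ?expR_gt0//.
  - by rewrite gt0_muley ?lte_fin// leye_eq.
rewrite -(integral_heat y r2) polar_integral//.
apply: (@le_trans _ _ (\int[leb]_(s in `[(q - r)%R, q]) (cst (a%:E * Iy)%E s))%E).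
  rewrite integral_cst//= lebesgue_measure_itv/= lte_fin ifT; last by lra.
  rewrite -EFinB (_ : q - (q - r) = r); last by ring.
  by rewrite EFinM muleAC.
have mp : measurable_fun setT (fun s => (rpow n s)%:E * polar_mean (fun x => heat (2 * r) (x - y)) s)%E.
  apply: emeasurable_funM; last exact: measurable_polar_mean.
  by apply/measurable_EFinP; exact: measurable_rpow.
apply: (@le_trans _ _ (\int[leb]_(s in `[(q - r)%R, q])
   ((rpow n s)%:E * polar_mean (fun x => heat (2 * r) (x - y)) s))%E); last first.
  apply: ge0_subset_integral => //.
  by move=> s _; rewrite mule_ge0 ?polar_mean_ge0 ?lee_fin ?rpow_ge0.
apply: ge0_le_integral => //.
- by move=> s _; rewrite /= mule_ge0// lee_fin ltW.
- exact: measurable_funTS.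
move=> s /=; rewrite in_itv/= => /andP[s1 s2].
have s0 : 0 < s by rewrite -/q in rq; lra.
rewrite /rpow s0 /a EFinM -muleA; apply: lee_pmul => //.
- by rewrite lee_fin exprn_ge0// divr_ge0// ltW.
- by rewrite mule_ge0// lee_fin !mulr_ge0 ?expR_ge0 ?exprn_ge0 ?invr_ge0// ltW.
- by rewrite lee_fin lerXn2r ?nnegrE ?divr_ge0 ?(ltW q0) ?(ltW s0)//; rewrite -/q in rq; lra.
rewrite /Iy /I -ge0_integralZl_EFin//; last 2 first.
- by move=> x _; rewrite lee_fin mulr_ge0 ?expR_ge0 ?polar_weight_ge0.
- by rewrite !mulr_ge0 ?expR_ge0 ?exprn_ge0 ?invr_ge0// ltW.
apply: ge0_le_integral => //.
- move=> x _; rewrite mule_ge0// lee_fin !mulr_ge0 ?expR_ge0 ?polar_weight_ge0 ?exprn_ge0 ?invr_ge0// ltW//.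
- exact: measurable_funeM.
move=> x _; rewrite -EFinM lee_fin mulrCA.
have [->|w0] := eqVneq (polar_weight x) 0; first by rewrite !mul0r.
rewrite ler_wpM2l ?polar_weight_ge0// heat_polar// -!mulrA ler_wpM2l ?(ltW K0)//.
rewrite ler_wpM2l ?exprn_ge0 ?invr_ge0 ?(ltW r2)// -expRD ler_expR.
have t0 := theta_ge0 y w0; rewrite -/q in rq *.
rewrite -subr_ge0 (_ : _ - _ = (r ^+ 2 - (s - q) ^+ 2 + 2 * (q - s) * theta y x) / (16 * r ^+ 2)).
  apply: divr_ge0; last by rewrite mulr_ge0// sqr_ge0.
  apply: addr_ge0; first by rewrite subr_ge0; nra.
  by rewrite mulr_ge0// mulr_ge0// subr_ge0.
by field; rewrite gt_eqF.
Qed.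

Let C3 : R := (8 * n.+1%:R) ^+ n.

(** For [z >= 2] the exponent is at most [- z / 8], and [expR (z / 8)] dominates the [n]-th power of
    [expR (z / (8 (n+1)))], which is at least [z / (8 (n+1))]. Dividing by [n+1] instead of [n]
    covers [n = 0]. *)
Let exp_decay z : 2 <= z -> expR (- (z ^+ 2 / 16)) <= C3 * z^-1 ^+ n.
Proof.
move=> z2; have z0 : 0 < z by lra.
have m0 : (0:R) < 8 * n.+1%:R by rewrite mulr_gt0 ?ltr0Sn.
apply: (@le_trans _ _ (expR (- (z / 8)))); first by rewrite ler_expR lerN2; nra.
rewrite expRN -[leRHS]invrK lef_pV2 ?posrE ?expR_gt0//; last first.
  by rewrite invr_gt0 mulr_gt0 ?exprn_gt0 ?invr_gt0.
rewrite /C3 -exprMn -exprVn invfM invrK mulrC.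
apply: (@le_trans _ _ (expR (z / (8 * n.+1%:R)) ^+ n)).
  rewrite lerXn2r ?nnegrE ?expR_ge0 ?divr_ge0 ?(ltW z0) ?(ltW m0)//.
  by apply: le_trans (expR_ge1Dx _); rewrite lerDr.
rewrite -expRM_natr ler_expR.
rewrite (_ : _ * n%:R = z / 8 * (n%:R / n.+1%:R)); last first.
  have : n.+1%:R != 0 :> R by rewrite pnatr_eq0.
  by move: (n.+1%:R) (n%:R) => m k m1; field.
by rewrite ger_pMr ?divr_gt0// ler_pdivrMr ?ltr0Sn// mul1r ler_nat.
Qed.

(** The bound is uniform in the radius [s]. The kernel is pointwise of size [r^-(n+1)]; averaging
    gains [(r / |y|)^n], roughly the proportion of the sphere through [y] that lies within distance
    [r] of [y]. *)
Lemma polar_mean_heat_le : exists2 C : R, 0 < C & forall r y s, 0 < r -> y != 0 ->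
  0 < s ->
  (polar_mean (fun x => heat r (x - y)) s <= (C * (r * enorm y ^+ n)^-1)%:E)%E.
Proof.
have [S S0 SE] := @sphere_mass_fin R n.
have C30 : 0 <= C3 by rewrite exprn_ge0// mulr_ge0.
exists (K * (2 ^+ n * S + C1 + C3 * S)).
  have C3p : 0 < C3 by rewrite exprn_gt0// mulr_gt0 ?ltr0Sn.
  apply: mulr_gt0 => //; apply: addr_gt0; last exact: mulr_gt0.
  by apply: addr_gt0 => //; rewrite mulr_gt0 ?exprn_gt0.
move=> r y s r0 y0 s0; set q := enorm y.
have q0 : 0 < q by rewrite lt_neqAle eq_sym enorm_eq0 y0 enorm_ge0.
have mono (c : V -> R) (B : \bar R) :
    (forall x, polar_weight x != 0 -> 0 <= theta y x ->
      expR (- (((s - q) ^+ 2 + 2 * s * theta y x) / (4 * r ^+ 2))) <= c x) ->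
    (forall x, 0 <= c x) -> measurable_fun setT c ->
    (\int[mu]_x (polar_weight x * c x)%:E <= B)%E ->
    (polar_mean (fun x => heat r (x - y)) s <= (K * r^-1 ^+ n.+1)%:E * B)%E.
  move=> hc c0 mc hB.
  have k0 : 0 <= K * r^-1 ^+ n.+1 by rewrite mulr_ge0 ?exprn_ge0 ?invr_ge0// ltW.
  have mwc : measurable_fun setT (fun x => (polar_weight x * c x)%:E).
    by apply/measurable_EFinP; apply: measurable_funM => //; exact: measurable_polar_weight.
  apply: (@le_trans _ _ ((K * r^-1 ^+ n.+1)%:E * \int[mu]_x (polar_weight x * c x)%:E)%E).
    rewrite -ge0_integralZl_EFin//; last first.
      by move=> x _; rewrite lee_fin mulr_ge0 ?polar_weight_ge0.
    apply: ge0_le_integral => //.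
    - by move=> x _; rewrite lee_fin mulr_ge0 ?polar_weight_ge0 ?heat_ge0.
    - exact: measurable_funeM.
    - move=> x _; rewrite -EFinM lee_fin.
      have [w0|w0] := eqVneq (polar_weight x) 0; first by rewrite w0 !mul0r mulr0.
      by apply: heat_weight_le => // t0; exact: hc.
  by rewrite lee_wpmul2l// lee_fin.
have cstE (c : R) : 0 <= c -> (\int[mu]_x (polar_weight x * c)%:E = (c * S)%:E)%E.
  move=> c0; rewrite EFinM -SE -(@polar_mean_cst R n 1) -polar_meanZ//.
  by apply: eq_integral => x _; rewrite mulr1.
set D := 2 ^+ n * S + C1 + C3 * S.
have D1 : 2 ^+ n * S <= D.
  by rewrite /D -addrA lerDl addr_ge0 ?(ltW C1_gt0)// mulr_ge0// ltW.
have D2 : C1 <= D.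
  by rewrite /D addrAC lerDr addr_ge0// mulr_ge0 ?exprn_ge0// ltW.
have D3 : C3 * S <= D.
  by rewrite /D lerDr addr_ge0 ?(ltW C1_gt0)// mulr_ge0 ?exprn_ge0// ltW.
have T (c D' : R) : D' <= D -> c <= D' * (r / q) ^+ n ->
    ((K * r^-1 ^+ n.+1)%:E * c%:E <= (K * D * (r * q ^+ n)^-1)%:E)%E.
  move=> D'D cD; rewrite -EFinM lee_fin.
  apply: (@le_trans _ _ (K * r^-1 ^+ n.+1 * (D * (r / q) ^+ n))).
    rewrite ler_wpM2l ?mulr_ge0 ?exprn_ge0 ?invr_ge0 ?(ltW r0) ?(ltW K0)//.
    apply: (le_trans cD); by rewrite ler_wpM2r// exprn_ge0// divr_ge0// ltW.
  rewrite le_eqVlt; apply/orP; left; apply/eqP.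
  rewrite exprS exprMn !exprVn; field.
  by rewrite !expf_neq0 ?gt_eqF.
(* If [q < 2 r] there is nothing to gain: [(2 r / q)^n >= 1] already pays for bounding the
   exponential by 1. *)
have [rq|rq] := leP (2 * r) q; last first.
  apply: le_trans (T (1 * S) (2 ^+ n * S) D1 _); last first.
    rewrite mulrAC ler_wpM2r ?(ltW S0)// -exprMn exprn_ege1// mulrA.
    by rewrite ler_pdivlMr// mul1r ltW.
  apply: (mono (fun=> 1)) => //; last by rewrite cstE.
  move=> x _ t0; rewrite -expR0 ler_expR oppr_le0 divr_ge0//; last by rewrite mulr_ge0 ?sqr_ge0.
  by rewrite addr_ge0 ?sqr_ge0// !mulr_ge0// ltW.
(* Large spheres are compared with [spherical_mean_le] through their angular decay. Small ones stay
   at distance at least [q / 2] from [y], so the radial factor alone is at most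
   [expR (- ((q / r)^2 / 16))]. *)
have [sq|sq] := leP (q / 2) s.
  apply: le_trans (T (C1 * (r / q) ^+ n) C1 D2 (lexx _)).
  apply: (mono (fun x => expR (- (q / (8 * r ^+ 2) * theta y x)))); last 2 first.
  - by apply: measurableT_comp => //; apply: measurable_funN; exact: measurable_funM.
  - exact: spherical_mean_le.
  - move=> x _ t0; rewrite ler_expR lerN2 -subr_ge0.
    rewrite (_ : _ - _ = ((s - q) ^+ 2 + 2 * (s - q / 4) * theta y x) / (4 * r ^+ 2)).
      apply: divr_ge0; last by rewrite mulr_ge0// sqr_ge0.
      by rewrite addr_ge0 ?sqr_ge0// !mulr_ge0//; lra.
    by field; rewrite gt_eqF.
  - by move=> x; exact: expR_ge0.
apply: le_trans (T (expR (- ((q / r) ^+ 2 / 16)) * S) _ D3 _); last first.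
  rewrite [leRHS]mulrAC ler_wpM2r ?(ltW S0)//.
  rewrite -(invrK (r / q)) invf_div exprVn -exprVn; apply: exp_decay.
  by rewrite ler_pdivlMr.
apply: (mono (fun=> expR (- ((q / r) ^+ 2 / 16)))) => //; last by rewrite cstE ?expR_ge0.
move=> x _ t0; rewrite ler_expR lerN2 -subr_ge0.
rewrite (_ : _ - _ = ((s - q) ^+ 2 - q ^+ 2 / 4 + 2 * s * theta y x) / (4 * r ^+ 2)).
  apply: divr_ge0; last by rewrite mulr_ge0// sqr_ge0.
  apply: addr_ge0; first by rewrite subr_ge0; nra.
  by rewrite !mulr_ge0// ltW.
by field; rewrite gt_eqF.
Qed.

(* The kernel, averaged over the sphere through [x], is at most
   [C / (r |y|^n)]: the radial gain over the pointwise bound [C / r^(n+1)]. *)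
Lemma heat_radial_le : exists2 C : R, 0 < C & forall r y (v : R -> R),
  0 < r -> y != 0 -> measurable_fun setT v -> (forall s, 0 <= v s) ->
  (\int[mu]_x (v (enorm x) * heat r (x - y))%:E <=
   (C * (r * enorm y ^+ n)^-1)%:E * \int[mu]_x (v (enorm x))%:E)%E.
Proof.
have [C C0 HC] := polar_mean_heat_le.
have [S S0 SE] := @sphere_mass_fin R n.
exists (C / S); first by rewrite divr_gt0.
move=> r y v r0 y0 mv v0; rewrite integral_radial// SE.
have q0 : 0 < enorm y by rewrite lt_neqAle eq_sym enorm_eq0 y0 enorm_ge0.
have mve : measurable_fun setT (fun x => v (enorm x)).
  by apply: measurableT_comp => //; exact: measurable_enorm.
have mh := measurable_heat_sub r y.
have h0 x : 0 <= heat r (x - y) := heat_ge0 _ r0.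
rewrite polar_integral; last 2 first.
- exact: measurable_funM.
- by move=> x; rewrite mulr_ge0.
set B := C * (r * enorm y ^+ n)^-1.
have B0 : 0 <= B by rewrite mulr_ge0 ?(ltW C0)// invr_ge0 mulr_ge0 ?exprn_ge0// ltW.
rewrite (_ : C / S * _ = B / S); last by rewrite /B mulrAC.
rewrite muleCA -EFinM divfK ?gt_eqF// muleC.
have mr : measurable_fun setT (fun s => (rpow n s * v s)%:E).
  by apply/measurable_EFinP; apply: measurable_funM => //; exact: measurable_rpow.
rewrite -ge0_integralZl_EFin//; last first.
  by move=> s _; rewrite lee_fin mulr_ge0// rpow_ge0.
apply: ge0_le_integral => //.
- move=> s _; rewrite mule_ge0 ?lee_fin ?rpow_ge0// polar_mean_ge0// => x.
  by rewrite mulr_ge0.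
- apply: emeasurable_funM; first by apply/measurable_EFinP; exact: measurable_rpow.
  apply: measurable_polar_mean; first exact: measurable_funM.
  by move=> x; rewrite mulr_ge0.
- exact: measurable_funeM.
move=> s _; have [s0|s0] := ltP 0 s; last first.
  by rewrite /rpow ltNge s0 /= mul0r mul0e mule0.
rewrite polar_mean_radial// polar_meanZ// -EFinM.
rewrite (_ : B * _ = rpow n s * (v s * B)); last by ring.
rewrite (EFinM (rpow n s)) (EFinM (v s)).
apply: lee_wpmul2l; first by rewrite lee_fin rpow_ge0.
by apply: lee_wpmul2l; [rewrite lee_fin|exact: HC].
Qed.

End heat_radial.

(** * The heat form of a radial function at one scale *)

Section heat_form.
Context {R : realType} (n : nat).
Notation V := 'rV[R]_n.+1.
Notation mu := (@lebesgueRn R n.+1).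
Implicit Types (x y : V) (r m : R) (f g : V -> R).

(** [|x|^((d-1)/2)] in dimension [d = n + 1]. *)
Definition wnorm x : R := Num.sqrt (enorm x ^+ n).

Lemma wnorm_ge0 x : 0 <= wnorm x. Proof. exact: sqrtr_ge0. Qed.

Lemma wnorm_gt0 x : x != 0 -> 0 < wnorm x.
Proof.
by move=> x0; rewrite sqrtr_gt0 exprn_gt0// lt_neqAle eq_sym enorm_eq0 x0 enorm_ge0.
Qed.

Lemma wnorm_sqr x : wnorm x ^+ 2 = enorm x ^+ n.
Proof. by rewrite sqr_sqrtr// exprn_ge0// enorm_ge0. Qed.

Lemma measurable_wnorm : measurable_fun setT wnorm.
Proof.
by apply: measurable_sqrt; apply: measurable_funX; exact: measurable_enorm.
Qed.

Lemma measurable_heat_pair r :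
  measurable_fun setT (fun p : V * V => heat r (p.1 - p.2)).
Proof.
apply: (measurableT_comp (measurable_heat r)); apply: measurable_fun_rV => i.
under eq_fun do rewrite !mxE.
apply: measurable_funB; apply: (measurableT_comp (measurable_coord i)).
  exact: measurable_fst.
exact: measurable_snd.
Qed.

Definition heat_form r f g : \bar R :=
  (\int[mu]_y \int[mu]_x (f x * g y * heat r (x - y))%:E)%E.

Section heat_form_theory.
Variables (r : R) (r0 : 0 < r).

Lemma measurable_heat_form f g : measurable_fun setT f -> measurable_fun setT g ->
  measurable_fun setT (fun p : V * V => (f p.1 * g p.2 * heat r (p.1 - p.2))%:E).
Proof.
move=> mf mg; apply/measurable_EFinP.
apply: measurable_funM; last exact: measurable_heat_pair.
by apply: measurable_funM; apply: measurableT_comp.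
Qed.

Lemma heat_formC f g : measurable_fun setT f -> measurable_fun setT g ->
  (forall x, 0 <= f x) -> (forall x, 0 <= g x) -> heat_form r f g = heat_form r g f.
Proof.
move=> mf mg f0 g0; rewrite /heat_form.
rewrite -(fubini_tonelli (fun p : V * V => (f p.1 * g p.2 * heat r (p.1 - p.2))%:E)).
- apply: eq_integral => y _; apply: eq_integral => x _ /=.
  by rewrite -heatN opprB (mulrC (f y)).
- exact: measurable_heat_form.
- by move=> p; rewrite lee_fin mulr_ge0 ?heat_ge0 ?mulr_ge0.
Qed.

Lemma heat_form1 g : measurable_fun setT g -> (forall x, 0 <= g x) ->
  heat_form r (fun=> 1) g = (\int[mu]_y (g y)%:E)%E.
Proof.
move=> mg g0; apply: eq_integral => y _.
under eq_integral do rewrite mul1r EFinM.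
rewrite ge0_integralZl_EFin ?integral_heat ?mule1//; last first.
  by apply/measurable_EFinP; exact: measurable_heat_sub.
by move=> x _; rewrite lee_fin heat_ge0.
Qed.

Lemma heat_formE f g : measurable_fun setT f -> measurable_fun setT g ->
  (forall x, 0 <= f x) -> (forall x, 0 <= g x) ->
  heat_form r f g =
  (\int[mu \x mu]_p (f p.1 * g p.2 * heat r (p.1 - p.2))%:E)%E.
Proof.
move=> mf mg f0 g0; rewrite fubini_tonelli2//; first exact: measurable_heat_form.
by move=> p; rewrite lee_fin mulr_ge0 ?heat_ge0 ?mulr_ge0.
Qed.

End heat_form_theory.

Lemma heat_form_le : exists2 C : R, 0 < C & forall v : R -> R,
  measurable_fun setT v -> (forall s, 0 <= v s) ->
  (\int[mu]_x (v (enorm x) ^+ 2)%:E = 1)%E ->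
  let u x := v (enorm x) in forall m, 0 < m ->
  (heat_form (m ^- 2) u u <=
   \int[mu]_y (if u y * wnorm y <= m then u y ^+ 2
               else C * (m / wnorm y) * u y)%:E)%E.
Proof.
have [C C0 HC] := @heat_radial_le R n.
exists (C + 1); first by rewrite addr_gt0.
move=> v mv v0 v1 u m m0; set r := m ^- 2.
have r0 : 0 < r by rewrite invr_gt0 exprn_gt0.
have u0 x : 0 <= u x by exact: v0.
have mu_ : measurable_fun setT u by apply: measurableT_comp => //; exact: measurable_enorm.
have h0 x : 0 <= heat r x := heat_ge0 _ r0.
pose M y := m / wnorm y.
have M0 y : 0 <= M y by rewrite divr_ge0 ?wnorm_ge0// ltW.
have mM : measurable_fun setT M.
  apply: measurable_funM => //.
  by apply: measurable_funV_ge0 => [|x]; [exact: measurable_wnorm|exact: wnorm_ge0].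
have pointwise y : y != 0 ->
    (\int[mu]_x (u x * heat r (x - y))%:E <= ((C + 1) / 2 * M y)%:E)%E.
  move=> y0; have w0 := wnorm_gt0 y0.
  have My : 0 < M y by rewrite divr_gt0.
  have mh := measurable_heat_sub r y.
  have i1 : measurable_fun setT (fun x => (u x ^+ 2 * heat r (x - y))%:E).
    by apply/measurable_EFinP; apply: measurable_funM => //; exact: measurable_funX.
  have i2 : measurable_fun setT (fun x => (heat r (x - y))%:E) by exact/measurable_EFinP.
  apply: (@le_trans _ _ (\int[mu]_x (((2 * M y)^-1)%:E * (u x ^+ 2 * heat r (x - y))%:E
     + (M y / 2)%:E * (heat r (x - y))%:E))%E).
    apply: ge0_le_integral => //.
    - by move=> x _; rewrite lee_fin mulr_ge0.
    - by apply/measurable_EFinP; apply: measurable_funM.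
    - by apply: emeasurable_funD; exact: measurable_funeM.
    move=> x _; rewrite -!EFinM -EFinD lee_fin.
    rewrite [leRHS](_ : _ = ((2 * M y)^-1 * u x ^+ 2 + M y / 2) * heat r (x - y)); last first.
      by ring.
    rewrite ler_wpM2r//.
    rewrite -subr_ge0 (_ : _ - _ = (u x - M y) ^+ 2 / (2 * M y)).
      by rewrite divr_ge0 ?sqr_ge0// mulr_ge0// ltW.
    by field; rewrite gt_eqF.
  have q1 x : 0 <= u x ^+ 2 * heat r (x - y) by rewrite mulr_ge0 ?sqr_ge0.
  rewrite ge0_integralD//; last 4 first.
  - by move=> x _; apply: mule_ge0; rewrite lee_fin ?q1// invr_ge0 mulr_ge0.
  - exact: measurable_funeM.
  - by move=> x _; apply: mule_ge0; rewrite lee_fin ?h0// divr_ge0.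
  - exact: measurable_funeM.
  rewrite !ge0_integralZl_EFin//; last 4 first.
  - by move=> x _; rewrite lee_fin.
  - by rewrite divr_ge0.
  - by move=> x _; rewrite lee_fin mulr_ge0 ?sqr_ge0.
  - by rewrite invr_ge0 mulr_ge0.
  rewrite integral_heat// mule1.
  have := HC r y (fun s => v s ^+ 2) r0 y0 (measurable_funX 2 mv) (fun s => sqr_ge0 _).
  rewrite v1 mule1 => h.
  (* This is where [r = m^-2] matters: [C / (r |y|^n) = C (M y)^2], so both parts of the estimate
     are multiples of [M y]. *)
  have -> : (C + 1) / 2 * M y = (2 * M y)^-1 * (C / (r * enorm y ^+ n)) + M y / 2.
    by rewrite -wnorm_sqr /r /M; field; rewrite !gt_eqF.
  rewrite EFinD (EFinM (2 * M y)^-1); apply: leeD2r; apply: lee_wpmul2l; last exact: h.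
  by rewrite lee_fin invr_ge0 mulr_ge0.
pose a x := if u x * wnorm x <= m then u x else 0.
pose b x := if u x * wnorm x <= m then 0 else u x.
have a0 x : 0 <= a x by rewrite /a; case: ifP.
have b0 x : 0 <= b x by rewrite /b; case: ifP.
have mc : measurable_fun setT (fun x => u x * wnorm x <= m).
  by apply: measurable_fun_ler => //; apply: measurable_funM => //; exact: measurable_wnorm.
have ma : measurable_fun setT a by exact: measurable_fun_ifT.
have mb : measurable_fun setT b by exact: measurable_fun_ifT.
have uab x : u x = a x + b x by rewrite /a /b; case: ifP => _; rewrite ?addr0 ?add0r.
pose a2 x := a x ^+ 2 / 2.
have a20 x : 0 <= a2 x by rewrite divr_ge0 ?sqr_ge0.
have ma2 : measurable_fun setT a2 by apply: measurable_funM => //; exact: measurable_funX.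
pose B y := (C + 1) / 2 * M y * b y.
have B0 y : 0 <= B y.
  apply: mulr_ge0 => //; apply: mulr_ge0 => //; apply: divr_ge0 => //.
  by rewrite addr_ge0// ltW.
have mB : measurable_fun setT B by apply: measurable_funM => //; exact: measurable_funM.
have F0 f g : (forall x, 0 <= f x) -> (forall x, 0 <= g x) ->
    forall p : V * V, [set: V * V] p -> (0 <= (f p.1 * g p.2 * heat r (p.1 - p.2))%:E)%E.
  by move=> f0 g0 p _; rewrite lee_fin mulr_ge0 ?h0 ?mulr_ge0.
pose F f g (p : V * V) := (f p.1 * g p.2 * heat r (p.1 - p.2))%:E.
have m1 : measurable_fun setT (fun _ : V => 1 : R) by [].
have mF f g : measurable_fun setT f -> measurable_fun setT g -> measurable_fun setT (F f g).
  exact: measurable_heat_form.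
(* Writing primes for values at the second point, [u u' <= (a^2 + a'^2) / 2 + u b' + b u']. Counting
   [b b'] twice leaves the whole of [u] beside each [b], the form to which [pointwise] applies. *)
have step1 : (heat_form r u u <= (heat_form r a2 (fun=> 1%R) + heat_form r (fun=> 1%R) a2) +
    (heat_form r u b + heat_form r b u))%E.
  rewrite !heat_formE//.
  rewrite -[leRHS](_ : (\int[mu \x mu]_p ((F a2 (fun=> 1%R) p + F (fun=> 1%R) a2 p) +
     (F u b p + F b u p)) = _)%E); last first.
    rewrite ge0_integralD//; last 4 first.
    - by move=> p _; rewrite adde_ge0// F0.
    - by apply: emeasurable_funD; exact: mF.
    - by move=> p _; rewrite adde_ge0// F0.
    - by apply: emeasurable_funD; exact: mF.
    by rewrite !ge0_integralD//; solve [exact: F0|exact: mF].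
  apply: ge0_le_integral => //.
  - exact: F0.
  - exact: mF.
  - by apply: emeasurable_funD; apply: emeasurable_funD; exact: mF.
  move=> p _; rewrite /F -!EFinD lee_fin -!mulrDl ler_wpM2r// mulr1 mul1r !uab /a2.
  have h1 := a0 p.1; have h2 := a0 p.2; have h3 := b0 p.1; have h4 := b0 p.2.
  have := sqr_ge0 (a p.1 - a p.2).
  have := mulr_ge0 h3 h4.
  nra.
have step2 : (heat_form r u b <= \int[mu]_y (B y)%:E)%E.
  apply: ae_ge0_le_integral => //.
  - by move=> y _; apply: integral_ge0 => x _; rewrite lee_fin mulr_ge0 ?h0 ?mulr_ge0.
  - exact: (@measurable_fun_fubini_tonelli_G _ _ _ _ _ mu (F u b) (mF _ _ mu_ mb)
      (fun p => F0 u b u0 b0 p Logic.I)).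
  - by move=> y _; rewrite lee_fin.
  - exact/measurable_EFinP.
  move: (@ae_neq0 R n); apply: filterS => y y0 _.
  under eq_integral do rewrite mulrAC mulrC EFinM.
  rewrite ge0_integralZl_EFin//; last 2 first.
  - by move=> x _; rewrite lee_fin mulr_ge0.
  - by apply/measurable_EFinP; apply: measurable_funM => //; exact: measurable_heat_sub.
  by rewrite /B mulrC EFinM lee_wpmul2l ?lee_fin// pointwise.
apply: (le_trans step1).
rewrite heat_formC// heat_form1// (heat_formC r0 mb mu_)//.
apply: (@le_trans _ _ ((\int[mu]_y (a2 y)%:E + \int[mu]_y (a2 y)%:E) +
  (\int[mu]_y (B y)%:E + \int[mu]_y (B y)%:E))%E).
  by rewrite leeD2l// leeD.
have iE f : measurable_fun setT f -> (forall x, 0 <= f x) ->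
   (\int[mu]_y (f y)%:E + \int[mu]_y (f y)%:E = \int[mu]_y (2 * f y)%:E)%E.
  move=> mf f0; rewrite -ge0_integralD//.
  - by apply: eq_integral => y _; rewrite -EFinD; congr EFin; ring.
  - by move=> y _; rewrite lee_fin.
  - exact/measurable_EFinP.
  - by move=> y _; rewrite lee_fin.
  - exact/measurable_EFinP.
rewrite !iE// -ge0_integralD//; last 4 first.
- by move=> y _; rewrite lee_fin mulr_ge0.
- by apply/measurable_EFinP; exact: measurable_funM.
- by move=> y _; rewrite lee_fin mulr_ge0.
- by apply/measurable_EFinP; exact: measurable_funM.
rewrite le_eqVlt; apply/orP; left; apply/eqP; apply: eq_integral => y _.
rewrite -EFinD; congr EFin; rewrite /a2 /B /a /b -/(M y).
by case: ifP => _; field.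
Qed.

End heat_form.

(** * Dyadic sums *)

Section dyadic_counting.
Context {R : realType}.
Implicit Types z : R.

Definition log2 z : R := ln z / ln 2.

Lemma ln2_gt0 : 0 < ln 2 :> R. Proof. by rewrite ln_gt0// ltr1n. Qed.

Lemma log2_double z : 0 < z -> log2 (2 * z) = 1 + log2 z.
Proof.
by move=> z0; rewrite /log2 lnM ?posrE// mulrDl divff// gt_eqF// ln2_gt0.
Qed.

Lemma log2_ge0 z : 1 <= z -> 0 <= log2 z.
Proof. by move=> z1; apply: divr_ge0; [exact: ln_ge0|exact: ltW ln2_gt0]. Qed.

Lemma log2_le0 z : z <= 1 -> log2 z <= 0.
Proof. by move=> z1; rewrite pmulr_lle0 ?invr_gt0 ?ln2_gt0// ln_le0. Qed.

Lemma ln2_ge_half : 2^-1 <= ln 2 :> R.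
Proof.
have : - ln 2 <= - 2^-1 :> R.
  rewrite -lnV ?posrE//.
  by have := @le_ln1Dx R (- 2^-1); rewrite (_ : 1 + - 2^-1 = 2^-1); [apply; lra|lra].
by rewrite lerN2.
Qed.

(** The tangent of [ln] at 2 gives [ln z <= z / 2 - 1 + ln 2], and [1 / 2 <= ln 2 <= 1]
    concludes. *)
Lemma log2_le z : 0 < z -> log2 z <= z.
Proof.
move=> z0; rewrite ler_pdivrMr ?ln2_gt0//.
have := @le_ln1Dx R (z / 2 - 1).
rewrite (_ : 1 + (z / 2 - 1) = z / 2); last by ring.
rewrite lnM ?posrE// lnV ?posrE// => h.
have : ln z - ln 2 <= z / 2 - 1 by apply: h; lra.
have := ln2_ge_half.
have : ln 2 <= 1 :> R.
  have := @le_ln1Dx R 1; rewrite (_ : 1 + 1 = 2)//; apply; lra.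
nra.
Qed.

(** For [z <= 1], splitting off the first index doubles [z] and lowers [1 - log2 z] by one. The
    induction runs on the bound [max 0 (1 - log2 z)]; adding [z >= log2 z] gives an expression that
    dominates both arguments of the maximum. *)
Lemma count_dyadic_le k z : 0 < z ->
  \sum_(j < k) (if 2 ^+ j * z <= 1 then 1 else 0) <= 1 - log2 z + z.
Proof.
move=> z0; have := log2_le z0.
suff : \sum_(j < k) (if 2 ^+ j * z <= 1 then 1 else 0) <= Num.max 0 (1 - log2 z).
  by rewrite le_max => /orP[]; lra.
elim: k z z0 => [|k IH] z z0; first by rewrite big_ord0 le_max lexx.
rewrite big_ord_recl expr0 mul1r.
have e : \sum_(i < k) (if 2 ^+ lift ord0 i * z <= 1 then 1 else 0) =
  \sum_(i < k) (if 2 ^+ i * (2 * z) <= 1 then 1 else 0) :> R.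
  by apply: eq_bigr => i _; rewrite lift0 exprSr mulrA.
rewrite e; have z20 : 0 < 2 * z by rewrite mulr_gt0.
case: ifPn => z1.
  have := IH _ z20; rewrite log2_double// !le_max.
  have := log2_le0 z1 => h /orP[|] h2; apply/orP; right; lra.
rewrite big1 ?addr0 ?le_max ?lexx// => i _; rewrite ifF//.
apply/negbTE; rewrite -ltNge; rewrite -ltNge in z1.
have : 1 <= 2 ^+ i :> R by rewrite exprn_ege1// ler1n.
nra.
Qed.

(** A geometric series starting at the first [j] with [2^j z > 1]. For [z <= 1] the first term
    vanishes and the rest is half the sum for [2 z]; for [z > 1] the whole series is at most
    [2 <= 2 z]. *)
Lemma sum_dyadic_le k z : 0 < z ->
  \sum_(j < k) (if 2 ^+ j * z <= 1 then 0 else 2 ^- j) <= 2 * z.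
Proof.
elim: k z => [|k IH] z z0; first by rewrite big_ord0 mulr_ge0// ltW.
have geo m : \sum_(j < m) (2:R) ^- j <= 2.
  suff : \sum_(j < m) (2:R) ^- j = 2 - 2 * 2 ^- m.
    by move=> ->; rewrite lerBlDr lerDl mulr_ge0// invr_ge0 exprn_ge0.
  elim: m => [|m IHm]; first by rewrite big_ord0 expr0 invr1 mulr1 subrr.
  by rewrite big_ord_recr IHm /= exprS; field; rewrite expf_neq0.
have [z1|z1] := leP z 1; last first.
  apply: (@le_trans _ _ 2); last by rewrite ler_peMr// ltW.
  apply: le_trans (geo k.+1); apply: ler_sum => j _.
  by case: ifP => // _; rewrite invr_ge0 exprn_ge0.
rewrite big_ord_recl expr0 mul1r z1 add0r.
have -> : \sum_(i < k) (if 2 ^+ lift ord0 i * z <= 1 then 0 else 2 ^- lift ord0 i) =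
  2^-1 * \sum_(i < k) (if 2 ^+ i * (2 * z) <= 1 then 0 else 2 ^- i) :> R.
  rewrite mulr_sumr; apply: eq_bigr => i _; rewrite lift0 exprSr mulrA.
  by case: ifP => _; rewrite ?mulr0// invfM mulrC.
have z20 : 0 < 2 * z by rewrite mulr_gt0.
by have := IH _ z20; lra.
Qed.

(** About [- log2 z] terms are close to 1; the loss [2^-k / z] covers the case where [k] terms are
    too few. The induction carries the extra summand [min z 2], a reserve from which each step pays
    the defect [1 - expR (- z^4) <= z]. *)
Lemma sum_gauss_dyadic_ge k z : 0 < z ->
  - log2 z - 2 - 2 ^- k / z <= \sum_(j < k) expR (- (2 ^+ j * z) ^+ 4).
Proof.
move=> z0.
suff : - log2 z - 2 - 2 ^- k / z + Num.min z 2 <= \sum_(j < k) expR (- (2 ^+ j * z) ^+ 4).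
  by apply: le_trans; rewrite lerDl le_min (ltW z0)/=.
elim: k z z0 => [|k IH] z z0.
  rewrite big_ord0 expr0 invr1 mul1r.
  have iz0 : 0 < z^-1 by rewrite invr_gt0.
  have := log2_le iz0; rewrite /log2 lnV ?posrE// mulNr -/(log2 z).
  have : Num.min z 2 <= 2 by rewrite ge_min lexx orbT.
  lra.
have [z1|z1] := leP z 1; last first.
  apply: (@le_trans _ _ 0); last by apply: sumr_ge0 => j _; exact: expR_ge0.
  have : Num.min z 2 <= 2 by rewrite ge_min lexx orbT.
  have := log2_ge0 (ltW z1).
  have : 0 <= 2 ^- k.+1 / z by rewrite divr_ge0 ?invr_ge0 ?exprn_ge0// ltW.
  lra.
rewrite big_ord_recl expr0 mul1r.
rewrite (eq_bigr (fun i : 'I_k => expR (- (2 ^+ i * (2 * z)) ^+ 4))); last first.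
  by move=> i _; rewrite lift0 (exprSr 2) -mulrA.
have z20 : 0 < 2 * z by rewrite mulr_gt0.
have := IH _ z20; rewrite log2_double//.
have -> : 2 ^- k / (2 * z) = 2 ^- k.+1 / z by rewrite exprS !invfM; ring.
rewrite !min_l; [|lra|lra].
have : 1 - z <= expR (- z ^+ 4).
  apply: le_trans (expR_ge1Dx _); rewrite lerD2l lerN2.
  by rewrite -[leRHS]expr1; apply: ler_wiXn2l => //; exact: ltW.
lra.
Qed.

End dyadic_counting.

(** * Cosine transforms *)

Section bounded_kernel.
Context d1 d2 (T1 : measurableType d1) (T2 : measurableType d2) (R : realType).
Variables (m1 : {sigma_finite_measure set T1 -> \bar R})
  (m2 : {sigma_finite_measure set T2 -> \bar R}).
Variables (a : T1 -> R) (b : T2 -> R) (k : T1 * T2 -> R).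
Hypotheses (ia : m1.-integrable setT (EFin \o a))
  (ib : m2.-integrable setT (EFin \o b))
  (mk : measurable_fun setT k) (k1 : forall z, `|k z| <= 1).

Let ma : measurable_fun setT a.
Proof. by apply/measurable_EFinP; exact: measurable_int ia. Qed.

Let mb : measurable_fun setT b.
Proof. by apply/measurable_EFinP; exact: measurable_int ib. Qed.

Lemma integrable_section_kernel x :
  m2.-integrable setT (EFin \o (fun y => b y * k (x, y))).
Proof.
apply: (le_integrable _ _ _ ib) => //.
  by apply/measurable_EFinP/measurable_funM => //; exact: measurableT_comp.
by move=> y _; rewrite lee_fin normrM ler_piMr.
Qed.

Lemma integrable_bounded_kernel :
  (m1 \x m2)%E.-integrable setT (fun z => (a z.1 * b z.2 * k z)%:E).
Proof.
have mF : measurable_fun setT (fun z : T1 * T2 => (a z.1 * b z.2 * k z)%:E).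
  apply/measurable_EFinP; apply: measurable_funM => //.
  by apply: measurable_funM; apply: measurableT_comp.
apply/integrableP; split => //.
rewrite (fubini_tonelli1 (fun z => `|(a z.1 * b z.2 * k z)%:E|%E))//; last exact: measurableT_comp.
have [_ ba] := integrableP _ _ _ ia; have [_ bb] := integrableP _ _ _ ib.
apply: (@le_lt_trans _ _ (\int[m1]_x (`|(a x)%:E| * \int[m2]_y `|(b y)%:E|))%E).
  apply: ge0_le_integral => //.
  - by move=> x _; exact: integral_ge0.
  - apply: (@measurable_fun_fubini_tonelli_F _ _ _ _ _ m2 (fun z => `|(a z.1 * b z.2 * k z)%:E|%E)) => //.
    exact: measurableT_comp.
  - apply: emeasurable_funM => //; apply: measurableT_comp => //.
    exact/measurable_EFinP.
  move=> x _; rewrite -ge0_integralZl//; last first.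
    by apply: measurableT_comp => //; exact/measurable_EFinP.
  apply: ge0_le_integral => //.
  - apply: measurableT_comp => //; apply: measurableT_comp mF _; exact: measurable_pair1.
  - by apply: measurable_funeM; apply: measurableT_comp => //; exact/measurable_EFinP.
  by move=> y _; rewrite /= lee_fin !normrM ler_piMr// mulr_ge0.
rewrite ge0_integralZr//; last 2 first.
- by apply: measurableT_comp => //; exact/measurable_EFinP.
- exact: integral_ge0.
by rewrite lte_mul_pinfty// ?integral_ge0// ge0_fin_numE// integral_ge0.
Qed.

End bounded_kernel.

Section bounded_kernel_fubini.
Context d1 d2 (T1 : measurableType d1) (T2 : measurableType d2) (R : realType).
Variables (m1 : {sigma_finite_measure set T1 -> \bar R})
  (m2 : {sigma_finite_measure set T2 -> \bar R}).

Lemma Rfubini_bounded_kernel (a : T1 -> R) (b : T2 -> R) (k : T1 * T2 -> R) :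
  m1.-integrable setT (EFin \o a) -> m2.-integrable setT (EFin \o b) ->
  measurable_fun setT k -> (forall z, `|k z| <= 1) ->
  \int[m1]_x (a x * \int[m2]_y (b y * k (x, y))) =
  \int[m2]_y (b y * \int[m1]_x (a x * k (x, y))).
Proof.
move=> ia ib mk k1; congr fine.
have iF := integrable_bounded_kernel ia ib mk k1.
transitivity (\int[m1]_x \int[m2]_y (a x * b y * k (x, y))%:E)%E.
  apply: eq_integral => x _.
  under [RHS]eq_integral do rewrite -mulrA EFinM.
  have ii := integrable_section_kernel ib mk k1 x.
  by rewrite integralZl// EFinM fineK//; exact: integrable_fin_num.
rewrite (Fubini iF); apply: eq_integral => y _ /=.
under eq_integral do rewrite (mulrC (a _)) -mulrA EFinM.
have ii : m1.-integrable setT (EFin \o (fun x => a x * k (x, y))).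
  apply: (integrable_section_kernel (k := fun z => k (z.2, z.1)) ia _ _ y).
    apply: measurableT_comp => //; exact: measurable_swap.
  by move=> z; exact: k1.
by rewrite integralZl// EFinM fineK//; exact: integrable_fin_num.
Qed.

Lemma measurable_Rintegral_kernel (a : T1 -> R) (b : T2 -> R) (k : T1 * T2 -> R) :
  m1.-integrable setT (EFin \o a) ->
  m2.-integrable setT (EFin \o b) ->
  measurable_fun setT k -> (forall z, `|k z| <= 1) ->
  measurable_fun setT (fun x => a x * \int[m2]_y (b y * k (x, y))).
Proof.
move=> ia ib mk k1; apply/measurable_EFinP.
have iF := integrable_bounded_kernel ia ib mk k1.
have := measurable_fubini_F iF.
apply: eq_measurable_fun => x _ /=; rewrite /fubini_F.
under eq_integral do rewrite -mulrA EFinM.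
have ii := integrable_section_kernel ib mk k1 x.
by rewrite /= integralZl// EFinM fineK//; exact: integrable_fin_num.
Qed.

End bounded_kernel_fubini.

Section cosine_transform.
Context {R : realType} (n : nat).
Notation V := 'rV[R]_n.
Notation mu := (@lebesgueRn R n).
Implicit Types (x y z xi : V) (r : R) (p : V -> R).

Lemma measurable_dotrV_pair : measurable_fun setT (fun z : V * V => dotrV z.1 z.2).
Proof.
apply: measurable_sum => i; apply: measurable_funM.
  by apply: (measurableT_comp (measurable_coord i)); exact: measurable_fst.
by apply: (measurableT_comp (measurable_coord i)); exact: measurable_snd.
Qed.

Lemma measurable_cos_pair : measurable_fun setT (fun z : V * V => cos (dotrV z.1 z.2)).
Proof.
apply: (measurableT_comp (continuous_measurable_fun (@continuous_cos R))).
exact: measurable_dotrV_pair.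
Qed.

Lemma cos_pair_le1 (z : V * V) : `|cos (dotrV z.1 z.2)| <= 1.
Proof. exact: cos_max. Qed.

Lemma integral_reflect (h : V -> R) : mu.-integrable setT (EFin \o h) ->
  mu.-integrable setT (EFin \o (fun x => h (- x))) /\
  \int[mu]_x h (- x) = \int[mu]_x h x.
Proof.
move=> ih.
have mN : measurable_fun setT (fun x : V => - x).
  have := @measurable_affineRn R n (-1) 0.
  by under eq_fun do rewrite scaleN1r addr0.
have H (g : V -> \bar R) : measurable_fun setT g -> (forall x, 0 <= g x)%E ->
    (1%:E * \int[mu]_x g (- x)%R = \int[mu]_x g x)%E.
  move=> mg g0; have n1 : -1 != 0 :> R by rewrite oppr_eq0 oner_eq0.
  have := @integral_affineRn R n (-1) 0 g n1 mg g0.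
  rewrite normrN1 expr1n => <-; congr (_ * _)%E; apply: eq_integral => x _.
  by rewrite scaleN1r addr0.
have [i e] := integral_change_of_variables ltr01 mN H ih.
by split => //; congr fine; rewrite -[RHS]e mul1e.
Qed.

Section even_function.
Variable p : V -> R.
Hypotheses (ip : mu.-integrable setT (EFin \o p)) (pN : forall x, p (- x) = p x).

Definition cosine_transform xi : R := \int[mu]_x (p x * cos (dotrV xi x)).

Lemma integrable_mul_bounded (q h : V -> R) : mu.-integrable setT (EFin \o q) ->
  measurable_fun setT h -> (forall x, `|h x| <= 1) ->
  mu.-integrable setT (EFin \o (fun x => q x * h x)).
Proof.
move=> iq mh h1; apply: (le_integrable _ _ _ iq) => //.
  apply/measurable_EFinP/measurable_funM => //.
  by apply/measurable_EFinP; exact: measurable_int iq.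
by move=> x _; rewrite lee_fin normrM ler_piMr.
Qed.

Lemma measurable_cos_dotrV xi : measurable_fun setT (fun x => cos (dotrV xi x)).
Proof.
apply: (measurableT_comp (continuous_measurable_fun (@continuous_cos R))).
exact: measurable_dotrV.
Qed.

Lemma measurable_sin_dotrV xi : measurable_fun setT (fun x => sin (dotrV xi x)).
Proof.
apply: (measurableT_comp (continuous_measurable_fun (@continuous_sin R))).
exact: measurable_dotrV.
Qed.

Lemma sine_integral0 xi : \int[mu]_x (p x * sin (dotrV xi x)) = 0.
Proof.
have i1 := integrable_mul_bounded ip (measurable_sin_dotrV xi) (fun x => normr_sin_le1 _).
have [_] := integral_reflect i1.
rewrite (@eq_Rintegral _ _ _ mu setT (fun x => -1 * (p x * sin (dotrV xi x)))); last first.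
  by move=> x _; rewrite pN dotrVC dotrVNl dotrVC sinN mulrN mulN1r.
by rewrite (RintegralZl _ measurableT i1); lra.
Qed.

Lemma integrable_gauss r : 0 < r ->
  mu.-integrable setT (EFin \o (fun xi => expR (- (r * enorm xi) ^+ 2))).
Proof.
move=> r0; have h1 (x : V) : `|(fun=> 1 : R) x| <= 1 by rewrite normr1.
have := integrable_gauss_bounded r0 (measurable_cst (1 : R)) h1.
by apply: eq_integrable => // x _; rewrite /= mulr1.
Qed.

Lemma cosine_transform_le xi : `|cosine_transform xi| <= \int[mu]_x `|p x|.
Proof.
have i1 := integrable_mul_bounded ip (measurable_cos_dotrV xi) (fun x => cos_max _).
apply: (le_trans (le_normr_Rintegral measurableT i1)).
apply: le_Rintegral => //.
- exact: integrable_norm i1.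
- exact: integrable_norm ip.
- by move=> x _; rewrite normrM ler_piMr ?cos_max.
Qed.

(** The Fubini argument needs an integrable factor in [xi], so a Gaussian is inserted and divided
    out afterwards. *)
Lemma measurable_cosine_transform : measurable_fun setT cosine_transform.
Proof.
have m1 := measurable_Rintegral_kernel (integrable_gauss ltr01) ip measurable_cos_pair
  cos_pair_le1.
have m2 : measurable_fun setT (fun xi : V => expR ((1 * enorm xi) ^+ 2)).
  apply: measurableT_comp => //; apply: measurable_funX.
  by apply: measurable_funM => //; exact: measurable_enorm.
have := measurable_funM m2 m1; apply: eq_measurable_fun => xi _ /=.
by rewrite mulrA -expRD addrN expR0 mul1r.
Qed.

Lemma integral_gauss_cos_heat r z : 0 < r ->
  \int[mu]_xi (expR (- (r * enorm xi) ^+ 2) * cos (dotrV z xi)) =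
  (2 * pi) ^+ n * heat r z.
Proof.
move=> r0; have := @integral_gauss_cosRn R n r z 0 r0.
under eq_integral do rewrite addr0.
rewrite /Rintegral => -> /=; rewrite cos0 mulr1 heatE mulrA; congr (_ * _).
rewrite -exprVn -exprMn; congr (_ ^+ _).
rewrite -{2}[pi](sqr_sqrtr (ltW (pi_gt0 R))); field.
by rewrite !gt_eqF// sqrtpi_gt0.
Qed.

(** Divided by its value at the origin, the heat kernel becomes a kernel bounded by 1, as the Fubini
    lemmas require. *)
Lemma heat_le r z : 0 < r -> heat r z <= heat r (0 : V).
Proof.
move=> r0; rewrite !heatE (eqP (_ : enorm 0 == 0)) ?enorm_eq0// mul0r expr0n oppr0.
rewrite ler_wpM2l ?ler_expR ?oppr_le0 ?sqr_ge0//.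
by rewrite invr_ge0 exprn_ge0// !mulr_ge0 ?sqrtr_ge0// ltW.
Qed.

Lemma heat0_gt0 r : 0 < r -> 0 < heat r (0 : V).
Proof.
move=> r0; rewrite heatE mulr_gt0 ?expR_gt0// invr_gt0 exprn_gt0// !mulr_gt0//.
exact: sqrtpi_gt0.
Qed.

Lemma integrable_mul_heat r x : 0 < r ->
  mu.-integrable setT (EFin \o (fun y => p y * heat r (y - x))).
Proof.
move=> r0; have H0 := heat0_gt0 r0.
have mh : measurable_fun setT (fun y => heat r (y - x) / heat r (0 : V)).
  by apply: measurable_funM => //; exact: measurable_heat_sub.
have h1 y : `|heat r (y - x) / heat r (0 : V)| <= 1.
  rewrite ger0_norm ?divr_ge0 ?heat_ge0// ler_pdivrMr// mul1r.
  exact: heat_le.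
have := integrableZ_EFin (heat r (0 : V)) (integrable_mul_bounded ip mh h1).
by apply: eq_integrable => // y _ /=; congr EFin; field; rewrite gt_eqF.
Qed.

Definition heat_mean r x : R := \int[mu]_y (p y * heat r (y - x)).

Lemma measurable_heat_mean r : 0 < r -> measurable_fun setT (heat_mean r).
Proof.
move=> r0; have H0 := heat0_gt0 r0.
pose k (z : V * V) := heat r (z.2 - z.1) / heat r (0 : V).
have mk : measurable_fun setT k.
  apply: measurable_funM => //.
  apply: (measurableT_comp (measurable_heat r)); apply: measurable_fun_rV => i.
  under eq_fun do rewrite !mxE.
  apply: measurable_funB; apply: (measurableT_comp (measurable_coord i)).
    exact: measurable_snd.
  exact: measurable_fst.
have k1 (z : V * V) : `|k z| <= 1.
  rewrite ger0_norm ?divr_ge0 ?heat_ge0 ?(ltW H0)// ler_pdivrMr// mul1r.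
  exact: heat_le.
have m1 := measurable_Rintegral_kernel (integrable_gauss ltr01) ip mk k1.
have m2 : measurable_fun setT (fun xi : V => heat r (0 : V) * expR ((1 * enorm xi) ^+ 2)).
  apply: measurable_funM => //; apply: measurableT_comp => //; apply: measurable_funX.
  by apply: measurable_funM => //; exact: measurable_enorm.
have := measurable_funM m2 m1; apply: eq_measurable_fun => x _ /=.
rewrite mulrA -(mulrA (heat r _)) -expRD addrN expR0 mulr1 /heat_mean.
rewrite -RintegralZl//; first by apply: eq_Rintegral => y _; rewrite /k/=; field; rewrite gt_eqF.
apply: (integrable_mul_bounded ip) => //.
by apply: measurableT_comp => //; exact: measurable_pair1.
Qed.

(** The two cosine transforms are opened in turn, the Gaussian making each exchange absolutely
    convergent. Its own transform yields the heat kernel at [y - x] and at [y + x], and these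
    contribute equally because [p] is even. *)
Lemma gauss_cosine_transform r : 0 < r ->
  \int[mu]_xi (expR (- (r * enorm xi) ^+ 2) * cosine_transform xi ^+ 2) =
  (2 * pi) ^+ n * \int[mu]_x (p x * heat_mean r x).
Proof.
move=> r0; set g := fun xi : V => expR (- (r * enorm xi) ^+ 2).
have ig : mu.-integrable setT (EFin \o g) by exact: integrable_gauss.
set P := \int[mu]_x `|p x|.
have P0 : 0 <= P by exact: Rintegral_ge0.
have ib : mu.-integrable setT (EFin \o (fun xi => g xi * cosine_transform xi)).
  (* The divisor is [P + 1] because [P] may vanish. *)
  have mh : measurable_fun setT (fun xi => cosine_transform xi / (P + 1)).
    by apply: measurable_funM => //; exact: measurable_cosine_transform.
  have h1 xi : `|cosine_transform xi / (P + 1)| <= 1.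
    rewrite normrM normfV (ger0_norm (addr_ge0 P0 ler01)).
    rewrite ler_pdivrMr ?ltr_pwDr// mul1r.
    by apply: (le_trans (cosine_transform_le xi)); rewrite -/P lerDl.
  have := integrableZ_EFin (P + 1) (integrable_mul_bounded ig mh h1).
  apply: eq_integrable => // xi _ /=; congr EFin; field.
  by rewrite gt_eqF// ltr_pwDr.
transitivity (\int[mu]_xi (g xi * cosine_transform xi *
   \int[mu]_x (p x * cos (dotrV xi x)))).
  by apply: eq_Rintegral => xi _; rewrite -mulrA.
rewrite (Rfubini_bounded_kernel ib ip measurable_cos_pair cos_pair_le1) /=.
have swapE x : \int[mu]_xi (g xi * cosine_transform xi * cos (dotrV xi x)) =
    (2 * pi) ^+ n * heat_mean r x.
  transitivity (\int[mu]_xi (g xi *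
      \int[mu]_y (p y * (cos (dotrV xi y) * cos (dotrV xi x))))).
    apply: eq_Rintegral => xi _; rewrite -mulrA; congr (_ * _).
    rewrite /cosine_transform -RintegralZr//.
      by apply: eq_Rintegral => y _; rewrite mulrA.
    exact: (integrable_mul_bounded ip (measurable_cos_dotrV xi) (fun y => cos_max _)).
  pose k (z : V * V) := cos (dotrV z.1 z.2) * cos (dotrV z.1 x).
  have mk : measurable_fun setT k.
    apply: measurable_funM; first exact: measurable_cos_pair.
    apply: (measurableT_comp (continuous_measurable_fun (@continuous_cos R))).
    under eq_fun do rewrite dotrVC.
    by apply: (measurableT_comp (measurable_dotrV x)); exact: measurable_fst.
  have k1 (z : V * V) : `|k z| <= 1.
    by rewrite normrM -[leRHS]mulr1 ler_pM ?normr_ge0 ?cos_max.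
  rewrite (Rfubini_bounded_kernel ig ip mk k1) /k /=.
  pose G z := (2 * pi) ^+ n * heat r z.
  have inner y : \int[mu]_xi (g xi * (cos (dotrV xi y) * cos (dotrV xi x))) =
      2^-1 * G (y - x) + 2^-1 * G (y + x).
    have ic z : mu.-integrable setT (EFin \o (fun xi => g xi * cos (dotrV z xi))).
      exact: (integrable_mul_bounded ig (measurable_cos_dotrV z) (fun y => cos_max _)).
    rewrite /G -!integral_gauss_cos_heat// -!RintegralZl//.
    rewrite -RintegralD//; [|exact: integrableZ_EFin|exact: integrableZ_EFin].
    apply: eq_Rintegral => xi _; rewrite !dotrVDl dotrVNl !(dotrVC xi) !cosD cosN sinN.
    by rewrite -/(g xi); field.
  under eq_Rintegral do rewrite inner mulrDr.
  have i1 z : mu.-integrable setT (EFin \o (fun y => p y * (2^-1 * G (y - z)))).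
    have := integrableZ_EFin (2^-1 * (2 * pi) ^+ n) (integrable_mul_heat z r0).
    by congr (_.-integrable _ _); apply/funext => y; rewrite /= /G; congr EFin; ring.
  have [i2 e2] := integral_reflect (i1 x).
  have e3 y : p (- y) * (2^-1 * G (- y - x)) = p y * (2^-1 * G (y + x)).
    by rewrite pN -opprD /G heatN.
  have i3 : mu.-integrable setT (EFin \o (fun y => p y * (2^-1 * G (y + x)))).
    apply: eq_integrable i2; first exact: measurableT.
    by move=> y _; exact: (congr1 EFin (e3 y)).
  rewrite (RintegralD measurableT (i1 x) i3).
  have -> : \int[mu]_y (p y * (2^-1 * G (y + x))) = \int[mu]_y (p y * (2^-1 * G (y - x))).
    by rewrite -e2; apply: eq_Rintegral => y _; exact/esym/e3.
  have -> : \int[mu]_y (p y * (2^-1 * G (y - x))) = 2^-1 * (2 * pi) ^+ n * heat_mean r x.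
    rewrite /heat_mean -(RintegralZl _ measurableT (integrable_mul_heat x r0)).
    by apply: eq_Rintegral => y _; rewrite /G; ring.
  by field.
under eq_Rintegral do rewrite swapE mulrCA.
rewrite RintegralZl//.
have H0 := heat0_gt0 r0.
have D0 : 0 < heat r (0 : V) * (P + 1) by rewrite mulr_gt0// ltr_pwDr.
have mh : measurable_fun setT (fun x => heat_mean r x / (heat r (0 : V) * (P + 1))).
  by apply: measurable_funM => //; exact: measurable_heat_mean.
have h1 x : `|heat_mean r x / (heat r (0 : V) * (P + 1))| <= 1.
  rewrite normrM normfV (gtr0_norm D0) ler_pdivrMr// mul1r.
  apply: (le_trans (le_normr_Rintegral measurableT (integrable_mul_heat x r0))).
  apply: (@le_trans _ _ (heat r (0 : V) * P)); last by rewrite ler_wpM2l ?(ltW H0)// lerDl.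
  rewrite /P -RintegralZl//; last exact: integrable_norm ip.
  apply: le_Rintegral => //.
  - exact: integrable_norm (integrable_mul_heat x r0).
  - exact: integrableZ_EFin (integrable_norm ip).
  by move=> y _; rewrite normrM mulrC ler_wpM2r// ger0_norm ?heat_ge0// heat_le.
have := integrableZ_EFin (heat r (0 : V) * (P + 1)) (integrable_mul_bounded ip mh h1).
apply: eq_integrable => // x _ /=; congr EFin; field.
by rewrite !gt_eqF// ltr_pwDr.
Qed.

End even_function.
End cosine_transform.

Lemma Rdominated_cvg d (T : measurableType d) (R : realType)
    (mu : {measure set T -> \bar R}) (f_ : nat -> T -> R) (f g : T -> R) :
  (forall k, measurable_fun setT (f_ k)) ->
  (forall x, f_ k x @[k --> \oo] --> f x) ->
  mu.-integrable setT (EFin \o g) -> (forall k x, `|f_ k x| <= g x) ->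
  \int[mu]_x f_ k x @[k --> \oo] --> \int[mu]_x f x.
Proof.
move=> mf cf ig fg.
have mf_ k : measurable_fun setT (EFin \o f_ k) by exact/measurable_EFinP.
have mfl : measurable_fun setT (EFin \o f).
  by apply/measurable_EFinP; apply: (measurable_fun_cvg mf) => x _; exact: cf.
have c1 : {ae mu, forall x, setT x -> (EFin \o f_ k) x @[k --> \oo] --> (EFin \o f) x}.
  by apply: aeW => x _; apply/fine_cvgP; split; [exact: nearW|exact: cf].
have c2 : {ae mu, forall x k, setT x -> (`|(EFin \o f_ k) x| <= (EFin \o g) x)%E}.
  by apply: aeW => x k _; rewrite lee_fin.
have [i1 _ h] := dominated_convergence measurableT mf_ mfl c1 ig c2.
apply: fine_cvg; rewrite fineK; first exact: h.
exact: integrable_fin_num.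
Qed.

(** * The heat kernel as an approximate identity *)

Section approximate_identity.
Context {R : realType} (n : nat).
Notation V := 'rV[R]_n.
Notation mu := (@lebesgueRn R n).
Variable p : V -> R.
Hypotheses (ip : mu.-integrable setT (EFin \o p)).
Variable B : R.
Hypotheses (pB : forall x, `|p x| <= B)
  (pc : forall x z : V, p (k.+1%:R^-1 *: z + x) @[k --> \oo] --> p x).

Let mp : measurable_fun setT p.
Proof. by apply/measurable_EFinP; exact: measurable_int ip. Qed.

Lemma integrable_heat r : 0 < r -> mu.-integrable setT (EFin \o @heat R n r).
Proof.
move=> r0; apply/integrableP; split.
  by apply/measurable_EFinP; exact: measurable_heat.
rewrite (eq_integral (fun x : V => (heat r (x - 0))%:E)) ?integral_heat ?ltry// => x _.
by rewrite /= ger0_norm ?heat_ge0// subr0.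
Qed.

(** Rescaling moves the small parameter into [p] and leaves a fixed kernel, so that [heat_mean_cvg]
    is dominated convergence with bound [B * heat 1 z]. *)
Lemma heat_mean_dilate r x : 0 < r ->
  heat_mean p r x = \int[mu]_z (p (r *: z + x) * heat 1 z).
Proof.
move=> r0.
have H (g : V -> \bar R) : measurable_fun setT g -> (forall x, 0 <= g x)%E ->
    ((r ^+ n)%:E * \int[mu]_z g (r *: z + x)%R = \int[mu]_z g z)%E.
  by move=> mg g0; rewrite -(@integral_affineRn R n r x g (lt0r_neq0 r0) mg g0) gtr0_norm.
have rn0 : 0 < r ^+ n by rewrite exprn_gt0.
have [i e] := integral_change_of_variables rn0 (measurable_affineRn r x) H
  (integrable_mul_heat ip x r0).
rewrite /heat_mean /Rintegral -[in LHS]e -integralZl//; congr fine.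
apply: eq_integral => z _; rewrite -EFinM; congr EFin; rewrite addrK.
rewrite mulrCA; congr (_ * _); rewrite !heatE enormZ gtr0_norm//.
rewrite mulrA; congr (_ * expR (- _ ^+ 2)).
  by rewrite -!exprVn -exprMn; congr (_ ^+ _); field; rewrite !gt_eqF// sqrtpi_gt0.
by field; rewrite gt_eqF.
Qed.

Lemma heat_mean_cvg x : heat_mean p k.+1%:R^-1 x @[k --> \oo] --> p x.
Proof.
have k0 k : 0 < k.+1%:R^-1 :> R by rewrite invr_gt0 ltr0Sn.
under eq_fun do rewrite heat_mean_dilate//.
have -> : p x = \int[mu]_z (p x * heat 1 z).
  rewrite RintegralZl//; last exact: integrable_heat.
  rewrite /Rintegral (eq_integral (fun z : V => (heat 1 (z - 0))%:E)).
    by rewrite integral_heat// mulr1.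
  by move=> z _; rewrite subr0.
apply: (@Rdominated_cvg _ _ _ mu _ _ (fun z => B * heat 1 z)).
- move=> k; apply: measurable_funM; last exact: measurable_heat.
  by apply: (measurableT_comp mp); exact: measurable_affineRn.
- by move=> z; apply: cvgMl; exact: pc.
- by apply: integrableZ_EFin; exact: integrable_heat.
- by move=> k z; rewrite normrM ler_pM// ger0_norm// heat_ge0.
Qed.

Lemma heat_mean_le r x : 0 < r -> `|heat_mean p r x| <= B.
Proof.
move=> r0; rewrite /heat_mean.
apply: (le_trans (le_normr_Rintegral measurableT (integrable_mul_heat ip x r0))).
have ih : mu.-integrable setT (EFin \o (fun y => heat r (y - x))).
  apply/integrableP; split; first by apply/measurable_EFinP; exact: measurable_heat_sub.
  under eq_integral do rewrite /= ger0_norm ?heat_ge0//.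
  by rewrite integral_heat// ltry.
apply: (@le_trans _ _ (\int[mu]_y (B * heat r (y - x)))).
  apply: le_Rintegral => //.
  - exact: integrable_norm (integrable_mul_heat ip x r0).
  - exact: integrableZ_EFin.
  by move=> y _; rewrite normrM ler_pM// ger0_norm// heat_ge0.
by rewrite RintegralZl// /Rintegral integral_heat// mulr1.
Qed.

Lemma integral_heat_mean_cvg :
  \int[mu]_x (p x * heat_mean p k.+1%:R^-1 x) @[k --> \oo] --> \int[mu]_x (p x ^+ 2).
Proof.
have k0 k : 0 < k.+1%:R^-1 :> R by rewrite invr_gt0 ltr0Sn.
apply: (@Rdominated_cvg _ _ _ mu _ _ (fun x => B * `|p x|)).
- by move=> k; apply: measurable_funM => //; exact: measurable_heat_mean.
- by move=> x; rewrite expr2; apply: cvgMr; exact: heat_mean_cvg.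
- by apply: integrableZ_EFin; exact: integrable_norm ip.
- by move=> k x; rewrite normrM mulrC ler_wpM2r// heat_mean_le.
Qed.

End approximate_identity.

(** * Integrability of radial functions *)

Section moments.
Context {R : realType} (n : nat).
Notation V := 'rV[R]_n.+1.
Notation mu := (@lebesgueRn R n.+1).
Notation leb := (@lebesgue_measure R).

Lemma integral_oneDsqr_lty :
  (\int[leb]_s (if 0 < s then (1 + s ^+ 2)^-1 else 0)%:E < +oo)%E.
Proof.
apply: (@le_lt_trans _ _ (\int[leb]_(s in `[0%R, +oo[) (oneDsqr s)^-1%:E)%E); last first.
  by rewrite integral0y_oneDsqr ltry.
rewrite [leRHS]integral_mkcond; apply: ge0_le_integral => //.
- by move=> s _; case: ifP => // _; rewrite lee_fin invr_ge0 addr_ge0// sqr_ge0.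
- apply/measurable_EFinP; apply: measurable_fun_ifT => //; first exact: measurable_fun_ltr.
  apply: measurable_funV_ge0; last by move=> s; rewrite addr_ge0// sqr_ge0.
  by apply: measurable_funD => //; exact: exprn_measurable.
- apply/(measurable_restrict _ _ _) => //.
  apply/measurable_EFinP; apply: measurable_funTS.
  apply: continuous_measurable_fun; exact: continuous_oneDsqrV.
- move=> s _; rewrite patchE mem_setE in_itv/= andbT.
  case: ifPn => [s0|_]; first by rewrite (ltW s0).
  by case: ifP => // _; rewrite lee_fin invr_ge0 addr_ge0// sqr_ge0.
Qed.

(* [s^(-1/2)] is the length of the [t > 0] with [t^2 s < 1]; exchange the integrals. *)
Lemma integral_rsqrt_lty :
  (\int[leb]_s (if (0 < s) && (s < 1) then (Num.sqrt s)^-1 else 0)%:E < +oo)%E.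
Proof.
pose K (p : measurableTypeR R * measurableTypeR R) : R :=
  if ((0 < (p.1 : R)) && ((p.1 : R) < 1)) && ((0 < (p.2 : R)) && ((p.2 : R) ^+ 2 * p.1 < 1))
  then 1 else 0.
have K0 p : 0 <= K p by rewrite /K; case: ifP.
have mK : measurable_fun setT K.
  apply: measurable_fun_ifT => //; apply: measurable_and; apply: measurable_and;
    apply: measurable_fun_ltr => //.
  by apply: measurable_funM => //; apply: measurable_funX.
apply: (@le_lt_trans _ _ (\int[leb]_s \int[leb]_t (K (s, t))%:E)%E).
  rewrite le_eqVlt; apply/orP; left; apply/eqP; apply: eq_integral => s _.
  case: ifPn => s01; last first.
    by rewrite [RHS]integral0_eq// => t _; rewrite /K /= (negbTE s01).
  have /andP[s0 s1] := s01.
  have q0 : 0 < Num.sqrt s by rewrite sqrtr_gt0.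
  rewrite (_ : (fun t => (K (s, t))%:E) = (cst 1%E) \_ `]0, (Num.sqrt s)^-1[); last first.
    apply/funext => t; rewrite /K /= patchE mem_setE in_itv/= s01 /=.
    have [t0|t0] := ltP 0 t => //=.
    rewrite (_ : (t ^+ 2 * s < 1) = (t < (Num.sqrt s)^-1)); first by case: ifP.
    rewrite -[s in LHS](sqr_sqrtr (ltW s0)) -exprMn expr_lt1//.
      by rewrite -ltr_pdivlMr// mul1r.
    by rewrite mulr_ge0 ?ltW.
  rewrite -integral_mkcond integral_cst//= lebesgue_measure_itv/= lte_fin invr_gt0 q0.
  by rewrite sube0 mul1e.
rewrite (fubini_tonelli (EFin \o K)) => //; last exact/measurable_EFinP.
have h : (2%:E * \int[leb]_s (if 0 < s then (1 + s ^+ 2)^-1 else 0)%:E < +oo)%E.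
  by rewrite lte_mul_pinfty// integral_oneDsqr_lty.
apply: le_lt_trans h.
rewrite -ge0_integralZl_EFin//; last 2 first.
- by move=> s _; case: ifP => // _; rewrite lee_fin invr_ge0 addr_ge0// sqr_ge0.
- apply/measurable_EFinP; apply: measurable_fun_ifT => //; first exact: measurable_fun_ltr.
  apply: measurable_funV_ge0; last by move=> s; rewrite addr_ge0// sqr_ge0.
  by apply: measurable_funD => //; exact: exprn_measurable.
apply: ge0_le_integral => //.
- by move=> t _; apply: integral_ge0 => s _; rewrite lee_fin.
- apply: (@measurable_fun_fubini_tonelli_G _ _ _ _ _ leb (EFin \o K)) => //.
  exact/measurable_EFinP.
- apply/measurable_EFinP; apply: measurable_funM => //.
  apply: measurable_fun_ifT => //; first exact: measurable_fun_ltr.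
  apply: measurable_funV_ge0; last by move=> s; rewrite addr_ge0// sqr_ge0.
  by apply: measurable_funD => //; exact: exprn_measurable.
move=> t _; have [t0|t0] := ltP 0 t; last first.
  rewrite mule0 integral0_eq// => s _.
  by rewrite /K /= (ltNge 0 t) t0 /= andbF.
have D0 : 0 < 1 + t ^+ 2 by rewrite ltr_pwDl// sqr_ge0.
(* Adding [s < 1] and [t^2 s < 1] gives [s (1 + t^2) < 2]: one interval contains the slice for small
   and for large [t]. *)
apply: (@le_trans _ _ (\int[leb]_(s in `[0%R, (2 / (1 + t ^+ 2))%R]) (cst 1%E s))%E).
  rewrite [leRHS]integral_mkcond; apply: ge0_le_integral => //.
  - by move=> s _; rewrite lee_fin.
  - apply/measurable_EFinP; apply: measurableT_comp => //; exact: measurable_pair2.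
  - by apply/(measurable_restrict _ _ _).
  move=> s _; rewrite patchE mem_setE in_itv/= /K /= t0 /=.
  case: ifPn => [/andP[/andP[s0 s1] ts]|_]; last by case: ifP.
  by rewrite ifT// (ltW s0)/= ler_pdivlMr//; lra.
rewrite integral_cst//= lebesgue_measure_itv/= lte_fin divr_gt0//.
by rewrite sube0 mul1e.
Qed.

Lemma integral_unit_rsqrt_lty :
  (\int[mu]_x (if enorm x < 1 then (Num.sqrt (enorm x))^-1 else 0)%:E < +oo)%E.
Proof.
have [S S0 SE] := @sphere_mass_fin R n.
have mv : measurable_fun setT (fun s : R => if s < 1 then (Num.sqrt s)^-1 else 0).
  apply: measurable_fun_ifT => //; first exact: measurable_fun_ltr.
  by apply: measurable_funV_ge0 => //; exact: measurable_sqrt.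
rewrite (@integral_radial R n (fun s => if s < 1 then (Num.sqrt s)^-1 else 0))//; last first.
  by move=> s; case: ifP => // _; rewrite invr_ge0 sqrtr_ge0.
rewrite SE muleC lte_mul_pinfty ?lee_fin ?(ltW S0)//.
apply: le_lt_trans integral_rsqrt_lty; apply: ge0_le_integral => //.
- move=> s _; rewrite lee_fin mulr_ge0 ?rpow_ge0//.
  by case: ifP => // _; rewrite invr_ge0 sqrtr_ge0.
- by apply/measurable_EFinP; apply: measurable_funM => //; exact: measurable_rpow.
- apply/measurable_EFinP; apply: measurable_fun_ifT => //.
    by apply: measurable_and; exact: measurable_fun_ltr.
  by apply: measurable_funV_ge0 => //; exact: measurable_sqrt.
move=> s _; rewrite lee_fin /rpow; case: ltP => s0 /=; last by rewrite mul0r.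
case: ltP => s1; last by rewrite mulr0.
by rewrite ler_piMl ?invr_ge0 ?sqrtr_ge0// exprn_ile1// ltW.
Qed.

(** In the unit ball [h] is bounded and [|x|^(-1/2)] is integrable; outside, [|x|^(-1/2) <= 1]. This
    controls [ln |x|] at the origin and the low-frequency error term in [F]. *)
Lemma integral_mul_rsqrt_lty (h : V -> R) (B : R) : measurable_fun setT h ->
  (forall x, 0 <= h x <= B) -> (\int[mu]_x (h x)%:E < +oo)%E ->
  (\int[mu]_x (h x * (Num.sqrt (enorm x))^-1)%:E < +oo)%E.
Proof.
move=> mh hB ih.
have h0 x : 0 <= h x by have /andP[] := hB x.
have B0 : 0 <= B by have /andP[/le_trans] := hB 0; apply.
have me := @measurable_enorm R n.+1.
have mr : measurable_fun setT (fun x : V => (Num.sqrt (enorm x))^-1).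
  by apply: measurable_funV_ge0 => //; exact: measurable_sqrt.
pose g (x : V) := if enorm x < 1 then (Num.sqrt (enorm x))^-1 else 0.
have g0 x : 0 <= g x by rewrite /g; case: ifP => // _; rewrite invr_ge0 sqrtr_ge0.
have mg : measurable_fun setT g.
  by apply: measurable_fun_ifT => //; exact: measurable_fun_ltr.
apply: (@le_lt_trans _ _ (\int[mu]_x ((h x)%:E + B%:E * (g x)%:E))%E).
  apply: ge0_le_integral => //.
  - by move=> x _; rewrite lee_fin mulr_ge0// invr_ge0 sqrtr_ge0.
  - by apply/measurable_EFinP; exact: measurable_funM.
  - apply: emeasurable_funD; first exact/measurable_EFinP.
    by apply: measurable_funeM; exact/measurable_EFinP.
  move=> x _; rewrite -EFinM -EFinD lee_fin /g; case: ltP => x1.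
    rewrite ler_wpDl// ler_wpM2r ?invr_ge0 ?sqrtr_ge0//.
    by have /andP[] := hB x.
  rewrite mulr0 addr0 ler_piMr// invf_le1.
    by rewrite -sqrtr1 ler_wsqrtr.
  by rewrite sqrtr_gt0; lra.
rewrite ge0_integralD//; last 4 first.
- by move=> x _; rewrite lee_fin.
- exact/measurable_EFinP.
- by move=> x _; rewrite mule_ge0 ?lee_fin.
- by apply: measurable_funeM; exact/measurable_EFinP.
rewrite lte_add_pinfty// ge0_integralZl_EFin//; last 2 first.
- by move=> x _; rewrite lee_fin.
- exact/measurable_EFinP.
by rewrite lte_mul_pinfty// integral_unit_rsqrt_lty.
Qed.

Section radial_moments.
Variable v : R -> R.
Hypotheses (mv : measurable_fun setT v) (v0 : forall s, 0 <= v s)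
  (vm : forall k, exists C, forall s, 0 <= s -> s ^+ k * v s <= C).

(** Decay of orders [n + k] and [n + k + 2] together bounds the radial integrand by a multiple of
    [1 / (1 + s^2)]. *)
Lemma integral_moment_lty k :
  (\int[mu]_x (v (enorm x) * enorm x ^+ k)%:E < +oo)%E.
Proof.
have [S S0 SE] := @sphere_mass_fin R n.
pose vk s := v s * `|s| ^+ k.
have mvk : measurable_fun setT vk.
  by apply: measurable_funM => //; apply: measurable_funX; exact: normr_measurable.
have vk0 s : 0 <= vk s by rewrite mulr_ge0 ?exprn_ge0.
have -> : (\int[mu]_x (v (enorm x) * enorm x ^+ k)%:E = \int[mu]_x (vk (enorm x))%:E)%E.
  by apply: eq_integral => x _; rewrite /vk ger0_norm ?enorm_ge0.
rewrite integral_radial// SE muleC lte_mul_pinfty ?lee_fin ?(ltW S0)//.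
have [C1 h1] := vm (n + k); have [C2 h2] := vm (n + k + 2).
have mD : measurable_fun setT (fun s : R => (if 0 < s then (1 + s ^+ 2)^-1 else 0)%:E).
  apply/measurable_EFinP; apply: measurable_fun_ifT => //; first exact: measurable_fun_ltr.
  apply: measurable_funV_ge0; last by move=> s; rewrite addr_ge0// sqr_ge0.
  by apply: measurable_funD => //; exact: exprn_measurable.
have D0 (s : R) : (0 <= (if 0 < s then (1 + s ^+ 2)^-1 else 0)%:E)%E.
  by case: ifP => // _; rewrite lee_fin invr_ge0 addr_ge0// sqr_ge0.
have C0 : 0 <= C1 + C2.
  have := h1 1 ler01; have := h2 1 ler01; rewrite !expr1n !mul1r.
  by have := v0 1; lra.
apply: (@le_lt_trans _ _ ((C1 + C2)%:E *
    \int[leb]_s (if 0 < s then (1 + s ^+ 2)^-1 else 0)%:E)%E); last first.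
  by rewrite lte_mul_pinfty// integral_oneDsqr_lty.
rewrite -ge0_integralZl_EFin//; apply: ge0_le_integral => //.
- by move=> s _; rewrite lee_fin mulr_ge0 ?rpow_ge0.
- by apply/measurable_EFinP; apply: measurable_funM => //; exact: measurable_rpow.
- exact: measurable_funeM.
move=> s _; rewrite -EFinM lee_fin /rpow; case: ltP => s0; last by rewrite mul0r mulr0.
rewrite ler_pdivlMr ?ltr_pwDl ?sqr_ge0//.
have := h1 s (ltW s0); have := h2 s (ltW s0).
rewrite !exprD /vk gtr0_norm//; lra.
Qed.

End radial_moments.
End moments.

(** Positive parts increase and negative parts decrease. This allows a comparison with
    [F * ln |xi|], about whose decay at infinity [entropy_frequency_le] assumes nothing. *)
Lemma le_integral_measurable d (T : measurableType d) (R : realType)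
    (mu : {measure set T -> \bar R}) (f g : T -> \bar R) :
  measurable_fun setT f -> measurable_fun setT g -> (forall x, f x <= g x)%E ->
  (\int[mu]_x f x <= \int[mu]_x g x)%E.
Proof.
move=> mf mg fg; rewrite integralE [leRHS]integralE; apply: leeB.
  apply: ge0_le_integral => //; [exact: measurable_funepos|exact: measurable_funepos|].
  by move=> x _; rewrite !funeposE ge_max le_max (fg x) /= le_max lexx orbT.
apply: ge0_le_integral => //; [exact: measurable_funeneg|exact: measurable_funeneg|].
by move=> x _; rewrite !funenegE ge_max !le_max leeN2 (fg x) /= lexx orbT.
Qed.

Lemma integrable_dominated d (T : measurableType d) (R : realType)
    (mu : {measure set T -> \bar R}) (f g : T -> R) :
  measurable_fun setT f -> measurable_fun setT g -> (forall x, `|f x| <= g x) ->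
  (\int[mu]_x (g x)%:E < +oo)%E -> mu.-integrable setT (EFin \o f).
Proof.
move=> mf mg fg ig; apply/integrableP; split; first exact/measurable_EFinP.
apply: le_lt_trans ig; apply: ge0_le_integral => //.
- by apply: measurableT_comp => //; exact/measurable_EFinP.
- exact/measurable_EFinP.
- by move=> x _; rewrite lee_fin.
Qed.

(** * Pointwise sums over the scales *)

Section dyadic_pointwise.
Context {R : realType}.

Lemma ln_le_id (z : R) : 0 < z -> ln z <= z.
Proof.
move=> z0; have := @le_ln1Dx R (z - 1); rewrite subrKC => h.
by apply: (le_trans (h _)); lra.
Qed.

Lemma ln_exp2 k : ln (2 ^+ k) = k%:R * ln 2 :> R.
Proof. by rewrite lnXn// mulr_natl. Qed.

(** With [z = u w / 2^N] the threshold reads [2^j z <= 1]. The terms [u^2] are counted by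
    [count_dyadic_le], whose error [z] becomes [2^-N u^3 w]; the others form the geometric sum of
    [sum_dyadic_le] and total at most [2 C u^2]. *)
Lemma dyadic_entropy_le (C u w : R) N : 0 <= C -> 0 <= u -> 0 < w ->
  \sum_(j < N.*2) (if u * w <= 2 ^+ N / 2 ^+ j then u ^+ 2
                   else C * (2 ^+ N / 2 ^+ j / w) * u) <=
  u ^+ 2 * (1 + 2 * C) + u ^+ 2 * N%:R - u ^+ 2 * log2 (u * w) +
  2 ^- N * (u ^+ 3 * w).
Proof.
move=> C0; rewrite le_eqVlt => /predU1P[<-|u0] w0.
  rewrite big1; last first.
    by move=> j _; rewrite mul0r divr_ge0 ?exprn_ge0// expr0n.
  by rewrite !expr0n /= !mul0r mulr0 !addr0 oppr0.
pose z := u * w / 2 ^+ N.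
have uw0 : 0 < u * w by rewrite mulr_gt0.
have N0 : 0 < 2 ^+ N :> R by rewrite exprn_gt0.
have z0 : 0 < z by rewrite divr_gt0.
have e (j : 'I_N.*2) : (if u * w <= 2 ^+ N / 2 ^+ j then u ^+ 2
      else C * (2 ^+ N / 2 ^+ j / w) * u) =
    u ^+ 2 * (if 2 ^+ j * z <= 1 then 1 else 0) +
    C * u ^+ 2 / z * (if 2 ^+ j * z <= 1 then 0 else 2 ^- j).
  have j0 : 0 < 2 ^+ j :> R by rewrite exprn_gt0.
  rewrite (_ : (2 ^+ j * z <= 1) = (u * w <= 2 ^+ N / 2 ^+ j)); last first.
    by rewrite /z mulrA ler_pdivrMr// mul1r ler_pdivlMr// mulrC.
  case: ifP => _; first by rewrite mulr1 mulr0 addr0.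
  by rewrite mulr0 add0r /z; field; rewrite !gt_eqF.
rewrite (eq_bigr _ (fun j _ => e j)) big_split /= -!mulr_sumr.
have h1 := count_dyadic_le N.*2 z0; have h2 := sum_dyadic_le N.*2 z0.
apply: (@le_trans _ _ (u ^+ 2 * (1 - log2 z + z) + C * u ^+ 2 / z * (2 * z))).
  apply: lerD; rewrite ler_wpM2l ?sqr_ge0//.
  by rewrite divr_ge0 ?(ltW z0)// mulr_ge0// sqr_ge0.
have -> : log2 z = log2 (u * w) - N%:R.
  by rewrite /log2 /z ln_div ?posrE// ln_exp2; field; rewrite gt_eqF// ln2_gt0.
rewrite le_eqVlt; apply/orP; left; apply/eqP.
by rewrite /z; field; rewrite !gt_eqF.
Qed.

(** Here [z = sqrt q / 2^N]: the width [m^-2] turns the Gaussian exponent into the fourth power of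
    [2^j z], and the square root is the source of the 2 in [2 * ln 2]. *)
Lemma dyadic_gauss_le (q : R) N : 0 < q ->
  N%:R - 2 - 2 ^- N * (Num.sqrt q)^-1 -
  \sum_(j < N.*2) expR (- ((2 ^+ N / 2 ^+ j) ^- 2 * q) ^+ 2) <= ln q / (2 * ln 2).
Proof.
move=> q0; pose z := Num.sqrt q / 2 ^+ N.
have sq0 : 0 < Num.sqrt q by rewrite sqrtr_gt0.
have N0 : 0 < 2 ^+ N :> R by rewrite exprn_gt0.
have z0 : 0 < z by rewrite divr_gt0.
have := sum_gauss_dyadic_ge N.*2 z0.
rewrite (eq_bigr (fun j : 'I_N.*2 => expR (- ((2 ^+ N / 2 ^+ j) ^- 2 * q) ^+ 2))); last first.
  move=> j _; congr (expR (- _)).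
  have j0 : 0 < 2 ^+ j :> R by rewrite exprn_gt0.
  rewrite (_ : 4%N = (2 * 2)%N)// exprM; congr (_ ^+ 2).
  rewrite /z -{2}[q](sqr_sqrtr (ltW q0)); field.
  by rewrite !gt_eqF.
have -> : log2 z = ln q / (2 * ln 2) - N%:R.
  have -> : ln q = 2 * ln (Num.sqrt q).
    by rewrite -{1}(sqr_sqrtr (ltW q0)) lnXn// mulr_natl.
  by rewrite /log2 /z ln_div ?posrE// ln_exp2; field; rewrite gt_eqF// ln2_gt0.
have -> : 2 ^- N.*2 / z = 2 ^- N * (Num.sqrt q)^-1.
  by rewrite /z -addnn exprD; field; rewrite !gt_eqF.
lra.
Qed.

End dyadic_pointwise.

(** * Integrability of the entropy terms *)

Section entropy.
Context {R : realType} (n : nat).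
Notation V := 'rV[R]_n.+1.
Notation mu := (@lebesgueRn R n.+1).

Section integrability.
Variable v : R -> R.
Hypotheses (mv : measurable_fun setT v) (v0 : forall s, 0 <= v s)
  (vm : forall k, exists C, forall s, 0 <= s -> s ^+ k * v s <= C).

Let u (x : V) := v (enorm x).

Let mu_ : measurable_fun setT u.
Proof. by apply: measurableT_comp => //; exact: measurable_enorm. Qed.

Let u0 x : 0 <= u x. Proof. exact: v0. Qed.

Lemma radial_bounded : exists2 B, 0 <= B & forall x, u x <= B.
Proof.
have [B hB] := vm 0; exists B; last first.
  by move=> x; have := hB _ (enorm_ge0 x); rewrite expr0 mul1r.
by have := hB 0 (lexx 0); rewrite expr0 mul1r; exact: le_trans.
Qed.

Lemma integrable_radial_moment k :
  mu.-integrable setT (EFin \o (fun x => u x * enorm x ^+ k)).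
Proof.
apply: (integrable_dominated (g := fun x => u x * enorm x ^+ k)).
- by apply: measurable_funM => //; apply: measurable_funX; exact: measurable_enorm.
- by apply: measurable_funM => //; apply: measurable_funX; exact: measurable_enorm.
- by move=> x; rewrite ger0_norm// mulr_ge0// exprn_ge0// enorm_ge0.
- exact: integral_moment_lty.
Qed.

Lemma integrable_radial : mu.-integrable setT (EFin \o u).
Proof.
by have := integrable_radial_moment 0; apply: eq_integrable => // x _; rewrite /= expr0 mulr1.
Qed.

Lemma le_integrable_EFin (f g : V -> R) : measurable_fun setT f ->
  (forall x, `|f x| <= g x) -> mu.-integrable setT (EFin \o g) ->
  mu.-integrable setT (EFin \o f).
Proof.
move=> mf fg; apply: le_integrable => //; first exact/measurable_EFinP.
by move=> x _; rewrite lee_fin (le_trans (fg x))// ler_norm.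
Qed.

Lemma integrable_radial_sqr : mu.-integrable setT (EFin \o (fun x => u x ^+ 2)).
Proof.
have [B B0 uB] := radial_bounded.
apply: (le_integrable_EFin _ _ (integrableZ_EFin B integrable_radial)).
  exact: measurable_funX.
by move=> x; rewrite ger0_norm ?sqr_ge0// expr2 ler_wpM2r.
Qed.

(** [ln z <= z] at [u] and at [u^-1] gives [u^2 |ln u| <= u^3 + u], and [u] is bounded and
    integrable. *)
Lemma integrable_sqr_ln : mu.-integrable setT (EFin \o (fun x => u x ^+ 2 * ln (u x))).
Proof.
have [B B0 uB] := radial_bounded.
apply: (le_integrable_EFin _ _ (integrableZ_EFin (1 + B ^+ 2) integrable_radial)).
  apply: measurable_funM; first exact: measurable_funX.
  by apply: (measurableT_comp (@measurable_ln R)).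
move=> x; have := u0 x; rewrite le_eqVlt => /predU1P[<-|ux].
  by rewrite expr0n mul0r normr0 mulr0.
have h1 := ln_le_id ux.
have iu : 0 < (u x)^-1 by rewrite invr_gt0.
have h2 := ln_le_id iu; rewrite lnV ?posrE// in h2.
have uu : u x ^+ 2 <= B ^+ 2 by rewrite lerXn2r ?nnegrE// uB.
have e1 : u x ^+ 2 * (u x)^-1 = u x by field; rewrite gt_eqF.
have s0 : 0 <= u x ^+ 2 by exact: sqr_ge0.
rewrite ler_norml; apply/andP; split.
  have : u x ^+ 2 * - ln (u x) <= u x ^+ 2 * (u x)^-1 by rewrite ler_wpM2l.
  by rewrite e1; nra.
have : u x ^+ 2 * ln (u x) <= u x ^+ 2 * u x by rewrite ler_wpM2l.
nra.
Qed.

(** At infinity [ln |x| <= |x|] is absorbed by the first moment; at the origin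
    [- ln |x| <= 2 |x|^(-1/2)], which is [ln z <= z] at [z = |x|^(-1/2)]. *)
Lemma integrable_sqr_ln_enorm :
  mu.-integrable setT (EFin \o (fun x => u x ^+ 2 * ln (enorm x))).
Proof.
have [B B0 uB] := radial_bounded.
have sB x : 0 <= u x ^+ 2 <= B ^+ 2 by rewrite sqr_ge0 lerXn2r ?nnegrE// uB.
have f2 : (\int[mu]_x (u x ^+ 2)%:E < +oo)%E by exact: integrable_lty integrable_radial_sqr.
have f3 := integral_mul_rsqrt_lty (measurable_funX 2 mu_) sB f2.
have mr : measurable_fun setT (fun x : V => (Num.sqrt (enorm x))^-1).
  by apply: measurable_funV_ge0 => //; apply: measurable_sqrt; exact: measurable_enorm.
have i3 : mu.-integrable setT (EFin \o (fun x => u x ^+ 2 * (Num.sqrt (enorm x))^-1)).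
  apply: integrable_dominated f3.
  - by apply: measurable_funM => //; exact: measurable_funX.
  - by apply: measurable_funM => //; exact: measurable_funX.
  - by move=> x; rewrite ger0_norm// mulr_ge0 ?sqr_ge0// invr_ge0 sqrtr_ge0.
apply: (le_integrable_EFin _ _ (integrableD_EFin
  (integrableZ_EFin B (integrable_radial_moment 1)) (integrableZ_EFin 2 i3))).
  apply: measurable_funM; first exact: measurable_funX.
  by apply: (measurableT_comp (@measurable_ln R)); exact: measurable_enorm.
move=> x; have := enorm_ge0 x; rewrite le_eqVlt => /predU1P[<-|x0].
  by rewrite ln0// mulr0 normr0 expr1 sqrtr0 invr0 !mulr0 addr0.
have q0 : 0 < Num.sqrt (enorm x) by rewrite sqrtr_gt0.
have iq0 : 0 < (Num.sqrt (enorm x))^-1 by rewrite invr_gt0.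
have h1 := ln_le_id x0; have h2 := ln_le_id iq0; rewrite lnV ?posrE// in h2.
have e : ln (enorm x) = 2 * ln (Num.sqrt (enorm x)).
  by rewrite -{1}(sqr_sqrtr (ltW x0)) lnXn// mulr_natl.
have s0 : 0 <= u x ^+ 2 by exact: sqr_ge0.
have uu : u x ^+ 2 <= B * u x by rewrite expr2 ler_wpM2r.
have p1 : 0 <= u x ^+ 2 * (2 * (Num.sqrt (enorm x))^-1) by rewrite !mulr_ge0// ltW.
have p2 : 0 <= B * (u x * enorm x) by rewrite !mulr_ge0// ltW.
rewrite expr1 ler_norml; apply/andP; split.
  have : u x ^+ 2 * - ln (enorm x) <= u x ^+ 2 * (2 * (Num.sqrt (enorm x))^-1).
    by rewrite ler_wpM2l//; lra.
  lra.
have : u x ^+ 2 * ln (enorm x) <= u x ^+ 2 * enorm x by rewrite ler_wpM2l.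
have : u x ^+ 2 * enorm x <= B * u x * enorm x by rewrite ler_wpM2r// ltW.
lra.
Qed.

Lemma integrable_cube_wnorm :
  mu.-integrable setT (EFin \o (fun x => u x ^+ 3 * wnorm x)).
Proof.
have [B B0 uB] := radial_bounded.
apply: (le_integrable_EFin _ _ (integrableZ_EFin (B ^+ 2) (integrableD_EFin
  (integrable_radial_moment 0) (integrable_radial_moment n)))).
  by apply: measurable_funM; [exact: measurable_funX|exact: measurable_wnorm].
move=> x; rewrite ger0_norm ?mulr_ge0 ?exprn_ge0 ?wnorm_ge0//.
have uu : u x ^+ 2 <= B ^+ 2 by rewrite lerXn2r ?nnegrE// uB.
have w1 : wnorm x <= 1 + enorm x ^+ n.
  by rewrite -wnorm_sqr; have := sqr_ge0 (wnorm x - 2^-1); nra.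
rewrite expr0 -mulrDr exprSr -mulrA ler_pM ?sqr_ge0 ?mulr_ge0 ?wnorm_ge0//.
by rewrite ler_wpM2l.
Qed.

End integrability.
End entropy.

(** * The entropy inequality *)

Section entropy_inequality.
Context {R : realType} (n : nat).
Notation V := 'rV[R]_n.+1.
Notation mu := (@lebesgueRn R n.+1).

Let final_arith (a x k k' C N e : R) : x <= 1 + 2 * C + N + e * k' - a ->
  e * (k + k') <= 1 -> a - (4 + 2 * C) <= N - 2 - e * k - x.
Proof. by rewrite mulrDr; lra. Qed.

Let origin_arith (a : R) : 0 <= a -> a - 2 - (a + a) <= 0.
Proof. lra. Qed.

Let half_arith (a b k : R) : 2 * a = k * b -> a = k / 2 * b.
Proof. by move=> h; rewrite mulrAC -h; field. Qed.

(** This isolates what is used of the Fourier transform: [F] is a bounded probability density whose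
    Gaussian averages lie below the heat form. The constant is fixed before [v] and [F]; their
    individual bounds influence only the choice of [N]. *)
Lemma entropy_frequency_le : exists c : R, forall (v : R -> R) (F : V -> R) (KF : R),
  measurable_fun setT v -> (forall s, 0 <= v s) ->
  (forall k, exists C, forall s, 0 <= s -> s ^+ k * v s <= C) ->
  let u (x : V) := v (enorm x) in
  (\int[mu]_x (u x ^+ 2)%:E = 1)%E ->
  measurable_fun setT F -> (forall xi, 0 <= F xi <= KF) ->
  (\int[mu]_xi (F xi)%:E = 1)%E ->
  (forall r, 0 < r -> (\int[mu]_xi (expR (- (r * enorm xi) ^+ 2) * F xi)%:E <=
                       heat_form r u u)%E) ->
  (2%:E * \int[mu]_x (u x ^+ 2 * ln (u x))%:E +
   n%:R%:E * \int[mu]_x (u x ^+ 2 * ln (enorm x))%:E <=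
   \int[mu]_xi (F xi * ln (enorm xi))%:E + c%:E)%E.
Proof.
have [C C0 HC] := @heat_form_le R n.
(* [4 + 2 C] collects [1 + 2 C] from [dyadic_entropy_le], 2 from [dyadic_gauss_le] and 1 for the two
   terms of order [2^-N]; the factor [2 ln 2] undoes the normalization by [log2] and its half. *)
exists (2 * ln 2 * (4 + 2 * C)) => v F KF mv v0 vm u u1 mF FK F1 FH.
have ln2 := @ln2_gt0 R.
have F0 xi : 0 <= F xi by have /andP[] := FK xi.
have u0 x : 0 <= u x by exact: v0.
have menorm := @measurable_enorm R n.+1.
have mwn := @measurable_wnorm R n.
have mu_ : measurable_fun setT u by exact: measurableT_comp.
have i2 : mu.-integrable setT (EFin \o (fun x => u x ^+ 2)) by exact: integrable_radial_sqr.
have iA : mu.-integrable setT (EFin \o (fun x => u x ^+ 2 * ln (u x))).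
  exact: integrable_sqr_ln.
have iB : mu.-integrable setT (EFin \o (fun x => u x ^+ 2 * ln (enorm x))).
  exact: integrable_sqr_ln_enorm.
have iK' : mu.-integrable setT (EFin \o (fun x => u x ^+ 3 * wnorm x)).
  exact: integrable_cube_wnorm.
have iF : mu.-integrable setT (EFin \o F).
  apply: (integrable_dominated mF mF); last by rewrite F1 ltry.
  by move=> x; rewrite ger0_norm.
have mr : measurable_fun setT (fun x : V => (Num.sqrt (enorm x))^-1).
  by apply: measurable_funV_ge0 => //; exact: measurable_sqrt.
have mFr : measurable_fun setT (fun xi => F xi * (Num.sqrt (enorm xi))^-1).
  exact: measurable_funM.
have iK : mu.-integrable setT (EFin \o (fun xi => F xi * (Num.sqrt (enorm xi))^-1)).
  apply: (integrable_dominated mFr mFr).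
    by move=> x; rewrite ger0_norm// mulr_ge0// invr_ge0 sqrtr_ge0.
  by apply: (integral_mul_rsqrt_lty mF FK); rewrite F1 ltry.
pose A := \int[mu]_x (u x ^+ 2 * ln (u x)).
pose B := \int[mu]_x (u x ^+ 2 * ln (enorm x)).
pose K := \int[mu]_xi (F xi * (Num.sqrt (enorm xi))^-1).
pose K' := \int[mu]_x (u x ^+ 3 * wnorm x).
have AE : (\int[mu]_x (u x ^+ 2 * ln (u x))%:E = A%:E)%E.
  by rewrite fineK//; exact: integrable_fin_num iA.
have BE : (\int[mu]_x (u x ^+ 2 * ln (enorm x))%:E = B%:E)%E.
  by rewrite fineK//; exact: integrable_fin_num iB.
have K0 : 0 <= K by apply: Rintegral_ge0 => x _; rewrite mulr_ge0// invr_ge0 sqrtr_ge0.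
have K'0 : 0 <= K' by apply: Rintegral_ge0 => x _; rewrite mulr_ge0 ?exprn_ge0// wnorm_ge0.
(* [K] and [K'] depend on [v] and [F]; [N] is so large that the two error terms together cost at
   most 1. *)
pose N := Num.bound (K + K').
have N0 : 0 < 2 ^+ N :> R by rewrite exprn_gt0.
have KN : 2 ^- N * (K + K') <= 1.
  rewrite mulrC ler_pdivrMr// mul1r.
  apply: (@le_trans _ _ N%:R); first by apply: ltW; apply: archi_boundP; exact: addr_ge0.
  by rewrite -natrX ler_nat ltnW// ltn_expl.
pose m (j : nat) : R := 2 ^+ N / 2 ^+ j.
have m0 j : 0 < m j by rewrite divr_gt0// exprn_gt0.
have m20 j : 0 < m j ^- 2 by rewrite invr_gt0 exprn_gt0.
pose gauss j (xi : V) := expR (- (m j ^- 2 * enorm xi) ^+ 2).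
have mg j : measurable_fun setT (gauss j) by exact: measurable_gaussRn.
pose S xi := \sum_(j < N.*2) gauss j xi.
have mS : measurable_fun setT S by apply: measurable_sum => j; exact: mg.
have S0 xi : 0 <= S xi by apply: sumr_ge0 => j _; exact: expR_ge0.
have gauss1 j xi : gauss j xi <= 1.
  by rewrite /gauss -expR0 ler_expR oppr_le0 sqr_ge0.
have S2N xi : S xi <= (N.*2)%:R.
  apply: (@le_trans _ _ (\sum_(j < N.*2) 1)); first exact: ler_sum.
  by rewrite sumr_const card_ord.
have mFS : measurable_fun setT (fun xi => F xi * S xi) by exact: measurable_funM.
have iFS : mu.-integrable setT (EFin \o (fun xi => F xi * S xi)).
  apply: (le_integrable_EFin mFS _ (integrableZ_EFin (N.*2)%:R iF)) => xi.
  by rewrite ger0_norm ?mulr_ge0// mulrC ler_wpM2r.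
pose T j y := if u y * wnorm y <= m j then u y ^+ 2 else C * (m j / wnorm y) * u y.
have T0 j y : 0 <= T j y.
  rewrite /T; case: ifP => _; first exact: sqr_ge0.
  by rewrite mulr_ge0// mulr_ge0 ?(ltW C0)// divr_ge0 ?wnorm_ge0// ltW.
have mT j : measurable_fun setT (T j).
  apply: measurable_fun_ifT.
  - by apply: measurable_fun_ler => //; exact: measurable_funM.
  - exact: measurable_funX.
  - apply: measurable_funM => //; apply: measurable_funM => //; apply: measurable_funM => //.
    by apply: measurable_funV_ge0 => // x; exact: wnorm_ge0.
pose L y := (u y ^+ 2 * ln (u y) + n%:R / 2 * (u y ^+ 2 * ln (enorm y))) / ln 2.
have iL : mu.-integrable setT (EFin \o L).
  have := integrableZ_EFin (ln 2)^-1 (integrableD_EFin iA (integrableZ_EFin (n%:R / 2) iB)).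
  by apply: eq_integrable => // x _; rewrite /= /L mulrC.
pose H y := u y ^+ 2 * (1 + 2 * C + N%:R) + (2 ^- N * (u y ^+ 3 * wnorm y) - L y).
have iH1 : mu.-integrable setT (EFin \o (fun y => u y ^+ 2 * (1 + 2 * C + N%:R))).
  have := integrableZ_EFin (1 + 2 * C + N%:R) i2.
  by apply: eq_integrable => // x _; rewrite /= mulrC.
have iH2 := integrableB_EFin (integrableZ_EFin (2 ^- N) iK') iL.
have iH : mu.-integrable setT (EFin \o H) by exact: integrableD_EFin.
have intL : \int[mu]_y L y = (A + n%:R / 2 * B) / ln 2.
  rewrite /L RintegralZr//; last exact: integrableD_EFin iA (integrableZ_EFin _ iB).
  rewrite RintegralD//; last exact: integrableZ_EFin iB.
  by rewrite (RintegralZl _ measurableT iB).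
have intH : \int[mu]_y H y = 1 + 2 * C + N%:R + 2 ^- N * K' - (A + n%:R / 2 * B) / ln 2.
  rewrite /H (RintegralD measurableT iH1 iH2).
  rewrite (RintegralB measurableT (integrableZ_EFin (2 ^- N) iK') iL) intL.
  rewrite (RintegralZl _ measurableT iK') (RintegralZr _ measurableT i2).
  by rewrite {1}/Rintegral u1 /= mul1r addrA.
have pointwise y : y != 0 -> \sum_(j < N.*2) T j y <= H y.
  move=> y0; have w0 := wnorm_gt0 y0.
  apply: (le_trans (dyadic_entropy_le N (ltW C0) (u0 y) w0)).
  have e0 : 0 < enorm y by rewrite lt_neqAle eq_sym enorm_eq0 y0 enorm_ge0.
  have lw : ln (wnorm y) = n%:R / 2 * ln (enorm y).
    apply: half_arith.
    by rewrite mulr_natl -lnXn// wnorm_sqr lnXn// mulr_natl.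
  have -> : u y ^+ 2 * log2 (u y * wnorm y) = L y.
    have := u0 y; rewrite /L le_eqVlt => /predU1P[<-|uy].
      by rewrite expr0n /= !mul0r mulr0 addr0 mul0r.
    by rewrite /log2 lnM ?posrE// lw; ring.
  by rewrite le_eqVlt; apply/orP; left; apply/eqP; rewrite /H; ring.
have X1 : \int[mu]_xi (F xi * S xi) <= \int[mu]_y H y.
  rewrite -lee_fin [leLHS]fineK; last exact: integrable_fin_num iFS.
  rewrite [leRHS]fineK; last exact: integrable_fin_num iH.
  have -> : (\int[mu]_xi (F xi * S xi)%:E =
      \sum_(j < N.*2) \int[mu]_xi (gauss j xi * F xi)%:E)%E.
    rewrite -ge0_integral_sum//.
    - apply: eq_integral => xi _; rewrite /S mulr_sumr -sumEFin.
      by apply: eq_bigr => j _; rewrite mulrC.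
    - by move=> j; apply/measurable_EFinP; exact: measurable_funM.
    - by move=> j xi _; rewrite lee_fin mulr_ge0// expR_ge0.
  apply: (@le_trans _ _ (\sum_(j < N.*2) \int[mu]_y (T j y)%:E)%E).
    apply: lee_sum => j _; apply: (le_trans (FH _ (m20 j))).
    exact: (HC v mv v0 u1 (m j) (m0 j)).
  rewrite -ge0_integral_sum//; last 2 first.
  - by move=> j; exact/measurable_EFinP.
  - by move=> j y _; rewrite lee_fin.
  have mH : measurable_fun setT H.
    by apply/measurable_EFinP; exact: measurable_int iH.
  (* [pointwise] gives [H] a nonnegative lower bound only off the origin, so [H] is replaced by its
     maximum with 0, equal to it almost everywhere. *)
  rewrite [leRHS](ae_eq_integral (fun y => (Num.max 0 (H y))%:E))//; last 3 first.
  - exact/measurable_EFinP.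
  - by apply/measurable_EFinP; exact: measurable_maxr.
  - move: (@ae_neq0 R n); apply: filterS => y y0 _; rewrite max_r//.
    by apply: le_trans (pointwise y y0); exact: sumr_ge0.
  apply: ae_ge0_le_integral => //.
  - by move=> y _; rewrite sumEFin lee_fin; exact: sumr_ge0.
  - under eq_fun do rewrite sumEFin.
    by apply/measurable_EFinP; apply: measurable_sum => j; exact: mT.
  - by move=> y _; rewrite lee_fin le_max lexx.
  - by apply/measurable_EFinP; exact: measurable_maxr.
  move: (@ae_neq0 R n); apply: filterS => y y0 _.
  by rewrite sumEFin lee_fin le_max pointwise// orbT.
(* The integrable minorant of [F * ln |xi|] supplied by [dyadic_gauss_le]. *)
pose G xi := 2 * ln 2 * ((N%:R - 2) * F xi -
  2 ^- N * (F xi * (Num.sqrt (enorm xi))^-1) - F xi * S xi).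
have iG1 := integrableB_EFin (integrableZ_EFin (N%:R - 2) iF) (integrableZ_EFin (2 ^- N) iK).
have iG2 := integrableB_EFin iG1 iFS.
have iG : mu.-integrable setT (EFin \o G) by exact: integrableZ_EFin iG2.
have intG : \int[mu]_xi G xi =
    2 * ln 2 * (N%:R - 2 - 2 ^- N * K - \int[mu]_xi (F xi * S xi)).
  rewrite /G (RintegralZl _ measurableT iG2) (RintegralB measurableT iG1 iFS).
  rewrite (RintegralB measurableT (integrableZ_EFin (N%:R - 2) iF) (integrableZ_EFin (2 ^- N) iK)).
  rewrite (RintegralZl _ measurableT iF) (RintegralZl _ measurableT iK).
  by rewrite {1}/Rintegral F1 /= mulr1.
have GF : (\int[mu]_xi (G xi)%:E <= \int[mu]_xi (F xi * ln (enorm xi))%:E)%E.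
  apply: le_integral_measurable.
  - exact: measurable_int iG.
  - apply/measurable_EFinP; apply: measurable_funM => //.
    exact: (measurableT_comp (@measurable_ln R)).
  move=> xi; rewrite lee_fin.
  rewrite (_ : G xi = F xi * (2 * ln 2 * (N%:R - 2 - 2 ^- N * (Num.sqrt (enorm xi))^-1 - S xi))).
    rewrite ler_wpM2l//; have := enorm_ge0 xi; rewrite le_eqVlt => /predU1P[e0|e0].
      (* At the origin [ln 0] and the inverse of 0 are both 0 and all [2 N] Gaussians equal 1, so
         the bracket is [N - 2 - 2 N <= 0]. *)
      have -> : S xi = (N.*2)%:R.
        rewrite /S (eq_bigr (fun=> 1)) ?sumr_const ?card_ord// => j _.
        by rewrite /gauss -e0 mulr0 expr0n oppr0 expR0.
      rewrite -e0 (ln0 (lexx 0)) sqrtr0 invr0 mulr0 subr0 mulr_ge0_le0 ?mulr_ge0 ?(ltW ln2)//.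
      by rewrite -addnn natrD; exact/origin_arith/ler0n.
    have := dyadic_gauss_le N e0; rewrite -/(S xi) ler_pdivlMr ?mulr_gt0// mulrC.
    exact: le_trans.
  by rewrite /G; ring.
rewrite AE BE -!EFinM -EFinD -leeBlDr// -EFinB; apply: le_trans GF.
rewrite -[leRHS]fineK; last exact: integrable_fin_num iG.
rewrite lee_fin -/(Rintegral mu setT G) intG.
rewrite intH in X1.
have l2 : ln 2 != 0 :> R by rewrite gt_eqF.
have -> : 2 * A + n%:R * B = 2 * ln 2 * ((A + n%:R / 2 * B) / ln 2) by field.
rewrite -mulrBr ler_pM2l ?mulr_gt0//.
exact: final_arith X1 KN.
Qed.

End entropy_inequality.

(** * Radial Schwartz functions *)

Section schwartz_radial.
Context {R : realType} (n : nat).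
Notation V := 'rV[R]_n.+1.
Notation mu := (@lebesgueRn R n.+1).
Local Notation Re := (@complex.Re R).
Local Notation Im := (@complex.Im R).

Lemma normc_sqrtE (z : R[i]) : Normc.normc z = Num.sqrt (Re z ^+ 2 + Im z ^+ 2).
Proof. by case: z. Qed.

Lemma normc_ge0 (z : R[i]) : 0 <= Normc.normc z.
Proof. by rewrite normc_sqrtE sqrtr_ge0. Qed.

Lemma normc_sqr (z : R[i]) : Normc.normc z ^+ 2 = Re z ^+ 2 + Im z ^+ 2.
Proof. by rewrite normc_sqrtE sqr_sqrtr// addr_ge0// sqr_ge0. Qed.

Lemma normr_Re_le (z : R[i]) : `|Re z| <= Normc.normc z.
Proof.
by rewrite -sqrtr_sqr normc_sqrtE ler_wsqrtr// lerDl sqr_ge0.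
Qed.

Lemma normr_Im_le (z : R[i]) : `|Im z| <= Normc.normc z.
Proof.
by rewrite -sqrtr_sqr normc_sqrtE ler_wsqrtr// lerDr sqr_ge0.
Qed.

(** The left side is the real part of [z] times the conjugate of [w]; this is where [gaussF_le]
    discards the phase of [f]. *)
Lemma normc_dot_le (z w : R[i]) :
  Re z * Re w + Im z * Im w <= Normc.normc z * Normc.normc w.
Proof.
rewrite !normc_sqrtE -sqrtrM ?addr_ge0 ?sqr_ge0//.
apply: (le_trans (ler_norm _)); rewrite -sqrtr_sqr ler_wsqrtr//.
have := sqr_ge0 (Re z * Im w - Im z * Re w); nra.
Qed.

Definition axis : V := delta_mx ord0 ord0.

Lemma enorm_axis s : enorm (s *: axis) = `|s|.
Proof.
rewrite enormZ /enorm big_ord_recl big1 ?addr0; last first.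
  by move=> i _; rewrite mxE /= expr0n.
by rewrite mxE eqxx expr1n sqrtr1 mulr1.
Qed.

Variable f : V -> R[i].
Hypotheses (fS : schwartz f) (fR : radial f).

Let p (x : V) := Re (f x).
Let q (x : V) := Im (f x).
Let v (s : R) := Normc.normc (f (s *: axis)).
Let u (x : V) := v (enorm x).

Let fE x : f x = f (enorm x *: axis).
Proof. by apply: fR; rewrite enorm_axis ger0_norm ?enorm_ge0. Qed.

Lemma profileE x : u x = Normc.normc (f x). Proof. by rewrite /u /v -fE. Qed.

Let cp : continuous p. Proof. by have [/(_ [::])[]] := fS. Qed.
Let cq : continuous q. Proof. by have [/(_ [::])[]] := fS. Qed.

Let measurable_axis (g : V -> R) : continuous g -> measurable_fun setT (fun s : R => g (s *: axis)).
Proof.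
move=> cg; apply: continuous_measurable_fun => s.
apply: (@continuous_comp _ _ _ (fun s : R => s *: axis) g); last exact: cg.
exact: scalel_continuous.
Qed.

(** Measurability on R^n refers to the coordinate sigma-algebra. A radial function factors through
    [enorm] and its restriction to a line, where continuity gives measurability. *)
Let measurable_radial (g : V -> R) : continuous g ->
  (forall x, g x = g (enorm x *: axis)) -> measurable_fun setT g.
Proof.
move=> cg gE; rewrite (_ : g = (fun s => g (s *: axis)) \o @enorm R n.+1).
  by apply: measurableT_comp; [exact: measurable_axis|exact: measurable_enorm].
by apply/funext => x /=; exact: gE.
Qed.

Let mp : measurable_fun setT p.
Proof. by apply: measurable_radial => // x; rewrite /p fE. Qed.
Let mq : measurable_fun setT q.
Proof. by apply: measurable_radial => // x; rewrite /q fE. Qed.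

Lemma measurable_profile : measurable_fun setT v.
Proof.
rewrite (_ : v = fun s => Num.sqrt (p (s *: axis) ^+ 2 + q (s *: axis) ^+ 2)).
  by apply: measurable_sqrt; apply: measurable_funD; apply: measurable_funX; exact: measurable_axis.
by apply/funext => s; rewrite /v normc_sqrtE.
Qed.

Let v0 s : 0 <= v s. Proof. exact: normc_ge0. Qed.

Lemma profile_decay k : exists C, forall s, 0 <= s -> s ^+ k * v s <= C.
Proof.
have [_ /(_ k [::])[C hC]] := fS; exists C => s s0.
by have := hC (s *: axis); rewrite enorm_axis ger0_norm.
Qed.

Let iu : mu.-integrable setT (EFin \o u).
Proof. exact: (integrable_radial n measurable_profile v0 profile_decay). Qed.

Let ip : mu.-integrable setT (EFin \o p).
Proof. by apply: (le_integrable_EFin mp _ iu) => x; rewrite profileE normr_Re_le. Qed.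

Let iq : mu.-integrable setT (EFin \o q).
Proof. by apply: (le_integrable_EFin mq _ iu) => x; rewrite profileE normr_Im_le. Qed.

Let pN x : p (- x) = p x. Proof. by rewrite /p (fR (enormN x)). Qed.
Let qN x : q (- x) = q x. Proof. by rewrite /q (fR (enormN x)). Qed.

(** The square of the normalization [(2 pi)^(-d/2)]; it cancels the [(2 pi)^d] of
    [gauss_cosine_transform]. *)
Let k0 : R := (2 * pi) ^- n.+1.

Let k0_gt0 : 0 < k0.
Proof. by rewrite invr_gt0 exprn_gt0// mulr_gt0// pi_gt0. Qed.

Let F xi := k0 * (cosine_transform p xi ^+ 2 + cosine_transform q xi ^+ 2).

(** A radial [f] is even, so the sine integrals vanish, and the real and imaginary parts of the
    transform are multiples of the cosine transforms of [p] and [q]. *)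
Lemma fourier_radialE xi : Normc.normc (fourier f xi) ^+ 2 = F xi.
Proof.
rewrite /fourier Normc.normcM exprMn; congr (_ * _).
  rewrite normc_sqr /= expr0n addr0 /k0 -powR_mulrn ?powR_ge0// -powRrM.
  rewrite mulNr divfK// powRN powR_mulrn// mulr_ge0// ltW// pi_gt0//.
rewrite normc_sqr /cintegral /=; congr (_ ^+ 2 + _ ^+ 2).
- transitivity (\int[mu]_x (p x * cos (dotrV xi x) + q x * sin (dotrV xi x))).
    apply: eq_Rintegral => x _; rewrite /p /q /expi cosN sinN.
    by case: (f x) => a b /=; rewrite mulrN opprK.
  rewrite RintegralD//; last 2 first.
  + exact: (integrable_mul_bounded ip (measurable_cos_dotrV xi) (fun x => cos_max _)).
  + exact: (integrable_mul_bounded iq (measurable_sin_dotrV xi) (fun x => normr_sin_le1 _)).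
  by rewrite (sine_integral0 iq qN) addr0.
- transitivity (\int[mu]_x (q x * cos (dotrV xi x) - p x * sin (dotrV xi x))).
    apply: eq_Rintegral => x _; rewrite /p /q /expi cosN sinN.
    by case: (f x) => a b /=; rewrite mulrN addrC.
  rewrite RintegralB//; last 2 first.
  + exact: (integrable_mul_bounded iq (measurable_cos_dotrV xi) (fun x => cos_max _)).
  + exact: (integrable_mul_bounded ip (measurable_sin_dotrV xi) (fun x => normr_sin_le1 _)).
  by rewrite (sine_integral0 ip pN) subr0.
Qed.

Let mF : measurable_fun setT F.
Proof.
apply: measurable_funM => //; apply: measurable_funD; apply: measurable_funX;
  exact: measurable_cosine_transform.
Qed.

Let KF : R := k0 * ((\int[mu]_x `|p x|) ^+ 2 + (\int[mu]_x `|q x|) ^+ 2).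

Let sqr_le (a b : R) : `|a| <= b -> a ^+ 2 <= b ^+ 2.
Proof.
by move=> ab; rewrite -[leLHS]real_normK ?num_real// lerXn2r ?nnegrE// (le_trans _ ab).
Qed.

Let F_bounds xi : 0 <= F xi <= KF.
Proof.
rewrite mulr_ge0 ?(ltW k0_gt0) ?addr_ge0 ?sqr_ge0//=.
by rewrite ler_wpM2l ?(ltW k0_gt0)// lerD// sqr_le// cosine_transform_le.
Qed.

Let integral_gaussF r : 0 < r ->
  (\int[mu]_xi (expR (- (r * enorm xi) ^+ 2) * F xi)%:E =
   (\int[mu]_x (p x * heat_mean p r x) + \int[mu]_x (q x * heat_mean q r x))%:E)%E.
Proof.
move=> r0.
have ig (g : V -> R) : mu.-integrable setT (EFin \o g) ->
    mu.-integrable setT (EFin \o (fun xi => expR (- (r * enorm xi) ^+ 2) * cosine_transform g xi ^+ 2)).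
  move=> i; have mc := measurable_cosine_transform i.
  pose P := \int[mu]_x `|g x|.
  apply: (le_integrable_EFin _ _ (integrableZ_EFin (P ^+ 2) (@integrable_gauss R n.+1 _ r0))).
    by apply: measurable_funM; [exact: measurable_gaussRn|exact: measurable_funX].
  move=> xi /=; rewrite normrM (ger0_norm (expR_ge0 _)) normrX mulrC.
  by rewrite ler_wpM2r ?expR_ge0// sqr_le// normr_id cosine_transform_le.
have -> : (\int[mu]_xi (expR (- (r * enorm xi) ^+ 2) * F xi)%:E =
   (\int[mu]_xi (k0 * (expR (- (r * enorm xi) ^+ 2) * cosine_transform p xi ^+ 2 +
   expR (- (r * enorm xi) ^+ 2) * cosine_transform q xi ^+ 2)))%:E)%E.
  rewrite fineK; last first.
    by apply: integrable_fin_num => //; apply: integrableZ_EFin; apply: integrableD_EFin; exact: ig.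
  by apply: eq_integral => xi _; rewrite /F; congr EFin; ring.
congr EFin; rewrite RintegralZl//; last by apply: integrableD_EFin; exact: ig.
rewrite RintegralD//; [|exact: ig|exact: ig].
rewrite !gauss_cosine_transform// -mulrDr mulrA /k0 mulVf ?mul1r//.
by rewrite expf_neq0// mulf_neq0// gt_eqF// pi_gt0.
Qed.

Let integrable_heat_mean (g : V -> R) r : mu.-integrable setT (EFin \o g) ->
  (forall x, `|g x| <= u x) -> 0 < r ->
  mu.-integrable setT (EFin \o (fun x => g x * heat_mean g r x)).
Proof.
move=> i gu r0; have [B B0 uB] := radial_bounded n v0 profile_decay.
have gB x : `|g x| <= B by exact: le_trans (gu x) (uB x).
have mg : measurable_fun setT g by apply/measurable_EFinP; exact: measurable_int i.
apply: (le_integrable_EFin _ _ (integrableZ_EFin B (integrable_norm i))).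
  by apply: measurable_funM => //; exact: measurable_heat_mean.
by move=> x /=; rewrite normrM mulrC ler_wpM2r//; exact: heat_mean_le.
Qed.

Let pu x : `|p x| <= u x. Proof. by rewrite profileE normr_Re_le. Qed.
Let qu x : `|q x| <= u x. Proof. by rewrite profileE normr_Im_le. Qed.

(** By Gaussian Plancherel the left side is the heat form with [p x * p y + q x * q y] in place of
    [u x * u y], a larger quantity. The iterated integrals are compared one variable at a time. *)
Let gaussF_le r : 0 < r ->
  (\int[mu]_xi (expR (- (r * enorm xi) ^+ 2) * F xi)%:E <= heat_form r u u)%E.
Proof.
move=> r0; rewrite integral_gaussF//.
have i1 := integrable_heat_mean ip pu r0; have i2 := integrable_heat_mean iq qu r0.
have mu_ : measurable_fun setT u by apply/measurable_EFinP; exact: measurable_int iu.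
rewrite -(RintegralD measurableT i1 i2) fineK; last first.
  by apply: integrable_fin_num => //; exact: integrableD_EFin i1 i2.
apply: le_integral_measurable.
- exact: measurable_int (integrableD_EFin i1 i2).
- apply: (@measurable_fun_fubini_tonelli_G _ _ _ _ _ mu
    (fun z : V * V => (u z.1 * u z.2 * heat r (z.1 - z.2))%:E)).
    exact: measurable_heat_form.
  by move=> z; rewrite lee_fin mulr_ge0 ?heat_ge0// mulr_ge0 ?v0.
move=> x.
have ih (g : V -> R) (i : mu.-integrable setT (EFin \o g)) a :
    mu.-integrable setT (EFin \o (fun y => a * (g y * heat r (y - x)))).
  exact: integrableZ_EFin (integrable_mul_heat i x r0).
rewrite /heat_mean -(RintegralZl _ measurableT (integrable_mul_heat ip x r0)).
rewrite -(RintegralZl _ measurableT (integrable_mul_heat iq x r0)).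
rewrite -(RintegralD measurableT (ih _ ip (p x)) (ih _ iq (q x))) fineK; last first.
  by apply: integrable_fin_num => //; exact: integrableD_EFin (ih _ ip (p x)) (ih _ iq (q x)).
apply: le_integral_measurable.
- exact: measurable_int (integrableD_EFin (ih _ ip (p x)) (ih _ iq (q x))).
- apply/measurable_EFinP; apply: measurable_funM; last exact: measurable_heat_sub.
  exact: measurable_funM.
move=> y; rewrite lee_fin /= !mulrA -mulrDl ler_wpM2r ?heat_ge0//.
by rewrite !profileE (mulrC (Normc.normc _)); exact: normc_dot_le.
Qed.

Hypothesis u1 : (\int[mu]_x (u x ^+ 2)%:E = 1)%E.

(** Plancherel as a limit: as the width tends to 0, the Gaussian integrals increase to [\int F] by
    monotone convergence, while the heat means give [\int p^2 + \int q^2]. Finiteness of [\int F] is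
    a result of this comparison. *)
Let integral_F : (\int[mu]_xi (F xi)%:E = 1)%E.
Proof.
pose r k : R := k.+1%:R^-1.
have r0 k : 0 < r k by rewrite invr_gt0 ltr0Sn.
pose g k xi := (expR (- (r k * enorm xi) ^+ 2) * F xi)%:E.
have F0 xi : 0 <= F xi by have /andP[] := F_bounds xi.
have mg k : measurable_fun setT (g k).
  by apply/measurable_EFinP; apply: measurable_funM => //; exact: measurable_gaussRn.
have g0 k xi : setT xi -> (0 <= g k xi)%E by rewrite lee_fin mulr_ge0// expR_ge0.
have gnd xi : setT xi -> {homo g ^~ xi : a b / (a <= b)%N >-> (a <= b)%E}.
  move=> _ a b ab; rewrite lee_fin ler_wpM2r// ler_expR lerN2.
  rewrite lerXn2r ?nnegrE ?mulr_ge0 ?enorm_ge0 ?(ltW (r0 _))//.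
  by rewrite ler_wpM2r ?enorm_ge0// lef_pV2 ?posrE ?ltr0Sn// ler_nat.
have rcvg : r k @[k --> \oo] --> (0 : R) by exact: cvg_harmonic.
have glim xi : limn (g ^~ xi) = (F xi)%:E.
  apply/cvg_lim => //; apply/fine_cvgP; split; first exact: nearW.
  rewrite [X in _ --> X](_ : _ = expR (- (0 * enorm xi) ^+ 2) * F xi); last first.
    by rewrite mul0r expr0n oppr0 expR0 mul1r.
  have rx : r k * enorm xi @[k --> \oo] --> 0 * enorm xi by apply: cvgM => //; exact: cvg_cst.
  apply: cvgM; last exact: cvg_cst.
  apply: continuous_cvg; first exact: continuous_expR.
  by apply: cvgN; rewrite expr2; under eq_fun do rewrite expr2; exact: (cvgM rx rx).
have c2 : (\int[mu]_xi g k xi @[k --> \oo] --> 1)%E.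
  have -> : (fun k => \int[mu]_xi g k xi)%E = EFin \o (fun k =>
      \int[mu]_x (p x * heat_mean p (r k) x) + \int[mu]_x (q x * heat_mean q (r k) x)).
    by apply/funext => k; exact: integral_gaussF.
  have [B B0 uB] := radial_bounded n v0 profile_decay.
  (* Continuity enters along the sequences [r k *: z + x], the form produced by
     [heat_mean_dilate]. *)
  have ray (h : V -> R) : continuous h -> forall x z : V, h (r k *: z + x) @[k --> \oo] --> h x.
    move=> ch x z; apply: continuous_cvg; first exact: ch.
    have -> : nbhs x = nbhs (0 *: z + x) by rewrite scale0r add0r.
    by apply: cvgD; [apply: cvgZ => //; exact: cvg_cst|exact: cvg_cst].
  have cvp := integral_heat_mean_cvg ip (fun x => le_trans (pu x) (uB x)) (ray _ cp).
  have cvq := integral_heat_mean_cvg iq (fun x => le_trans (qu x) (uB x)) (ray _ cq).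
  apply: cvg_EFin; first exact: nearW.
  have isq (h : V -> R) : measurable_fun setT h -> (forall x, `|h x| <= u x) ->
      mu.-integrable setT (EFin \o (fun x => h x ^+ 2)).
    move=> mh hu; apply: (le_integrable_EFin _ _
      (integrable_radial_sqr n measurable_profile v0 profile_decay)).
      exact: measurable_funX.
    by move=> x /=; rewrite ger0_norm ?sqr_ge0// sqr_le.
  have -> : (1 : R) = (\int[mu]_x p x ^+ 2) + (\int[mu]_x q x ^+ 2).
    rewrite -(RintegralD measurableT (isq _ mp pu) (isq _ mq qu)).
    rewrite [LHS](_ : _ = fine 1%E)// -u1; congr fine.
    by apply: eq_integral => x _; rewrite profileE normc_sqr.
  exact: cvgD.
have <- : (\int[mu]_xi (limn (g ^~ xi)) = \int[mu]_xi (F xi)%:E)%E.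
  by apply: eq_integral => xi _; exact: glim.
by rewrite (monotone_convergence mu measurableT mg g0 gnd); exact/cvg_lim.
Qed.

Lemma fourier_profile : exists KF : R,
  [/\ measurable_fun setT (fun xi => Normc.normc (fourier f xi) ^+ 2),
      (forall xi, 0 <= Normc.normc (fourier f xi) ^+ 2 <= KF),
      (\int[mu]_xi (Normc.normc (fourier f xi) ^+ 2)%:E = 1)%E &
      forall r, 0 < r ->
        (\int[mu]_xi (expR (- (r * enorm xi) ^+ 2) * Normc.normc (fourier f xi) ^+ 2)%:E <=
         heat_form r u u)%E].
Proof.
have -> : (fun xi => Normc.normc (fourier f xi) ^+ 2) = F.
  by apply/funext => xi; exact: fourier_radialE.
exists KF; split.
- exact: mF.
- by move=> xi; rewrite fourier_radialE; exact: F_bounds.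
- by rewrite -integral_F; apply: eq_integral => xi _; rewrite fourier_radialE.
- move=> r r0; apply: le_trans (gaussF_le r0); rewrite le_eqVlt; apply/orP; left; apply/eqP.
  by apply: eq_integral => xi _; rewrite fourier_radialE.
Qed.

End schwartz_radial.

Theorem theorem3 (R : realType) (d : nat) (hd : (1 <= d)%N) :
  exists c : R,
    forall f : 'rV[R]_d -> R[i],
      schwartz f ->
      radial f ->
      Lnorm (lebesgueRn d) 2%:E (fun x => (Normc.normc (f x))%:E) = 1%E ->
      (2%:E * \int[lebesgueRn d]_x
                (Normc.normc (f x) ^+ 2 * ln (Normc.normc (f x)))%:E
       + (d%:R - 1)%:E * \int[lebesgueRn d]_x
                (Normc.normc (f x) ^+ 2 * ln (enorm x))%:E
       <= \int[lebesgueRn d]_xi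
                (Normc.normc (fourier f xi) ^+ 2 * ln (enorm xi))%:E
          + c%:E)%E.
Proof.
case: d hd => // n _; have [c hc] := @entropy_frequency_le R n.
exists c => f fS fR f1.
have f2 : (\int[@lebesgueRn R n.+1]_x (Normc.normc (f x) ^+ 2)%:E = 1)%E.
  have two0 : (2 : R) != 0 by rewrite pnatr_eq0.
  have := poweR_Lnorm (@lebesgueRn R n.+1) (EFin \o (fun x => Normc.normc (f x))) two0.
  rewrite f1 poweR1r => ->; apply: eq_integral => x _ /=.
  by rewrite ger0_norm ?normc_ge0// powR_mulrn ?normc_ge0.
have f3 : (\int[@lebesgueRn R n.+1]_x (Normc.normc (f (enorm x *: axis n)) ^+ 2)%:E = 1)%E.
  by rewrite -f2; apply: eq_integral => x _; rewrite profileE.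
have [K [mF FK F1 gF]] := fourier_profile fS fR f3.
have := hc _ _ K (measurable_profile fS) (fun s => normc_ge0 _) (profile_decay fS) f3 mF FK F1 gF.
rewrite (_ : n.+1%:R - 1 = n%:R :> R); last by rewrite -natr1 addrK.
under eq_integral => x _ do rewrite profileE//.
under [X in (_ + _ * X)%E]eq_integral => x _ do rewrite profileE//.
by [].
Qed.
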